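(* Assume that conditions (a)–(f) of the context hold, that the foliation $\mathcal{F}$ of $\mathcal{M}$ is regular, and that $F_0$ has finite defect $m$. A non-empty subset $\mathcal{L}\subset\mathcal{M}$ is the graph of a locally self-adjoint extension of the operator $F_0$ if the following conditions are fulfilled: 1) $\mathcal{L}\cap\mathrm{graph}(F_0)\neq\emptyset$; 2) there exist a neighborhood $U(\mathcal{L})$ of $\mathcal{L}$ in $\mathcal{M}$ and a mapping $\Theta\in C^2(U(\mathcal{L}),\mathbf{R}^m)$ such that $$\mathcal{L}=\{\zeta\in U(\mathcal{L}):\ \Theta(\zeta)=0\}$$ and at each point $\zeta\in U(\mathcal{L})$ the following hold: $$\mathrm{Im}(\Theta'(\zeta))=\mathbf{R}^m,$$ $$\mathrm{Im}((\Theta'(\zeta))^* )\subset\mathcal{C}_\zeta,\qquad\text{where } \mathcal{C}_\zeta=T_\zeta(\mathcal{M})\cap J(T_\zeta(\mathcal{M})),$$ $$\Theta'(\zeta)\,J\,(\Theta'(\zeta))^*=0.$$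
   Context: **Spaces.** $\mathcal{H}$ is a real Hilbert space, $\mathcal{H}^2=\mathcal{H}\oplus\mathcal{H}$ is the orthogonal sum with inner product $(\cdot,\cdot)_2$, and $\mathrm{pr}_1,\mathrm{pr}_2$ are the projections on the two summands; write $h=\{\mathrm{pr}_1h,\mathrm{pr}_2h\}$. $J:\mathcal{H}^2\to\mathcal{H}^2$ is $Jh=\{-\mathrm{pr}_2h,\mathrm{pr}_1h\}$, and $j(h_1,h_2)=(Jh_1,h_2)_2$ is the (constant) symplectic form on $\mathcal{H}^2$. Tangent spaces of submanifolds of $\mathcal{H}^2$ are identified with closed subspaces of $\mathcal{H}^2$, with the induced inner product; $(\Theta'(\zeta))^*:\mathbf{R}^m\to T_\zeta(\mathcal{M})$ is the Hilbert space adjoint of $\Theta'(\zeta):T_\zeta(\mathcal{M})\to\mathbf{R}^m$. **Submanifolds and operators.** A $C^k$-submanifold is the range of an injective $C^k$-immersion; it is regular if the immersion is a homeomorphism onto its range with the induced topology. An operator $F$ in $\mathcal{H}$ with domain $\mathrm{Dom}(F)$ is graphically smooth if $\mathrm{graph}(F)$ is a $C^1$-submanifold of $\mathcal{H}^2$ and, for each $x\in\mathrm{Dom}(F)$, the tangent space to $\mathrm{graph}(F)$ at $\{x,F(x)\}$ is the graph of a linear operator $F'(x)$ (the graphic derivative). It is locally self-adjoint if it is graphically smooth and every $F'(x)$ is self-adjoint. $F$ is an extension of $F_0$ if $\mathrm{graph}(F_0)\subset\mathrm{graph}(F)$. **The operator $F_0$.** $F_0$ acts in $\mathcal{H}$ with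 $\mathrm{Dom}(F_0)=D_0+\{x_0\}$, where $D_0$ is a dense linear subset of $\mathcal{H}$ and $x_0\in\mathcal{H}$ is distinguished. At each $x\in\mathrm{Dom}(F_0)$, $F_0$ has a Gateaux derivative $F_0'(x)$ along $\mathrm{Dom}(F_0)$, which is a linear symmetric operator in $\mathcal{H}$ with domain $D_0$. $\mathbf{D}(x)$ is the closure of $F_0'(x)$. Conditions: (a) the field $x\mapsto\mathbf{D}(x)$ admits an extension to all $x\in\mathcal{H}$, again denoted $\mathbf{D}(x)$, consisting of symmetric operators; (b) there is a norm $\|\cdot\|_+$ on $D_0$ such that the completion $\mathcal{H}_+$ of $D_0$ in this norm is continuously embedded in $\mathcal{H}$ and, for each $x\in\mathcal{H}$, the norm $\|v\|_x=(\|\mathbf{D}(x)v\|^2+\|v\|^2)^{1/2}$ is equivalent to $\|v\|_+$; hence $\mathrm{Dom}(\mathbf{D}(x))=\mathcal{H}_+$ for all $x\in\mathcal{H}$; (c) $\mathbf{D}(\cdot)\in C(\mathcal{H},L(\mathcal{H}_+;\mathcal{H}))$. **Maximal extension.** For $x,h\in\mathcal{H}$, $v\in\mathcal{H}_+$ put $\Phi'(x)h(v)=(\mathbf{D}(x)v,h)$, so $\Phi'(x)\in L(\mathcal{H};\mathcal{H}_+^* )$; this field is integrable, and $\Phi(x)=f+\int_{x_0}^x\Phi'(u)\,du$ with $f(v)=(v,F_0(x_0))$. The maximal extension $\widetilde F$ of $F_0$ has domain $\widetilde D=\{x\in\mathcal{H}:\exists y\in\mathcal{H}\ \forall v\in\mathcal{H}_+\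 \Phi(x)(v)=(v,y)\}$, and $\widetilde F(x)=y$. Put $\mathcal{M}=\mathrm{graph}(\widetilde F)$. It is known that $\mathcal{M}$ is a regular $C^1$-submanifold of $\mathcal{H}^2$, that $T_\zeta(\mathcal{M})=\mathrm{graph}(\mathbf{D}(\mathrm{pr}_1\zeta)^* )$, and that $\widetilde D+\mathcal{H}_+=\widetilde D$. Further conditions: (d) the mapping $\zeta\mapsto\mathbf{D}(\mathrm{pr}_1\zeta)$ from $\mathcal{M}$ to $L(\mathcal{H}_+;\mathcal{H})$ has a linear Gateaux derivative at each $\zeta\in\mathcal{M}$; (e) for each fixed $\zeta\in\mathcal{M}$, $v\in\mathcal{H}_+$, the linear operator given by the derivative of $\mathbf{D}(\mathrm{pr}_1\zeta)v$, defined on $\mathrm{pr}_1(T_\zeta(\mathcal{M}))$, admits an extension to all of $\mathcal{H}$, denoted $\mathbf{D}'(\mathrm{pr}_1\zeta)(v,\cdot)$; (f) $\zeta\mapsto\mathbf{D}'(\mathrm{pr}_1\zeta)(\cdot,\cdot)$ is locally uniformly continuous from $\mathcal{M}$ to $L(\mathcal{H}_+,\mathcal{H};\mathcal{H})$ (bounded bilinear maps). Under (a)–(f), $\mathcal{M}$ is a regular $C^2$-submanifold of $\mathcal{H}^2$. **Foliation.** For $\zeta\in\mathcal{M}$, $v\in\mathcal{H}_+$ put $G(\zeta,v)=\{\mathrm{pr}_1\zeta+v,\widetilde F(\mathrm{pr}_1\zeta+v)\}\in\mathcal{M}$. Then $G(G(\zeta,v_1),v_2)=G(\zeta,v_1+v_2)$,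 and under (a)–(f) $G$ is of class $C^1$. The leaves $\Gamma_\zeta=\{G(\zeta,v):v\in\mathcal{H}_+\}$ partition $\mathcal{M}$ and form a $C^1$-foliation $\mathcal{F}=\{\Gamma_\zeta\}_{\zeta\in\mathcal{M}}$. Fibered charts near $\zeta_*\in\mathcal{M}$: take a regular $C^1$-submanifold $\mathcal{C}\ni\zeta_*$ of $\mathcal{M}$, modelled on a Banach space $B$, with $T_\xi(\Gamma_\xi)\oplus T_\xi(\mathcal{C})=T_\xi(\mathcal{M})$ for $\xi\in\mathcal{C}$, a chart $\phi:\widehat W\to W\subset B$ of $\mathcal{C}$ at $\zeta_*$, and a neighborhood $V$ of $0$ in $\mathcal{H}_+$ such that $\psi(v,\eta)=G(\phi^{-1}(\eta),v)$ is a $C^1$-diffeomorphism of $V\times W$ onto an open set $U\subset\mathcal{M}$; the sets $\psi(V\times\{\eta\})$, $\eta\in W$, are its sections. $\mathcal{F}$ is regular if near each point of $\mathcal{M}$ there is a fibered chart such that each leaf meets $U$ in at most one section. **Defect.** For a densely defined closed symmetric operator $A_0$ in $\mathcal{H}$, $\mathrm{def}(A_0)$ is the number $m$ with $\dim(\mathrm{graph}(A_0^* )\ominus\mathrm{graph}(A_0))=2m$. $F_0$ has finite defect $m$ if $\mathrm{def}(\mathbf{D}(x))=m<\infty$ for some $x\in\mathrm{Dom}(F_0)$ (equivalently, for all $x\in\mathcal{H}$).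
   Formalization: The neighborhood U(𝓛) is additionally required to contain graph(F_0); without this the claim fails (intersect 𝓛 and U(𝓛) with a ball), and the condition is necessary for 𝓛 to be the graph of an extension of F_0. *)

(* Defs.v *)
From HB Require Import structures.
From mathcomp Require Import all_boot all_order all_algebra.
From mathcomp Require Import all_classical all_reals all_analysis.

Set Implicit Arguments.
Unset Strict Implicit.
Unset Printing Implicit Defensive.

Import Order.TTheory GRing.Theory Num.Theory.
Import numFieldNormedType.Exports.

Local Open Scope classical_set_scope.
Local Open Scope ring_scope.

(* A real Hilbert space is a [completeNormedModType] [H] over a [realType] with
   a dot product [ip : {dot H for idfun}] such that [ip x x = `|x| ^+ 2].  On
   [H * H] the library norm is the max norm; it is equivalent to the norm of the
   orthogonal sum, and it is used only for the topology and for derivatives.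
   Orthogonality and adjoints refer to [dot2] below. *)

Section calculus.
Variable R : realType.

(* The library has no normed space of bounded (bi)linear maps, so bounds on
   operator norms are written out. *)
Definition opnorm_le (V W : normedModType R) (T : V -> W) (C : R) : Prop :=
  forall v, `|T v| <= C * `|v|.

Definition bounded_linear (V W : normedModType R) (T : V -> W) : Prop :=
  linear T /\ exists C, opnorm_le T C.

Definition binorm_le (U V W : normedModType R) (T : U -> V -> W) (C : R) : Prop :=
  forall u v, `|T u v| <= C * `|u| * `|v|.

Definition bounded_bilinear (U V W : normedModType R) (T : U -> V -> W) : Prop :=
  [/\ forall u, linear (T u), forall v, linear (T ^~ v) &
      exists C, binorm_le T C].

Inductive smoothness := C1 | C2.

Definition C1_on (V W : normedModType R) (O : set V) (f : V -> W) : Prop :=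
  forall x, O x -> differentiable f x /\
    forall e, 0 < e -> \forall y \near x,
      opnorm_le (fun h => 'd f y h - 'd f x h) e.

(* [d2f x k] is the derivative of [x |-> 'd f x] in the direction [k]. *)
Definition C2_on (V W : normedModType R) (O : set V) (f : V -> W) : Prop :=
  C1_on O f /\ exists d2f : V -> V -> V -> W, forall x, O x ->
    [/\ bounded_bilinear (d2f x),
        forall e, 0 < e -> \forall k \near (0 : V),
          opnorm_le (fun h => 'd f (x + k) h - 'd f x h - d2f x k h) (e * `|k|) &
        forall e, 0 < e -> \forall y \near x,
          binorm_le (fun k h => d2f y k h - d2f x k h) e].

Definition smooth_on (k : smoothness) (V W : normedModType R) (O : set V)
    (f : V -> W) : Prop :=
  match k with C1 => C1_on O f | C2 => C2_on O f end.

End calculus.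

Section manifolds.
Variable R : realType.

(* [cmap a], restricted to [cdom a], is the inverse of a chart in the usual
   sense.  As for an atlas on a set, the topology is the one for which the sets
   [cmap a @` O], with [O] open in [cdom a], form a base. *)
Record manifold (k : smoothness) := Manifold {
  carrier :> Type;
  chart_index : Type;
  model : chart_index -> completeNormedModType R;
  cdom : forall a, set (model a);
  cmap : forall a, model a -> carrier;
  cdom_open : forall a, open (@cdom a);
  cmap_inj : forall a, set_inj (@cdom a) (@cmap a);
  cmap_cover : forall p, exists a, (@cmap a @` @cdom a) p;
  transition : forall a a',
    let O := @cdom a `&` @cmap a @^-1` (@cmap a' @` @cdom a') in
    open O /\
    exists tau : model a -> model a', smooth_on k O tau /\
      forall b, O b -> @cdom a' (tau b) /\ @cmap a' (tau b) = @cmap a b }.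

Section submanifolds.
Variable E : normedModType R.

(* The targets considered are Hilbert spaces up to an equivalent norm, where
   every closed subspace splits. *)
Definition immersive_on (k : smoothness) (V : normedModType R) (O : set V)
    (f : V -> E) : Prop :=
  smooth_on k O f /\
  forall x, O x -> injective ('d f x) /\ closed (range ('d f x)).

Definition open_in (S U : set E) : Prop := exists2 W, open W & U = S `&` W.

Definition injective_immersion k (N : manifold k) (i : N -> E) : Prop :=
  injective i /\
  forall a : chart_index N, immersive_on k (@cdom k N a) (i \o @cmap k N a).

(* An immersion is continuous, so it is a homeomorphism onto its range as soon
   as it maps a base of open sets to relatively open sets. *)
Definition homeo_onto_range k (N : manifold k) (i : N -> E) : Prop :=
  forall (a : chart_index N) O, open O -> O `<=` @cdom k N a ->
    open_in (range i) ((i \o @cmap k N a) @` O).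

Definition regular_parametrization (S : set E) k (N : manifold k) (i : N -> E)
    : Prop :=
  [/\ injective_immersion i, homeo_onto_range i & range i = S].

Definition regular_submanifold (k : smoothness) (S : set E) : Prop :=
  exists (N : manifold k) (i : N -> E), regular_parametrization S i.

Definition tangent_image k (N : manifold k) (i : N -> E) (p : N) : set E :=
  [set t | exists (a : chart_index N) (b h : model a),
     [/\ cdom b, cmap b = p & t = 'd (i \o @cmap k N a) b h]].

(* The regular parametrizations of a set differ by a diffeomorphism, so they all
   give the same tangent space. *)
Definition tangent_space (S : set E) (z : E) : set E :=
  [set t | exists (N : manifold C1) (i : N -> E) (p : N),
     [/\ regular_parametrization S i, i p = z & tangent_image i p t]].

(* [f], restricted to [O], is a diffeomorphism onto an open subset of the
   regular submanifold [S]. *)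
Definition diffeo_onto_open (k : smoothness) (S : set E) (V : normedModType R)
    (O : set V) (f : V -> E) : Prop :=
  [/\ open O, immersive_on k O f, set_inj O f &
      forall O', open O' -> O' `<=` O -> open_in S (f @` O')].

Definition C2_map (S U : set E) (W : normedModType R) (f : E -> W) : Prop :=
  exists (N : manifold C2) (i : N -> E), regular_parametrization S i /\
    forall a : chart_index N,
      C2_on (@cdom C2 N a `&` (i \o @cmap C2 N a) @^-1` U)
            (f \o i \o @cmap C2 N a).

Definition curve_in (S : set E) (z : E) (g : R -> E) : Prop :=
  g 0 = z /\
  exists O : set R, [/\ open O, O 0, C1_on (O : set R^o) (g : R^o -> E) &
                        forall s, O s -> S (g s)].

(* [L] matters only on the tangent space of [S] at [z]. *)
Definition tangent_derivative (S : set E) (W : normedModType R) (f : E -> W)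
    (z : E) (L : E -> W) : Prop :=
  forall g, curve_in S z g -> is_derive (0 : R) 1 (f \o g) (L ('D_1 g (0 : R))).

Definition direct_sum (A B T : set E) : Prop :=
  T = [set a + b | a in A & b in B] /\ A `&` B = [set 0].

Definition has_dim (S : set E) (n : nat) : Prop :=
  exists e : 'I_n -> E,
    (forall a : 'I_n -> R, \sum_i a i *: e i = 0 -> forall i, a i = 0) /\
    S = [set z | exists a : 'I_n -> R, z = \sum_i a i *: e i].

End submanifolds.
End manifolds.

Section operators.
Variables (R : realType) (H : completeNormedModType R) (ip : {dot H for idfun}).

(* [app] is irrelevant outside [dom]. *)
Record operator := Operator { dom : set H; app :> H -> H }.

Definition graph (A : operator) : set (H * H) :=
  [set z | dom A z.1 /\ z.2 = A z.1].

Definition linear_subspace (S : set H) : Prop :=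
  S 0 /\ forall (a : R) u v, S u -> S v -> S (a *: u + v).

Definition linear_operator (A : operator) : Prop :=
  linear_subspace (dom A) /\
  forall (a : R) u v, dom A u -> dom A v -> A (a *: u + v) = a *: A u + A v.

Definition symmetric_operator (A : operator) : Prop :=
  forall u v, dom A u -> dom A v -> ip (A u) v = ip u (A v).

Definition adjoint_graph (A : operator) : set (H * H) :=
  [set z | forall u, dom A u -> ip (A u) z.1 = ip u z.2].

Definition self_adjoint (A : operator) : Prop :=
  [/\ linear_operator A, dense (dom A) & graph A = adjoint_graph A].

Definition dot2 (z w : H * H) : R := ip z.1 w.1 + ip z.2 w.2.

Definition J (z : H * H) : H * H := (- z.2, z.1).

Definition orthogonal_difference (S S' : set (H * H)) : set (H * H) :=
  [set z | S z /\ forall w, S' w -> dot2 z w = 0].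

Definition defect (A : operator) (m : nat) : Prop :=
  has_dim (orthogonal_difference (adjoint_graph A) (graph A)) (2 * m)%N.

Definition extension (F F0 : operator) : Prop := graph F0 `<=` graph F.

Definition graphic_derivative (F : operator) (dF : H -> operator) : Prop :=
  exists (N : manifold R C1) (i : N -> H * H),
    [/\ injective_immersion i, range i = graph F &
        forall p : N, linear_operator (dF (i p).1) /\
          tangent_image i p = graph (dF (i p).1)].

Definition graphically_smooth (F : operator) : Prop :=
  exists dF, graphic_derivative F dF.

Definition locally_self_adjoint (F : operator) : Prop :=
  exists dF, graphic_derivative F dF /\ forall x, dom F x -> self_adjoint (dF x).

End operators.

Section maximal_extension.
Variables (R : realType) (H : completeNormedModType R) (ip : {dot H for idfun}).
Variables (F0 : operator H) (D0 : set H) (x0 : H) (dF0 : H -> operator H).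
(* [Hp] is the completion of [D0] for the norm [|.|_+] and [iota] is its
   embedding in [H]; for [v] in [D0], [|v|_+] is the norm of [u] with
   [iota u = v]. *)
Variables (Hp : completeNormedModType R) (iota : Hp -> H).
Variable D : H -> operator H.

Definition initial_operator : Prop :=
  [/\ linear_subspace D0, dense D0, dom F0 = [set v + x0 | v in D0] &
      forall x, dom F0 x ->
        [/\ dom (dF0 x) = D0, linear_operator (dF0 x),
            symmetric_operator ip (dF0 x) &
            forall v, D0 v -> is_derive x v F0 (dF0 x v)]].

Definition condition_a : Prop :=
  (forall x, dom F0 x -> graph (D x) = closure (graph (dF0 x))) /\
  (forall x, linear_operator (D x) /\ symmetric_operator ip (D x)).

Definition embedded_completion : Prop :=
  [/\ linear iota, continuous iota, injective iota, D0 `<=` range iota &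
      dense (iota @^-1` D0)].

Definition condition_b : Prop :=
  embedded_completion /\
  forall x, dom (D x) = range iota /\
    exists c C : R, [/\ 0 < c, 0 < C & forall u, D0 (iota u) ->
      c * `|u| <= Num.sqrt (`|D x (iota u)| ^+ 2 + `|iota u| ^+ 2) <= C * `|u|].

Definition condition_c : Prop :=
  forall x, bounded_linear (fun u => D x (iota u)) /\
    forall e, 0 < e -> \forall y \near x,
      opnorm_le (fun u => D y (iota u) - D x (iota u)) e.

(* The field [x |-> (h |-> (D x v, h))] is integrable, so its integral from [x0]
   to [x] may be taken along the segment. *)
Definition Phi (x : H) (v : Hp) : R :=
  ip (iota v) (F0 x0) +
  \int[lebesgue_measure]_(t in `[0%R, 1%R])
    ip (D (x0 + t *: (x - x0)) (iota v)) (x - x0).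

Definition maximal_values (x : H) : set H :=
  [set y | forall v, Phi x v = ip (iota v) y].

(* There is at most one value, as [range iota] is dense. *)
Definition Fmax : operator H :=
  Operator [set x | maximal_values x !=set0] (fun x => get (maximal_values x)).

Definition maxgraph : set (H * H) := graph Fmax.

Definition condition_d (dD : H * H -> H * H -> Hp -> H) : Prop :=
  forall z, maxgraph z ->
    [/\ forall t, tangent_space maxgraph z t -> bounded_linear (dD z t),
        forall (a : R) s t v,
          tangent_space maxgraph z s -> tangent_space maxgraph z t ->
          dD z (a *: s + t) v = a *: dD z s v + dD z t v &
        forall g, curve_in maxgraph z g -> forall e, 0 < e ->
          \forall s \near (0 : R),
            opnorm_le (fun v => D (g s).1 (iota v) - D z.1 (iota v)
                                - s *: dD z ('D_1 g (0 : R)) v) (e * `|s|)].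

Definition condition_e (dD : H * H -> H * H -> Hp -> H)
    (D' : H -> Hp -> H -> H) : Prop :=
  forall z v, maxgraph z -> linear (D' z.1 v) /\
    forall t, tangent_space maxgraph z t -> D' z.1 v t.1 = dD z t v.

Definition condition_f (D' : H -> Hp -> H -> H) : Prop :=
  (forall z, maxgraph z -> bounded_bilinear (D' z.1)) /\
  forall z0, maxgraph z0 -> exists2 W : set (H * H), nbhs z0 W &
    forall e, 0 < e -> exists2 d, 0 < d &
      forall z w, (maxgraph `&` W) z -> (maxgraph `&` W) w -> `|z - w| < d ->
        binorm_le (fun v h => D' z.1 v h - D' w.1 v h) e.

Definition G (z : H * H) (v : Hp) : H * H :=
  (z.1 + iota v, Fmax (z.1 + iota v)).

Definition leaf (z : H * H) : set (H * H) := range (G z).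

(* The leaf is the injectively immersed image of [Hp] under [G z]. *)
Definition leaf_tangent (z : H * H) : set (H * H) := range ('d (G z) 0).

(* [W] and [p] are the image and the inverse of the chart of [C]. *)
Definition fibered_chart (z0 : H * H) (B : completeNormedModType R)
    (C : set (H * H)) (W : set B) (p : B -> H * H) (V : set Hp) : Prop :=
  [/\ C `<=` maxgraph /\ C z0,
      regular_submanifold C1 C,
      forall z, C z ->
        direct_sum (leaf_tangent z) (tangent_space C z)
          (tangent_space maxgraph z),
      diffeo_onto_open C1 C W p /\ (p @` W) z0 &
      V 0 /\
      diffeo_onto_open C1 maxgraph (V `*` W) (fun q : Hp * B => G (p q.2) q.1)].

Definition section_of (B : completeNormedModType R) (p : B -> H * H)
    (V : set Hp) (b : B) : set (H * H) := [set G (p b) v | v in V].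

Definition regular_foliation : Prop :=
  forall z0, maxgraph z0 ->
    exists (B : completeNormedModType R) C (W : set B) p V,
      fibered_chart z0 C W p V /\
      forall z b b', maxgraph z -> W b -> W b' ->
        leaf z `&` section_of p V b !=set0 ->
        leaf z `&` section_of p V b' !=set0 -> b = b'.

Definition finite_defect (m : nat) : Prop :=
  exists2 x, dom F0 x & defect ip (D x) m.

Definition characteristic_space (z : H * H) : set (H * H) :=
  tangent_space maxgraph z `&` @J R H @` tangent_space maxgraph z.

Definition is_adjoint (m : nat) (T : set (H * H)) (A : H * H -> 'rV[R]_m)
    (As : 'rV[R]_m -> H * H) : Prop :=
  forall a, T (As a) /\
    forall t, T t -> dot2 ip t (As a) = \sum_i A t 0 i * a 0 i.

End maximal_extension.

(* Main.v *)
Require Import Defs.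
From HB Require Import structures.
From mathcomp Require Import all_boot all_order all_algebra.
From mathcomp Require Import all_classical all_reals all_analysis.
From mathcomp Require Import ring lra.

Set Implicit Arguments.
Unset Strict Implicit.
Unset Printing Implicit Defensive.

Import Order.TTheory GRing.Theory Num.Theory.
Import numFieldNormedType.Exports.

Local Open Scope classical_set_scope.
Local Open Scope ring_scope.

(** Let [E] and [A] be the graphs of [D x] and of its adjoint at the first
    component [x] of a point [z] of [U], and let [C] be the defect space, the
    orthogonal complement of [E] in [A]; it has dimension [2 * m].  The range [N]
    of [dTheta' z] lies in [C] and has dimension [m].  The condition
    [dTheta z (J (dTheta' z a)) = 0] says that [J N] is orthogonal to [N], so that
    [C] is the sum of [N] and [J N] ([defect_decomposition]).  The tangent space
    of the zero set of [Theta] is the orthogonal complement [K] of [N] in [A],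
    hence [K = E + J N], and such a space is its own annihilator for the
    symplectic form ([kernel_part_lagrangian]).  A space with this property and a
    dense first projection is the graph of a self-adjoint operator.

    To make this an argument, the tangent space [T] of [M] has to be [A].  The
    inclusion of [T] in [A] comes from differentiating the equations
    [Phi x v = (v, y)] of [M] along curves ([curve_adjoint]); it rests on the fact
    that [Phi] is a potential of the field [x |-> (D x v, .)], which is read off
    from the symmetric operators [dF0 x] on the dense set [dom F0] ([Phi_diff]).
    The inclusion of [E] in [T] comes from the leaves: the fibered charts say that
    they contain smooth curves, whose velocities are then known ([leaf_curve]).
    Finally [A = E + N + J N], and all three summands are in [T]
    ([tangent_adjoint]).  Tangent spaces are compared through curves only
    ([curve_velocity]).

    The defect is prescribed at one point.  It is the same everywhere because
    [x |-> D x] is norm continuous into the bounded maps from [Hp] to [H], so that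
    nearby graphs are close, and because segments are connected
    ([defect_constant]).

    [Theta] is constant on [graph F0]: along the lines of [dom F0] the curves in
    [graph F0] are tangent to the leaves, and [dTheta] vanishes on [E], which is
    orthogonal to [N] ([graph_F0_zero]).

    That the zero set is a submanifold is the implicit function theorem
    ([zero_chart]).  The decomposition [K = E + J N] provides the model
    [Hp * 'rV_m] for all its charts ([zero_chart_ex]). *)

(** * Complete normed spaces *)

(* Declares the joins with pointed structures on which completeness builds. *)
HB.saturate prod.

Section complete_product.
Variables (R : realType) (U V : completeNormedModType R).

Fact prod_complete (F : set_system (U * V)) :
  ProperFilter F -> cauchy F -> cvg F.
Proof.
move=> FF /cauchy_ballP cF; apply/cvg_ex.
have c1 : cvg ((fst : U * V -> U) @ F).
  apply: cauchy_cvg; apply/cauchy_ballP => e e0; rewrite near_map2.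
  by apply: filterS (cF e e0) => -[a b] [].
have c2 : cvg ((snd : U * V -> V) @ F).
  apply: cauchy_cvg; apply/cauchy_ballP => e e0; rewrite near_map2.
  by apply: filterS (cF e e0) => -[a b] [].
case/cvg_ex : c1 => l1 h1; case/cvg_ex : c2 => l2 h2; exists (l1, l2).
apply/fcvg_ballP => e e0.
have {}h1 : F [set q | ball l1 e q.1] by apply: (cvg_ball h1 e0).
have {}h2 : F [set q | ball l2 e q.2] by apply: (cvg_ball h2 e0).
by apply: filterS2 h1 h2 => -[a b] /=.
Qed.

HB.instance Definition _ := Uniform_isComplete.Build (U * V)%type prod_complete.

End complete_product.

HB.instance Definition _ (R : realType) (m n : nat) :=
  Complete.copy 'M[R]_(m, n) 'M[R]_(m, n).

(** * Differential calculus in normed spaces *)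

Section calculus_tools.
Variable R : realType.
Implicit Types U V W : normedModType R.

Lemma near_distP V (x : V) (P : set V) :
  (\forall y \near x, P y) <-> exists2 d, 0 < d & forall y, `|y - x| < d -> P y.
Proof.
split => [/nbhs_normP[d /= d0 dP]|[d d0 dP]].
  by exists d => // y yx; apply: dP; rewrite /ball_/= distrC.
by apply/nbhs_normP; exists d => // y; rewrite /ball_/= distrC; exact: dP.
Qed.

Lemma open_nearP V (O : set V) :
  open O <-> forall x, O x -> exists2 d, 0 < d & forall y, `|y - x| < d -> O y.
Proof.
rewrite openE; split=> oO x Ox; first by apply/near_distP; exact: oO.
by apply/near_distP; exact: oO.
Qed.

Lemma dense_near (V : normedModType R) (S P : set V) (x : V) :
  dense S -> (\forall y \near x, P y) -> exists2 y, S y & P y.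
Proof.
move=> dS /near_distP[d d0 dP].
have [|y [yx Sy]] := dS (ball x d) _ (ball_open x d).
  by exists x; exact: ballxx.
by exists y => //; apply: dP; move: yx; rewrite -ball_normE/= distrC.
Qed.

Lemma open_dist_lt V (c : V) e : open [set x : V | `|x - c| < e].
Proof.
apply/open_nearP => x /= xc; exists (e - `|x - c|); first by rewrite subr_gt0.
move=> y yx; rewrite -(subrK x y) -addrA (le_lt_trans (ler_normD _ _))//.
by rewrite -ltrBrDr.
Qed.

Definition linear_of V W (f : V -> W) (lf : linear f) : {linear V -> W} :=
  HB.pack f (GRing.isLinear.Build R V W *:%R f lf).

Lemma opnorm_continuous V W (L : {linear V -> W}) C :
  opnorm_le L C -> continuous L.
Proof.
move=> LC; apply/(linear_bounded_continuous L)/linear_boundedP.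
apply: filterS (nbhs_pinfty_ge (num_real C)) => r Cr x.
by rewrite (le_trans (LC x))// ler_wpM2r.
Qed.

Lemma continuous_opnorm V W (L : {linear V -> W}) :
  continuous L -> exists2 C, 0 < C & opnorm_le L C.
Proof. exact: linear_lipschitz. Qed.

Lemma diff_near V W (f : V -> W) x : differentiable f x ->
  forall e, 0 < e ->
  \forall y \near x, `|f y - f x - 'd f x (y - x)| <= e * `|y - x|.
Proof.
move=> /diff_locally/eqaddoP df e /df/near_distP[d d0 dP]; apply/near_distP.
exists d => // y yx; have := dP (y - x); rewrite subr0 => /(_ yx).
by rewrite !fctE /= subrK opprD addrA.
Qed.

Lemma near_diff V W (f : V -> W) x (L : {linear V -> W}) : continuous L ->
  (forall e, 0 < e ->
     \forall y \near x, `|f y - f x - L (y - x)| <= e * `|y - x|) ->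
  differentiable f x /\ 'd f x = L :> (V -> W).
Proof.
move=> cL fL.
have E : f \o shift x = cst (f x) + L +o_ (0 : V) id.
  apply/eqaddoP => e e0; have /near_distP[d d0 dP] := fL e e0.
  apply/near_distP; exists d => // h; rewrite subr0 => hd.
  have := dP (h + x); rewrite addrK => /(_ hd).
  by rewrite !fctE /= opprD addrA.
have dE := diff_unique cL E.
split=> //; apply/diff_locallyP; split; first by rewrite dE.
by rewrite dE.
Qed.

Lemma near_eq_diff V W (f g : V -> W) x : (\forall y \near x, f y = g y) ->
  differentiable f x -> differentiable g x /\ 'd g x = 'd f x :> (V -> W).
Proof.
move=> fg df; have fgx : f x = g x by exact: nbhs_singleton fg.
apply: near_diff; first exact: diff_continuous.
move=> e e0; apply: filterS2 fg (diff_near df e0) => y.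
by rewrite fgx => ->.
Qed.

Lemma C1_differentiable V W (O : set V) (f : V -> W) x :
  C1_on O f -> O x -> differentiable f x.
Proof. by move=> fO /fO[]. Qed.

Lemma C1_continuous V W (O : set V) (f : V -> W) x :
  C1_on O f -> O x -> {for x, continuous f}.
Proof. by move=> fO /fO[/differentiable_continuous]. Qed.

Lemma C1_sub V W (O O' : set V) (f : V -> W) :
  O `<=` O' -> C1_on O' f -> C1_on O f.
Proof. by move=> OO' f1 x /OO'/f1. Qed.

Lemma C1_eq V W (O : set V) (f g : V -> W) :
  open O -> (forall x, O x -> f x = g x) -> C1_on O f -> C1_on O g.
Proof.
move=> oO fg f1 x Ox.
have nO y : O y -> \forall z \near y, f z = g z.
  by move=> Oy; apply: filterS (open_nbhs_nbhs (conj oO Oy)) => z; exact: fg.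
have [df cf] := f1 x Ox; have [dg gE] := near_eq_diff (nO x Ox) df.
split; first exact: dg.
move=> e e0; have Ox' := open_nbhs_nbhs (conj oO Ox).
apply: filterS2 Ox' (cf e e0) => y Oy fy h.
have [dfy _] := f1 y Oy; have [_ gyE] := near_eq_diff (nO y Oy) dfy.
have -> : 'd g y h = 'd f y h by exact: (congr1 (@^~ h) gyE).
have -> : 'd g x h = 'd f x h by exact: (congr1 (@^~ h) gE).
exact: fy.
Qed.

Lemma C1_linear V W (O : set V) (L : {linear V -> W}) :
  continuous L -> C1_on O L.
Proof.
move=> cL x _; split; first exact: linear_differentiable.
move=> e e0; near=> y => h.
by rewrite !diff_lin// subrr normr0 mulr_ge0// ltW.
Unshelve. all: by end_near. Qed.

Lemma C1_cst V W (O : set V) (a : W) : C1_on O (cst a : V -> W).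
Proof.
move=> x _; split; first exact: differentiable_cst.
move=> e e0; near=> y => h.
by rewrite !diff_cst subrr normr0 mulr_ge0// ltW.
Unshelve. all: by end_near. Qed.

Lemma C1_add V W (O : set V) (f g : V -> W) :
  C1_on O f -> C1_on O g -> open O -> C1_on O (f + g).
Proof.
move=> f1 g1 oO x Ox; have [df cf] := f1 x Ox; have [dg cg] := g1 x Ox.
split; first exact: differentiableD.
move=> e e0; have e20 : 0 < e / 2 by rewrite divr_gt0.
have Ox' := open_nbhs_nbhs (conj oO Ox).
apply: filterS3 Ox' (cf _ e20) (cg _ e20) => y Oy fy gy h.
have [dfy _] := f1 y Oy; have [dgy _] := g1 y Oy.
have -> : 'd (f + g) y h = 'd f y h + 'd g y h.
  exact: (congr1 (@^~ h) (diffD dfy dgy)).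
have -> : 'd (f + g) x h = 'd f x h + 'd g x h.
  exact: (congr1 (@^~ h) (diffD df dg)).
rewrite opprD addrACA (splitr e) mulrDl.
apply: le_trans (ler_normD _ _) _; exact: lerD (fy h) (gy h).
Qed.

Lemma C1_comp U V W (O : set U) (O' : set V) (f : U -> V) (g : V -> W) :
  C1_on O f -> C1_on O' g -> open O -> open O' ->
  C1_on (O `&` f @^-1` O') (g \o f).
Proof.
move=> f1 g1 oO oO' x [Ox Ofx].
have [df cf] := f1 x Ox; have [dg cg] := g1 (f x) Ofx.
split; first exact: differentiable_comp.
have [K K0 fK] := continuous_opnorm (diff_continuous df).
have [M M0 gM] := continuous_opnorm (diff_continuous dg).
move=> e e0.
(* The half [e / 2] allowed for the variation of ['d g] is met with [e1], as
   ['d f y] is bounded by [K + 1]; the other half is met with [e2]. *)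
pose e1 := e / 2 / (K + 1); pose e2 := Num.min 1 (e / 2 / M).
have K10 : 0 < K + 1 by rewrite addr_gt0.
have e10 : 0 < e1 by rewrite !divr_gt0.
have e20 : 0 < e2 by rewrite lt_min ltr01 !divr_gt0.
have fx : {for x, continuous f} by exact: differentiable_continuous.
have ng := fx _ (cg e1 e10).
have nO := fx _ (open_nbhs_nbhs (conj oO' Ofx)).
near=> y => h.
have Oy : O y by near: y; exact: open_nbhs_nbhs.
have Ofy : O' (f y) by near: y.
have [dfy _] := f1 y Oy; have [dgy _] := g1 _ Ofy.
rewrite (diff_comp dfy dgy) (diff_comp df dg) /=.
have Hf : `|'d f y h - 'd f x h| <= e2 * `|h|.
  by move: h; near: y; exact: cf.
have Hg k : `|'d g (f y) k - 'd g (f x) k| <= e1 * `|k|.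
  by move: k; near: y; exact: ng.
have Hy : `|'d f y h| <= (K + 1) * `|h|.
  rewrite -(subrK ('d f x h) ('d f y h)) (le_trans (ler_normD _ _))//.
  rewrite [_ + 1]addrC mulrDl lerD// (le_trans Hf)// ler_wpM2r//.
  by rewrite ge_min lexx.
rewrite -(subrK ('d g (f x) ('d f y h)) ('d g (f y) ('d f y h))) -addrA -linearB.
rewrite (le_trans (ler_normD _ _))// (splitr e) mulrDl lerD//.
  rewrite (le_trans (Hg _))// (le_trans (ler_wpM2l (ltW e10) Hy))//.
  by rewrite mulrA divfK// gt_eqF.
rewrite (le_trans (gM _))// (le_trans (ler_wpM2l (ltW M0) Hf))//.
rewrite mulrA ler_wpM2r// -ler_pdivlMl// mulrC ge_min.
by rewrite [e / 2 * _]mulrC mulrC lexx orbT.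
Unshelve. all: by end_near. Qed.

End calculus_tools.

Section derivatives_along_lines.
Variable R : realType.
Implicit Types V W : normedModType R.

Lemma is_derive_nearP V (g : R -> V) (s : R) (t : V) :
  is_derive s 1 g t <->
  forall e, 0 < e ->
    \forall h \near s, `|g h - g s - (h - s) *: t| <= e * `|h - s|.
Proof.
split=> [[dg gt] e e0|gt].
  have /derivable1_diffP dg' := dg.
  apply: filterS (diff_near dg' e0) => h.
  have -> : 'd g s (h - s) = (h - s) *: t; last by [].
  have -> : 'd g s (h - s) = (h - s) *: 'd g s 1.
    by rewrite -linearZ [_ *: 1]mulr1.
  by rewrite -gt; congr (_ *: _); exact/esym/deriveE.
have [dg gE] : differentiable g s /\ 'd g s = ( *:%R^~ t) :> (R -> V).
  have lt : linear ( *:%R^~ t : R -> V).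
    by move=> a u v; rewrite /= scalerDl -scalerA.
  apply: (near_diff (L := linear_of lt)) => //; exact: scalel_continuous.
split; first exact: diff_derivable.
by rewrite deriveE// gE scale1r.
Qed.

Lemma is_derive_linear V W (L : {linear V -> W}) (g : R -> V) (s : R) (t : V) :
  continuous L -> is_derive s 1 g t -> is_derive s 1 (L \o g) (L t).
Proof.
move=> /continuous_opnorm[C C0 LC] /is_derive_nearP gt.
apply/is_derive_nearP => e e0; have eC : 0 < e / C by rewrite divr_gt0.
apply: filterS (gt _ eC) => h hs /=.
rewrite -linearZ -!linearB (le_trans (LC _))// -ler_pdivlMl//.
by rewrite mulrA [C^-1 * e]mulrC.
Qed.

Lemma is_derive_diff_comp V W (f : V -> W) (g : R -> V) (s : R) (t : V) :
  differentiable f (g s) -> is_derive s 1 g t ->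
  is_derive s 1 (f \o g) ('d f (g s) t).
Proof.
move=> df [/derivable1_diffP dg gt].
have dfg : differentiable (f \o g) s by exact: differentiable_comp.
split; first exact: diff_derivable.
by rewrite deriveE// (diff_comp dg df) /= -gt; congr ('d f _ _); exact/esym/deriveE.
Qed.

Lemma is_derive_line V (y k : V) (t : R) :
  is_derive t 1 (fun s : R => y + s *: k) k.
Proof.
apply/is_derive_nearP => e e0; near=> h.
rewrite opprD addrACA subrr add0r scalerBl subrr normr0 mulr_ge0//.
exact: ltW.
Unshelve. all: by end_near. Qed.

Lemma is_derive_diff_line V W (f : V -> W) (y k : V) (t : R) :
  differentiable f (y + t *: k) ->
  is_derive t 1 (fun s : R => f (y + s *: k)) ('d f (y + t *: k) k).
Proof.
move=> df; apply: (is_derive_diff_comp (g := fun s => y + s *: k)) => //.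
exact: is_derive_line.
Qed.

Lemma C1_line V (y k : V) : C1_on (setT : set R) (fun s => y + s *: k).
Proof.
have ll : linear (fun s : R => s *: k).
  by move=> r s t; rewrite scalerDl scalerA.
have cl : continuous (linear_of ll) by move=> s; apply: cvgZl; exact: cvg_id.
have H1 : C1_on (setT : set R) (cst y : R -> V) by exact: C1_cst.
by have := C1_add H1 (C1_linear (O := setT) cl) openT.
Qed.

Lemma ball_line V (b x y : V) d (t : R) : 0 <= t <= 1 ->
  `|x - b| < d -> `|y - b| < d -> `|y + t *: (x - y) - b| < d.
Proof.
move=> /andP[t0 t1] xb yb.
have -> : y + t *: (x - y) - b = t *: (x - b) + (1 - t) *: (y - b).
  have -> : x - y = (x - b) - (y - b) by rewrite opprB addrA subrK.
  by rewrite addrAC scalerBr scalerBl scale1r addrCA.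
set M := Num.max `|x - b| `|y - b|.
have Md : M < d by rewrite gt_max xb yb.
apply: le_lt_trans Md; rewrite (le_trans (ler_normD _ _))// !normrZ.
rewrite (ger0_norm t0) ger0_norm ?subr_ge0//.
rewrite -[M]mul1r -[X in X * M](subrK t) addrC [leRHS]mulrDl lerD//.
  by rewrite ler_wpM2l ?subr_ge0// le_max lexx orbT.
by rewrite ler_wpM2l// le_max lexx.
Qed.

Lemma coord_linear n (j : 'I_n) : linear (fun v : 'rV[R]_n => v 0 j).
Proof. by move=> a u v; rewrite !mxE. Qed.

Lemma rV_coord_le n (v : 'rV[R]_n) j : `|v 0 j| <= `|v|.
Proof.
rewrite [leRHS]/Num.norm/= mx_normrE.
exact: (le_bigmax _ (fun ij => `|v ij.1 ij.2|) (0, j)).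
Qed.

Lemma rV_norm_le n (v : 'rV[R]_n) C : 0 <= C ->
  (forall j, `|v 0 j| <= C) -> `|v| <= C.
Proof.
move=> C0 vC; rewrite [leLHS]/Num.norm/= mx_normrE.
by apply/bigmax_leP; split=> // -[i j] _; rewrite /= ord1.
Qed.

(** For the maximum norm of ['rV_n] the mean value inequality can be read off
    coordinate by coordinate from the mean value theorem for real functions. *)
Lemma mean_value_rV V n (f : V -> 'rV[R]_n) b d e : 0 <= e ->
  (forall x, `|x - b| < d -> differentiable f x /\ opnorm_le ('d f x) e) ->
  forall x y, `|x - b| < d -> `|y - b| < d -> `|f x - f y| <= e * `|x - y|.
Proof.
move=> e0 fP x y xb yb; apply: rV_norm_le => [|j]; first by rewrite mulr_ge0.
pose g (t : R) : R := f (y + t *: (x - y)) 0 j.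
have dg (t : R) : 0 <= t <= 1 ->
    is_derive t 1 g ('d f (y + t *: (x - y)) (x - y) 0 j).
  move=> t01; have [df _] := fP _ (ball_line t01 xb yb).
  apply: (is_derive_linear (L := linear_of (@coord_linear n j))
    (g := fun t : R => f (y + t *: (x - y)))).
    exact: coord_continuous.
  exact: is_derive_diff_line.
have [t] : exists2 t : R, t \in `[0, 1]%R &
    g 1 - g 0 = 'd f (y + t *: (x - y)) (x - y) 0 j * (1 - 0).
  apply: (@MVT_segment _ g (fun t : R => 'd f (y + t *: (x - y)) (x - y) 0 j)) => //.
    by move=> t /[!in_itv]/= /andP[t0 t1]; apply: dg; rewrite !ltW.
  apply: derivable_within_continuous => t /[!in_itv]/= t01.
  by have [] := dg t t01.
rewrite in_itv/= => t01; rewrite subr0 mulr1 /g scale1r scale0r addr0.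
rewrite [y + _]addrC subrK => gE; rewrite !mxE gE.
have [_ fe] := fP _ (ball_line t01 xb yb).
exact: le_trans (rV_coord_le _ _) (fe _).
Qed.

(** Difference quotients in the direction [h] converge to the differential. *)
Lemma lipschitz_opnorm V W (f : V -> W) x d C : 0 < d -> differentiable f x ->
  (forall y, `|y - x| < d -> `|f y - f x| <= C * `|y - x|) ->
  opnorm_le ('d f x) C.
Proof.
move=> d0 df fC h; apply/ler_addgt0Pr => e e0.
have [->|h0] := eqVneq h 0; first by rewrite linear0 !normr0 mulr0 add0r ltW.
have nh : 0 < `|h| by rewrite normr_gt0.
have e10 : 0 < e / `|h| by rewrite divr_gt0.
have /near_distP[d' d'0 dP] := diff_near df e10.
pose s := Num.min d d' / 2 / `|h|.
have m0 : 0 < Num.min d d' by rewrite lt_min d0 d'0.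
have s0 : 0 < s by rewrite !divr_gt0.
have sh : `|s *: h| < Num.min d d'.
  by rewrite normrZ gtr0_norm// divfK ?gt_eqF// ltr_pdivrMr// ltr_pMr// ltr1n.
have md : Num.min d d' <= d by rewrite ge_min lexx.
have md' : Num.min d d' <= d' by rewrite ge_min lexx orbT.
have := dP (x + s *: h); have := fC (x + s *: h); rewrite [x + _]addrC addrK => H1 H2.
have {}H1 := H1 (lt_le_trans sh md).
have {}H2 := H2 (lt_le_trans sh md').
rewrite -(ler_pM2l s0) -[s in leLHS]gtr0_norm// -normrZ -linearZ.
set z := f _ - f x in H1 H2.
rewrite -[X in `|X|](subKr z) (le_trans (ler_normB _ _))// mulrDr lerD//.
  by rewrite (le_trans H1)// normrZ gtr0_norm// mulrCA.
by rewrite (le_trans H2)// normrZ gtr0_norm// mulrCA divfK// gt_eqF.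
Qed.

End derivatives_along_lines.

(** * Inverse functions and zero sets *)

Section perturbed_identity.
Variables (R : realType) (X : completeNormedModType R).

(** The solution is the fixed point of the contraction [x |-> y + r x], which
    maps the closed ball into itself. *)
Lemma contraction_solve (r : X -> X) b d y : 0 <= d ->
  (forall u v, `|u - b| <= d -> `|v - b| <= d ->
     `|r u - r v| <= 2^-1 * `|u - v|) ->
  `|y + r b - b| <= d / 2 -> exists2 x, `|x - b| <= d & x = y + r x.
Proof.
move=> d0 rP yb; pose U : set X := [set x | `|x - b| <= d].
have bU : U b by rewrite /U/= subrr normr0.
pose g x := y + r x.
have gU : set_fun U U g.
  move=> x Ux; rewrite /U/= /g -(subrK (r b) (r x)) addrCA -addrA.
  rewrite (le_trans (ler_normD _ _))// (splitr d) lerD//.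
  by rewrite (le_trans (rP _ _ Ux bU))// [leRHS]mulrC ler_pM2l.
have clU : closed U.
  apply: (@closed_comp _ _ (fun x => `|x - b|) [set t | t <= d]).
    by move=> x _; apply: cvg_norm; apply: cvgB => //; exact: cvg_cst.
  exact: closed_le.
pose gf : {fun U >-> U} := HB.pack g (isFun.Build _ _ U U g gU).
have [||x Ux xg] := @banach_fixed_point R X U gf _ clU; last by exists x.
  have h0 : 0 <= 2^-1 :> R by rewrite invr_ge0.
  exists (NngNum h0); split=> [/=|[u v] [/= Uu Uv]].
    by rewrite invf_lt1// ltr1n.
  by rewrite /g opprD addrACA subrr add0r; exact: rP.
by exists b.
Qed.

(** The Neumann series of [L], obtained as the fixed points of
    [x |-> y + (x - L x)]; [M] is bounded since [L] is bounded below. *)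
Lemma near_id_inverse (L : {linear X -> X}) :
  (forall h, `|h - L h| <= 2^-1 * `|h|) ->
  exists M : {linear X -> X},
    [/\ cancel M L, cancel L M & opnorm_le M 2].
Proof.
move=> LP.
have lowL h : `|h| <= 2 * `|L h|.
  have : `|h| <= 2^-1 * `|h| + `|L h|.
    by rewrite -{1}(subrK (L h) h) (le_trans (ler_normD _ _))// lerD2r.
  by lra.
have injL : injective L.
  move=> u v /eqP; rewrite -subr_eq0 -linearB => /eqP Luv.
  apply/eqP; rewrite -subr_eq0 -normr_eq0 eq_le normr_ge0 andbT.
  by rewrite (le_trans (lowL _))// Luv normr0 mulr0.
have surjL y : exists x, L x = y.
  have [|||x _ xE] := @contraction_solve (fun h => h - L h) 0 (2 * `|y|) y.
  - by rewrite mulr_ge0.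
  - move=> u v _ _; rewrite opprD addrACA -opprD -linearN -linearD; exact: LP.
  - by rewrite linear0 !subr0 addr0 mulrAC divff ?mul1r.
  exists x; move: xE; rewrite addrCA -{1}[x]addr0.
  by move=> /addrI/esym/subr0_eq/esym.
pose M y := xget 0 [set x | L x = y].
have LM y : L (M y) = y.
  by have [x Lx] := surjL y; rewrite /M; case: xgetP => [z _ //|/(_ x)].
have linM : linear M.
  by move=> a u v; apply: injL; rewrite linearP !LM.
exists (linear_of linM); split=> [y|h|y] /=; first exact: LM.
  by apply: injL; rewrite LM.
by rewrite -{2}(LM y) lowL.
Qed.

(** A map that differs from the identity by a [1/2]-Lipschitz map near [b] is a
    local diffeomorphism at [b]: the equation [Xi x = y] is solved by the
    contraction [x |-> y + (x - Xi x)], and [Xi] shrinks distances at most by a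
    factor 2, which makes the inverse Lipschitz and then differentiable. *)
Lemma local_inverse (Xi : X -> X) b d : 0 < d ->
  C1_on [set x | `|x - b| < d] Xi ->
  (forall u v, `|u - b| < d -> `|v - b| < d ->
     `|(u - Xi u) - (v - Xi v)| <= 2^-1 * `|u - v|) ->
  exists sigma : X -> X,
    [/\ forall y, `|y - Xi b| < d / 8 ->
          `|sigma y - b| < d /\ Xi (sigma y) = y,
        forall x, `|x - b| < d -> `|Xi x - Xi b| < d / 8 -> sigma (Xi x) = x,
        C1_on [set y | `|y - Xi b| < d / 8] sigma &
        forall y k, `|y - Xi b| < d / 8 ->
          'd sigma y ('d Xi (sigma y) k) = k].
Proof.
move=> d0 Xi1 XiP.
have d8 : 0 < d / 8 by rewrite divr_gt0.
have low u v : `|u - b| < d -> `|v - b| < d ->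
    `|u - v| <= 2 * `|Xi u - Xi v|.
  move=> ub vb; have := XiP u v ub vb.
  have : `|u - v| <= `|u - Xi u - (v - Xi v)| + `|Xi u - Xi v|.
    have -> : u - Xi u - (v - Xi v) = (u - v) - (Xi u - Xi v).
      by rewrite !opprB [Xi v - v]addrC addrACA [- Xi u + _]addrC.
    by rewrite -{1}(subrK (Xi u - Xi v) (u - v)) ler_normD.
  by lra.
(* The contraction is used on the closed ball of radius [d / 4], where it can
   solve for [y] up to distance [d / 8]. *)
have ex y : `|y - Xi b| < d / 8 -> exists x, `|x - b| < d /\ Xi x = y.
  move=> yb; have [|||x xb xE] :=
    @contraction_solve (fun x => x - Xi x) b (d / 4) y.
  - by rewrite divr_ge0// ltW.
  - move=> u v ub vb; apply: XiP; [apply: le_lt_trans ub _|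
      apply: le_lt_trans vb _]; lra.
  - rewrite addrCA [b + _]addrC addrK; lra.
  exists x; split; first by apply: le_lt_trans xb _; lra.
  move: xE; rewrite addrCA -{1}[x]addr0.
  by move=> /addrI/esym/subr0_eq/esym.
pose sigma y := xget b [set x | `|x - b| < d /\ Xi x = y].
have sP y : `|y - Xi b| < d / 8 -> `|sigma y - b| < d /\ Xi (sigma y) = y.
  by move=> /ex[x xP]; rewrite /sigma; case: xgetP => [z _ //|/(_ x)].
have sXi x : `|x - b| < d -> `|Xi x - Xi b| < d / 8 -> sigma (Xi x) = x.
  move=> xb /sP[sb sE]; apply/eqP; rewrite -subr_eq0 -normr_eq0 eq_le.
  by rewrite normr_ge0 andbT (le_trans (low _ _ sb xb))// sE subrr normr0 mulr0.
have slip y y' : `|y - Xi b| < d / 8 -> `|y' - Xi b| < d / 8 ->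
    `|sigma y - sigma y'| <= 2 * `|y - y'|.
  move=> /sP[sb sE] /sP[sb' sE'].
  by rewrite (le_trans (low _ _ sb sb'))// sE sE'.
have inv x : `|x - b| < d -> exists M : {linear X -> X},
    [/\ cancel M ('d Xi x), cancel ('d Xi x) M & opnorm_le M 2].
  move=> xb; apply: near_id_inverse => h.
  have [dXi _] := Xi1 x xb.
  have dr : differentiable (id - Xi) x by exact: differentiableB.
  have /near_distP[e e0 eP] : \forall y \near x, `|y - b| < d.
    by apply: open_nbhs_nbhs; split=> //; exact: open_dist_lt.
  have idd : differentiable (id : X -> X) x by exact: ex_diff.
  have did : 'd (id : X -> X) x = id :> (X -> X) by exact: diff_val.
  have E : 'd (id - Xi) x h = h - 'd Xi x h.
    apply: etrans (congr1 (@^~ h) (diffB idd dXi)) _.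
    exact: (congr1 (fun k : X -> X => k h - 'd Xi x h) did).
  have lip : opnorm_le ('d (id - Xi) x) 2^-1.
    apply: (lipschitz_opnorm e0 dr) => y yx.
    by apply: XiP => //; exact: eP.
  by rewrite -E; exact: lip.
have dS y (M : {linear X -> X}) : `|y - Xi b| < d / 8 ->
    cancel M ('d Xi (sigma y)) -> cancel ('d Xi (sigma y)) M ->
    opnorm_le M 2 ->
    differentiable sigma y /\ 'd sigma y = M :> (X -> X).
  move=> yb M1 M2 MC; apply: near_diff; first exact: opnorm_continuous MC.
  move=> e e0; have [sb sE] := sP y yb; have [dXi _] := Xi1 _ sb.
  have e40 : 0 < e / 4 by rewrite divr_gt0.
  have /near_distP[d1 d10 d1P] := diff_near dXi e40.
  have ny : \forall z \near y, `|z - Xi b| < d / 8.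
    by apply: open_nbhs_nbhs; split=> //; exact: open_dist_lt.
  have d20 : 0 < d1 / 2 by rewrite divr_gt0.
  have nz : \forall z \near y, `|z - y| < d1 / 2.
    by apply: open_nbhs_nbhs; split; [exact: open_dist_lt|rewrite /= subrr normr0].
  apply: filterS2 ny nz => z zb zy; have [szb szE] := sP z zb.
  have ss : `|sigma z - sigma y| <= 2 * `|z - y| by exact: slip.
  have sd : `|sigma z - sigma y| < d1 by apply: le_lt_trans ss _; lra.
  have := d1P _ sd; rewrite szE sE => H.
  rewrite -{1}(M2 (sigma z - sigma y)) -linearB (le_trans (MC _))//.
  rewrite distrC; apply: le_trans (_ : 2 * (e / 4 * (2 * `|z - y|)) <= _).
    by rewrite ler_pM2l// (le_trans H)// ler_pM2l.
  by rewrite le_eqVlt; apply/orP; left; apply/eqP; field.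
exists sigma; split => //.
- move=> y yb; have [sb sE] := sP y yb; have [M [M1 M2 MC]] := inv _ sb.
  have [ds dsE] := dS y M yb M1 M2 MC; split=> // e e0.
  have [dXi cXi] := Xi1 _ sb.
  have e40 : 0 < e / 4 by rewrite divr_gt0.
  have cs : {for y, continuous sigma} by exact: differentiable_continuous.
  have n1 := cs _ (cXi _ e40).
  have ny : \forall z \near y, `|z - Xi b| < d / 8.
    by apply: open_nbhs_nbhs; split=> //; exact: open_dist_lt.
  apply: filterS2 ny n1 => z zb /= zP h; have [szb szE] := sP z zb.
  have [M' [M1' M2' MC']] := inv _ szb.
  have [_ ->] := dS z M' zb M1' M2' MC'; rewrite dsE.
  rewrite -(M2' (M h)) -{1}(M1 h) -linearB (le_trans (MC' _))//.
  rewrite distrC; apply: le_trans (_ : 2 * (e / 4 * (2 * `|h|)) <= _).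
    by rewrite ler_pM2l// (le_trans (zP _))// ler_pM2l.
  by rewrite le_eqVlt; apply/orP; left; apply/eqP; field.
- move=> y k yb; have [sb sE] := sP y yb; have [M [M1 M2 MC]] := inv _ sb.
  by have [_ ->] := dS y M yb M1 M2 MC; rewrite M2.
Qed.

End perturbed_identity.

Section zero_set.
Variables (R : realType) (X Y : completeNormedModType R) (m : nat).

(** The map [Xi : x |-> x + B (theta x - 'd theta b x)] has the identity as its
    differential at [b] and turns the zero set of [theta] into the affine space
    [Xi b + ker ('d theta b)], which [Q] and [P] identify with the prescribed
    model [Y].  The local inverse of [Xi] therefore parametrizes the zero set. *)
Lemma zero_chart (theta : X -> 'rV[R]_m) (O : set X) (b : X)
    (B : {linear 'rV[R]_m -> X}) (Q : {linear Y -> X}) (P : {linear X -> Y}) :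
  open O -> O b -> C1_on O theta -> theta b = 0 ->
  continuous B -> continuous Q -> continuous P ->
  (forall a, 'd theta b (B a) = a) ->
  cancel Q P -> (forall q, 'd theta b (Q q) = 0) ->
  (forall x, 'd theta b x = 0 -> Q (P x) = x) ->
  exists (Om : set X) (W : set Y) (chi : Y -> X) (rho : X -> Y),
    [/\ [/\ open Om, Om b, Om `<=` O & open W],
        C1_on W chi, C1_on Om rho,
        forall q, W q -> [/\ Om (chi q), theta (chi q) = 0, rho (chi q) = q,
          injective ('d chi q) &
          range ('d chi q) = [set k | 'd theta (chi q) k = 0]] &
        forall x, Om x -> theta x = 0 -> W (rho x) /\ chi (rho x) = x].
Proof.
move=> oO Ob th1 thb cB cQ cP AB QP AQ QPA.
have [dthb cthb] := th1 b Ob.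
have [A AE cA] : exists2 A : {linear X -> 'rV[R]_m},
    'd theta b = A & continuous A.
  by exists ('d theta b) => //; exact: diff_continuous.
rewrite AE in cthb AB AQ QPA.
pose f : X -> 'rV[R]_m := theta - (A : X -> 'rV[R]_m).
pose Xi : X -> X := id + (B \o f).
have AXi x : A (Xi x) = theta x.
  by rewrite /Xi/= linearD AB /f/= addrC subrK.
have f1 : C1_on O f.
  have lNA : linear (- (A : X -> 'rV[R]_m) : X -> 'rV[R]_m).
    by move=> a u v; rewrite !fctE linearP opprD scalerN.
  have cNA : continuous (linear_of lNA) by move=> x; exact/continuousN/cA.
  exact: (C1_add th1 (C1_linear cNA) oO).
have df x : O x -> differentiable f x /\
    'd f x = (fun h => 'd theta x h - A h) :> (X -> 'rV[R]_m).
  move=> Ox; have [dth _] := th1 x Ox; have [dfx _] := f1 x Ox; split=> //.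
  have dA : differentiable A x by exact: linear_differentiable.
  have E1 := diffB dth dA.
  have E2 := diff_lin x cA.
  transitivity ('d theta x \- 'd A x); first exact: E1.
  apply/funext => h /=.
  congr (_ - _).
  exact: (congr1 (@^~ h) E2).
(* Where ['d theta] varies by at most [(2 * CB)^-1], the map [B \o f] is
   [1/2]-Lipschitz. *)
have [CB CB0 BC] := continuous_opnorm cB.
have e0 : 0 < (2 * CB)^-1 by rewrite invr_gt0 mulr_gt0.
have nO : \forall x \near b, O x by exact: open_nbhs_nbhs.
have := cthb _ e0; move/(filterI nO)/near_distP => [d d0 dP].
have Xi1 : C1_on O Xi.
  have idc : continuous (idfun : {linear X -> X}) by move=> x; exact: cvg_id.
  have := C1_comp f1 (C1_linear (O := setT) cB) oO openT.
  rewrite preimage_setT setIT => Bf1.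
  exact: (C1_add (C1_linear idc) Bf1 oO).
have dXi x : O x -> 'd Xi x = (fun h => h + B ('d theta x h - A h)) :> (X -> X).
  move=> Ox; have [dfx dfE] := df x Ox.
  have dBf : differentiable (B \o f) x.
    by apply: differentiable_comp => //; exact: linear_differentiable.
  have did : 'd (id : X -> X) x = id :> (X -> X) by exact: diff_val.
  have idd : differentiable (id : X -> X) x by exact: ex_diff.
  have E1 := diffD idd dBf.
  transitivity ('d (id : X -> X) x \+ 'd (B \o f) x); first exact: E1.
  have dB : differentiable B (f x) by exact: linear_differentiable.
  have E2 := diff_comp dfx dB.
  have E3 := diff_lin (f x) cB.
  apply/funext => h /=; congr (_ + _); first exact: (congr1 (@^~ h) did).
  apply: etrans (congr1 (@^~ h) E2) _.
  apply: etrans (congr1 (@^~ _) E3) _.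
  exact: (congr1 (B \o @^~ h) dfE).
have XiP u v : `|u - b| < d -> `|v - b| < d ->
    `|(u - Xi u) - (v - Xi v)| <= 2^-1 * `|u - v|.
  move=> ub vb; have E x : x - Xi x = - B (f x).
    by rewrite /Xi/= opprD addrA subrr add0r.
  rewrite !E -opprD normrN -linearN -linearD (le_trans (BC _))//.
  have H : `|f u - f v| <= (2 * CB)^-1 * `|u - v|.
    apply: (mean_value_rV (ltW e0) _ ub vb) => x xb.
    have [Ox thx] := dP x xb; have [dfx dfE] := df x Ox; split=> // h.
    have := thx h; have := congr1 (@^~ h) dfE => /= <-; exact.
  rewrite (le_trans (ler_wpM2l (ltW CB0) H))// mulrA invfM mulrCA.
  by rewrite divff ?mulr1// gt_eqF.
have Xib : Xi b = b + B (- A b).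
  by rewrite /Xi/= /f !fctE thb sub0r.
have Xi1d : C1_on [set x | `|x - b| < d] Xi.
  by apply: C1_sub Xi1 => x /= xb; have [] := dP x xb.
have [sigma [sP sXi s1 ds]] := local_inverse d0 Xi1d XiP.
pose Om : set X := [set x | `|x - b| < d] `&` Xi @^-1` [set y | `|y - Xi b| < d / 8].
pose aff : Y -> X := cst (Xi b) + (Q : Y -> X).
have affE q : aff q = Xi b + Q q by [].
pose W : set Y := aff @^-1` [set y | `|y - Xi b| < d / 8].
have OmO : Om `<=` O by move=> x [xb _]; have [] := dP x xb.
have d8 : 0 < d / 8 by rewrite divr_gt0.
have aff1 : C1_on setT aff.
  have H1 : C1_on (setT : set Y) (cst (Xi b) : Y -> X) by exact: C1_cst.
  have H2 : C1_on (setT : set Y) Q by exact: C1_linear.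
  by have := C1_add H1 H2 openT.
have daff q : differentiable aff q /\ 'd aff q = Q :> (Y -> X).
  apply: near_diff => // e e1; near=> y.
  by rewrite !affE opprD addrACA subrr add0r linearB subrr normr0 mulr_ge0// ltW.
have oW : open W.
  apply: open_comp => [q _|]; last exact: open_dist_lt.
  exact: (C1_continuous aff1).
have oOm : open Om.
  apply/open_nearP => x [xb xXi].
  have cXi : {for x, continuous Xi} by exact: (C1_continuous Xi1d).
  have n1 := cXi _ (open_nbhs_nbhs (conj (open_dist_lt _ _) xXi)).
  have n2 := open_nbhs_nbhs (conj (open_dist_lt b d) xb).
  have /near_distP// : \forall y \near x, Om y by exact: filterI n2 n1.
pose chi := sigma \o aff.
pose rho x := P (Xi x - Xi b).
have chi1 : C1_on W chi.
  have := C1_comp aff1 s1 openT (open_dist_lt _ _).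
  by rewrite setTI.
have tr1 : C1_on (setT : set X) ((id : X -> X) + cst (- Xi b)).
  have idc : continuous (idfun : {linear X -> X}) by move=> x; exact: cvg_id.
  have H1 : C1_on (setT : set X) (cst (- Xi b) : X -> X) by exact: C1_cst.
  have H2 : C1_on (setT : set X) (idfun : X -> X) by exact: (C1_linear idc).
  by have := C1_add H2 H1 openT.
have rho1 : C1_on Om rho.
  have H1 := C1_comp Xi1d tr1 (open_dist_lt _ _) openT.
  have H2 := C1_comp H1 (C1_linear (O := setT) cP) _ openT.
  apply: C1_sub (H2 _) => [x [] //|].
  by rewrite preimage_setT setIT; exact: open_dist_lt.
have AXib : A (Xi b) = 0 by rewrite AXi.
have chiP q : W q -> [/\ Om (chi q), theta (chi q) = 0 & rho (chi q) = q].
  move=> Wq; have [sb sE] := sP _ Wq; split.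
  - by split=> //; rewrite /= sE.
  - by rewrite -AXi sE affE linearD AXib AQ addr0.
  - by rewrite /rho sE affE addrAC subrr add0r QP.
have rhoP x : Om x -> theta x = 0 -> W (rho x) /\ chi (rho x) = x.
  move=> [xb xXi] thx.
  have E : aff (rho x) = Xi x.
    rewrite affE /rho QPA; first by rewrite addrC subrK.
    by rewrite linearB AXi thx AXib subr0.
  by split; [rewrite /W/= E|rewrite /chi/= E sXi].
exists Om, W, chi, rho; split=> //.
  by split=> //; split; rewrite /= ?subrr ?normr0.
move=> q Wq; have [Omc thc rc] := chiP q Wq; split=> //.
  have [dchi _] := chi1 q Wq; have [drho _] := rho1 _ Omc.
  move=> k1 k2 kE.
  have E k : 'd rho (chi q) ('d chi q k) = k.
    have [_] : differentiable id q /\ 'd (id : Y -> Y) q = 'd (rho \o chi) q :> (Y -> Y).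
      apply: near_eq_diff; last exact: differentiable_comp.
      by have := open_nbhs_nbhs (conj oW Wq); apply: filterS => z /chiP[].
    have did : 'd (id : Y -> Y) q = id :> (Y -> Y) by exact: diff_val.
    move=> dE; apply: etrans (congr1 (@^~ k) did).
    apply: etrans (esym (congr1 (@^~ k) dE)).
    exact: esym (congr1 (@^~ k) (diff_comp dchi drho)).
  by rewrite -(E k1) kE E.
have [dchi _] := chi1 q Wq; have [dth _] := th1 _ (OmO _ Omc).
apply/seteqP; split=> k /=.
  move=> [q' _ <-].
  have [_] : differentiable (cst 0 : Y -> 'rV[R]_m) q /\
      'd (cst 0 : Y -> 'rV[R]_m) q = 'd (theta \o chi) q :> (Y -> 'rV[R]_m).
    apply: near_eq_diff; last exact: differentiable_comp.
    by have := open_nbhs_nbhs (conj oW Wq); apply: filterS => z /chiP[].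
  move=> dE; have E1 := congr1 (@^~ q') (diff_comp dchi dth).
  apply: etrans (esym E1) _; apply: etrans (esym (congr1 (@^~ q') dE)) _.
  exact: (congr1 (@^~ q') (diff_cst _ _)).
move=> thk; exists (P ('d Xi (chi q) k)) => //.
have [daq daqE] := daff q; have [dsg _] := s1 _ Wq.
apply: etrans (congr1 (@^~ _) (diff_comp daq dsg)) _.
apply: etrans (congr1 ('d sigma (aff q)) (congr1 (@^~ _) daqE)) _.
apply: etrans (ds _ k Wq); congr ('d sigma (aff q) _); apply: QPA.
have dXE := congr1 (@^~ k) (dXi _ (OmO _ Omc)).
apply: etrans (congr1 A dXE) _.
by rewrite linearD AB thk sub0r subrr.
Unshelve. all: by end_near. Qed.

End zero_set.

(** * Open mappings and orthogonal projections *)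

Section geometric_limits.
Variables (R : realType) (X : completeNormedModType R).

Lemma geometric_half_cvg0 (C : R) : C * 2^-1 ^+ n @[n --> \oo] --> 0.
Proof.
rewrite -(mulr0 C); apply: cvgMr; apply: cvg_expr.
by rewrite ger0_norm ?invr_ge0// invf_lt1// ltr1n.
Qed.

Lemma le_geometric_half (a b C : R) :
  (forall n, a <= b + C * 2^-1 ^+ n) -> a <= b.
Proof.
move=> abC; apply/ler_addgt0Pr => e e0.
have /cvgr_dist_lt/(_ e e0) := @geometric_half_cvg0 C; case=> N _ /(_ N (leqnn N)).
rewrite /= sub0r normrN => CN; apply: le_trans (abC N) _.
by rewrite lerD2l (le_trans (ler_norm _))// ltW.
Qed.

Lemma cauchy_geometric (u : nat -> X) (C : R) :
  (forall n k, (n <= k)%N -> `|u k - u n| <= C * 2^-1 ^+ n) ->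
  exists2 l, u @ \oo --> l & forall n, `|l - u n| <= C * 2^-1 ^+ n.
Proof.
move=> uC.
have cu : cvgn u.
  apply: cauchy_cvg; apply/cauchy_ballP => e e0.
  have e20 : 0 < e / 2 by rewrite divr_gt0.
  have /cvgr_dist_lt/(_ _ e20)[N _ NP] := @geometric_half_cvg0 C.
  have {}NP : C * 2^-1 ^+ N < e / 2.
    have := NP N (leqnn N); rewrite /= sub0r normrN.
    exact/le_lt_trans/ler_norm.
  exists (u @` [set n | N <= n]%N, u @` [set n | N <= n]%N).
    by split; exists N => // n Nn; exists n.
  move=> [_ _] /= [[n Nn <-] [k Nk <-]]; rewrite -ball_normE/=.
  rewrite -(subrK (u N) (u n)) -addrA (le_lt_trans (ler_normD _ _))//.
  rewrite [X in _ + X]distrC.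
  by have := uC _ _ Nn; have := uC _ _ Nk; lra.
case/cvg_ex : cu => l ul; exists l => // n; apply/ler_addgt0Pr => e e0.
have /cvgr_dist_lt/(_ e e0)[N _ NP] := ul.
have {}NP := NP (maxn n N) (leq_maxr _ _).
rewrite -(subrK (u (maxn n N)) l) -addrA (le_trans (ler_normD _ _))//.
by rewrite [leRHS]addrC lerD//; [exact: ltW | exact/uC/leq_maxl].
Qed.

End geometric_limits.

Section open_mapping.
Variables (R : realType) (V W : completeNormedModType R) (T : {linear V -> W}).
Hypotheses (cT : continuous T) (sT : forall w, exists v, T v = w).

(** By Baire's theorem the closure of the image of some ball has an interior
    point [w0]; differences of two points near [w0] then fill a ball around 0. *)
Let approx : exists2 C, 0 < C &
  forall w, exists2 v, `|v| <= C * `|w| & `|w - T v| <= 2^-1 * `|w|.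
Proof.
pose F n := closure (T @` [set v | `|v| <= n%:R]).
have [n nd] : exists n, ~ dense (~` F n).
  apply/existsNP => FP.
  have oF n : open (~` F n) /\ dense (~` F n).
    split; last exact: contrapT (FP n).
    by apply: closed_openC; exact: closed_closure.
  have [w [_ wF]] := Baire oF (ex_intro setT (0 : W) I) openT.
  have [v Tv] := sT w.
  have [n nv] : exists n : nat, `|v| <= n%:R.
    by exists (Num.truncn `|v|).+1; rewrite ltW// truncnS_gt.
  by apply: (wF n I); apply: subset_closure; exists v.
have [N [[w0 [oN Nw0]] NF]] := denseNE nd.
have /open_nearP/(_ w0 Nw0)[r r0 rN] := oN.
have inF w : `|w - w0| < r -> F n w.
  move=> wr; apply: contrapT => nF.
  have : (N `&` ~` F n) w by split=> //; exact: rN.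
  by rewrite NF.
have apx w e : 0 < e -> `|w - w0| < r ->
    exists2 v, `|v| <= n%:R & `|w - T v| < e.
  move=> e0 /inF/(_ (ball w e) (nbhsx_ballx _ _ e0))[_ [[v vn <-]]].
  by rewrite -ball_normE/= => ?; exists v.
exists (n%:R * 4 / r + 1) => [|w]; first by rewrite ltr_pwDr// divr_ge0 ?mulr_ge0// ltW.
have [->|w_neq0] := eqVneq w 0.
  by exists 0; rewrite ?(linear0 T) ?subr0 !normr0 !mulr0.
have nw : 0 < `|w| by rewrite normr_gt0.
pose s := r / 2 / `|w|; have s0 : 0 < s by rewrite !divr_gt0.
have r8 : 0 < r / 8 by rewrite divr_gt0.
have sw : `|s *: w| = r / 2.
  by rewrite normrZ gtr0_norm// divfK// gt_eqF.
have [|v1 v1n v1T] := apx (s *: w + w0) _ r8; first by rewrite addrK sw; lra.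
have [|v2 v2n v2T] := apx w0 _ r8; first by rewrite subrr normr0.
exists (s^-1 *: (v1 - v2)).
  rewrite normrZ gtr0_norm ?invr_gt0// ler_pdivrMl//.
  have -> : s * ((n%:R * 4 / r + 1) * `|w|) = n%:R * 2 + r / 2.
    by rewrite /s; field; rewrite ?gt_eqF// !lt0r_neq0.
  by rewrite (le_trans (ler_normB _ _))//; lra.
have -> : w - T (s^-1 *: (v1 - v2)) = s^-1 *: (s *: w - (T v1 - T v2)).
  by rewrite linearZ linearB scalerBr scalerA mulVf ?gt_eqF// scale1r.
rewrite normrZ gtr0_norm ?invr_gt0// ler_pdivrMl// mulrCA.
have -> : s * `|w| = r / 2 by rewrite /s divfK// gt_eqF.
have -> : s *: w - (T v1 - T v2) = (s *: w + w0 - T v1) - (w0 - T v2).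
  rewrite !opprB [s *: w + w0 - _]addrAC -[RHS]addrA [w0 + _]addrC subrK.
  by rewrite addrA addrAC.
by rewrite (le_trans (ler_normB _ _))//; lra.
Qed.

(** Baire's theorem only gives approximate preimages; the geometric series of
    the successive corrections converges to an exact one. *)
Theorem open_mapping : exists2 C, 0 < C &
  forall w, exists2 v, T v = w & `|v| <= C * `|w|.
Proof.
have [C C0 CP] := approx; exists (2 * C) => [|w]; first by rewrite mulr_gt0.
have /choice[s sP] : forall w, exists v,
    `|v| <= C * `|w| /\ `|w - T v| <= 2^-1 * `|w|.
  by move=> w'; have [v ? ?] := CP w'; exists v.
pose step (p : V * W) := (p.1 + s p.2, p.2 - T (s p.2)).
pose p n := iter n step (0, w).
have wn n : `|(p n).2| <= `|w| * 2^-1 ^+ n.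
  elim: n => [|n IH]; first by rewrite expr0 mulr1.
  have [_ H] := sP (p n).2; rewrite /= (le_trans H)// exprS mulrCA.
  by rewrite ler_pM2l.
have Tp n : T (p n).1 = w - (p n).2.
  elim: n => [|n IH] /=; first by rewrite linear0 subrr.
  by rewrite linearD IH opprB addrA addrAC.
have un n k : `|(p (n + k)%N).1 - (p n).1| <= 2 * C * `|w| * 2^-1 ^+ n.
  suff H : `|(p (n + k)%N).1 - (p n).1| <=
      2 * C * `|w| * (2^-1 ^+ n - 2^-1 ^+ (n + k)).
    rewrite (le_trans H)// ler_wpM2l ?mulr_ge0 ?(ltW C0)//.
    by rewrite lerBlDr lerDl exprn_ge0.
  elim: k => [|k IH]; first by rewrite addn0 !subrr normr0 mulr0.
  rewrite addnS exprS /= addrAC (le_trans (ler_normD _ _))//.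
  have [H _] := sP (p (n + k)%N).2; have := ler_wpM2l (ltW C0) (wn (n + k)%N).
  by move: IH H; set h := 2^-1 ^+ (n + k); rewrite !mulrBr; lra.
have uC n k : (n <= k)%N ->
    `|(p k).1 - (p n).1| <= 2 * C * `|w| * 2^-1 ^+ n.
  by move=> nk; rewrite -(subnKC nk).
have [l ul lP] := cauchy_geometric uC.
exists l; last by have := lP 0%N; rewrite /= subr0 expr0 mulr1.
have H1 : T (p n).1 @[n --> \oo] --> T l.
  by apply: continuous_cvg => //; exact: cT.
have H2 : T (p n).1 @[n --> \oo] --> w.
  apply/cvgrPdist_le => e e0.
  have /cvgr_dist_lt/(_ e e0) := @geometric_half_cvg0 R `|w|.
  apply: filterS => n /=; rewrite sub0r normrN => H.
  by rewrite Tp subKr (le_trans (wn n))// (le_trans (ler_norm _))// ltW.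
exact: (cvg_unique _ H1 H2).
Qed.

End open_mapping.

Section hilbert.
Variables (R : realType) (H : completeNormedModType R) (ip : {dot H for idfun}).
Hypothesis ipE : forall x : H, ip x x = `|x| ^+ 2.

Lemma ipC v w : ip w v = ip v w.
Proof. by rewrite hermC/= expr0 mul1r. Qed.
Lemma ipDl u v w : ip (u + v) w = ip u w + ip v w.
Proof. by rewrite linearDl. Qed.
Lemma ipDr u v w : ip w (u + v) = ip w u + ip w v.
Proof. by rewrite linearD. Qed.
Lemma ipZl a v w : ip (a *: v) w = a * ip v w.
Proof. by rewrite linearZl_LR. Qed.
Lemma ipZr a v w : ip w (a *: v) = a * ip w v.
Proof. by rewrite linearZ. Qed.
Lemma ipNl v w : ip (- v) w = - ip v w.
Proof. by rewrite linearNl. Qed.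
Lemma ipNr v w : ip w (- v) = - ip w v.
Proof. by rewrite linearN. Qed.
Lemma ipBl u v w : ip (u - v) w = ip u w - ip v w.
Proof. by rewrite ipDl ipNl. Qed.
Lemma ipBr u v w : ip w (u - v) = ip w u - ip w v.
Proof. by rewrite ipDr ipNr. Qed.
Lemma ip0r w : ip w 0 = 0.
Proof. by rewrite linear0. Qed.

(** Expand [0 <= |u - a v|^2] at the minimizing [a]. *)
Lemma ip_cauchy_schwarz u v : `|ip u v| <= `|u| * `|v|.
Proof.
have [->|v0] := eqVneq v 0; first by rewrite ip0r !normr0 mulr0.
have nv : 0 < `|v| by rewrite normr_gt0.
rewrite -(ler_pXn2r (n := 2)) ?nnegrE ?mulr_ge0// real_normK ?num_real// exprMn.
pose a := ip u v / `|v| ^+ 2.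
have : 0 <= ip (u - a *: v) (u - a *: v) by rewrite ipE exprn_ge0.
rewrite ipBl !ipBr !ipZl !ipZr (ipC u v) !ipE.
have -> : `|u| ^+ 2 - a * ip u v - (a * ip u v - a * (a * `|v| ^+ 2)) =
    `|u| ^+ 2 - ip u v ^+ 2 / `|v| ^+ 2.
  by rewrite /a; field; rewrite gt_eqF.
by rewrite subr_ge0 ler_pdivrMr// exprn_gt0.
Qed.

Lemma ip_linear v : linear (fun u => ip u v).
Proof. by move=> a u w; rewrite ipDl ipZl. Qed.

Lemma ip_continuous v : continuous (fun u => ip u v).
Proof.
apply: (opnorm_continuous (L := linear_of (ip_linear v)) (C := `|v|)) => u /=.
by rewrite mulrC ip_cauchy_schwarz.
Qed.

Lemma ip_continuousr v : continuous (ip v).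
Proof.
have -> : (ip v : H -> R) = (fun u => ip u v) by apply/funext => u; exact: ipC.
exact: ip_continuous.
Qed.

Lemma ip_dense_eq (S : set H) y y' : dense S ->
  (forall v, S v -> ip v y = ip v y') -> y = y'.
Proof.
move=> dS yy'; apply/eqP; rewrite -subr_eq0 -normr_eq0; apply/eqP.
set d := y - y'; have dv v : S v -> ip v d = 0.
  by move=> /yy' E; rewrite ipBr E subrr.
apply/eqP; rewrite eq_le normr_ge0 andbT; apply/ler_addgt0Pr => e e0.
rewrite add0r.
have [v [vd Sv]] : ball d e `&` S !=set0.
  by apply: dS; [exists d; exact: ballxx | exact: ball_open].
move: vd; rewrite -ball_normE/= => vd.
have [->|d0] := eqVneq d 0; first by rewrite normr0 ltW.
have nd : 0 < `|d| by rewrite normr_gt0.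
rewrite -(ler_pM2r nd) -expr2 -ipE.
have -> : ip d d = ip (d - v) d by rewrite [RHS]ipBl (dv v Sv) subr0.
rewrite (le_trans (ler_norm _))// (le_trans (ip_cauchy_schwarz _ _))//.
by rewrite ler_pM2r// ltW.
Qed.

Local Notation dot2 := (dot2 ip).
Implicit Types z w : H * H.

Lemma dot2C z w : dot2 z w = dot2 w z.
Proof. by rewrite /Defs.dot2 ipC [ip z.2 _]ipC. Qed.
Lemma dot2Dl z z' w : dot2 (z + z') w = dot2 z w + dot2 z' w.
Proof. by rewrite /Defs.dot2/= !ipDl addrACA. Qed.
Lemma dot2Zl a z w : dot2 (a *: z) w = a * dot2 z w.
Proof. by rewrite /Defs.dot2/= !ipZl mulrDr. Qed.
Lemma dot2Nl z w : dot2 (- z) w = - dot2 z w.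
Proof. by rewrite /Defs.dot2/= !ipNl opprD. Qed.
Lemma dot2Bl z z' w : dot2 (z - z') w = dot2 z w - dot2 z' w.
Proof. by rewrite dot2Dl dot2Nl. Qed.
Lemma dot2Dr z z' w : dot2 w (z + z') = dot2 w z + dot2 w z'.
Proof. by rewrite dot2C dot2Dl !(dot2C _ w). Qed.
Lemma dot2Zr a z w : dot2 w (a *: z) = a * dot2 w z.
Proof. by rewrite dot2C dot2Zl dot2C. Qed.
Lemma dot2Nr z w : dot2 w (- z) = - dot2 w z.
Proof. by rewrite dot2C dot2Nl dot2C. Qed.
Lemma dot2Br z z' w : dot2 w (z - z') = dot2 w z - dot2 w z'.
Proof. by rewrite dot2Dr dot2Nr. Qed.
Lemma dot20l w : dot2 0 w = 0.
Proof. by rewrite -(subrr 0) dot2Bl subrr. Qed.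
Lemma dot20r w : dot2 w 0 = 0.
Proof. by rewrite dot2C dot20l. Qed.

Lemma dot2_sum_r n (a : 'I_n -> R) (e : 'I_n -> H * H) w :
  dot2 w (\sum_i a i *: e i) = \sum_i a i * dot2 w (e i).
Proof.
elim/big_rec2: _ => [|i x y _ IH]; first exact: dot20r.
by rewrite dot2Dr dot2Zr IH.
Qed.

Lemma prod_norm_ge z : `|z.1| <= `|z| /\ `|z.2| <= `|z|.
Proof. by rewrite prod_normE !le_max !lexx orbT. Qed.

Lemma dot2_ge z : `|z| ^+ 2 <= dot2 z z.
Proof.
rewrite /Defs.dot2 !ipE prod_normE /Num.max; case: ifP => _.
  by rewrite lerDr exprn_ge0.
by rewrite lerDl exprn_ge0.
Qed.

Lemma dot2_ge0 z : 0 <= dot2 z z.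
Proof. by rewrite (le_trans _ (dot2_ge z))// exprn_ge0. Qed.

Lemma dot2_eq0 z : dot2 z z = 0 -> z = 0.
Proof.
move=> z0; apply/eqP; rewrite -normr_eq0 -sqrf_eq0.
by rewrite eq_le sqr_ge0 andbT -z0 dot2_ge.
Qed.

Lemma dot2_le z w : `|dot2 z w| <= 2 * `|z| * `|w|.
Proof.
have [z1 z2] := prod_norm_ge z; have [w1 w2] := prod_norm_ge w.
rewrite (le_trans (ler_normD _ _))// -mulrA mulrDl !mul1r.
by rewrite lerD// (le_trans (ip_cauchy_schwarz _ _))// ler_pM.
Qed.

Lemma dot2_continuous w : continuous (dot2 ^~ w).
Proof.
have l : linear (fun z : H * H => dot2 z w : R).
  by move=> a u v; rewrite dot2Dl dot2Zl.
apply: (opnorm_continuous (L := linear_of l) (C := 2 * `|w|)) => z /=.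
by rewrite mulrAC dot2_le.
Qed.

(** A minimizing sequence is a Cauchy sequence by the parallelogram identity. *)
Let nearest (S : set (H * H)) z : closed S -> linear_subspace S ->
  exists2 p, S p & forall s, S s -> dot2 (z - p) s = 0.
Proof.
move=> cS [S0 lS].
pose D := [set dot2 (z - s) (z - s) | s in S].
have D0 : has_inf D.
  split; first by exists (dot2 (z - 0) (z - 0)); exists 0.
  by exists 0 => _ [s _ <-]; exact: dot2_ge0.
pose d := inf D.
have dD s : S s -> d <= dot2 (z - s) (z - s).
  by move=> Ss; apply: ge_inf; [exact: (proj2 D0) | exists s].
have /choice[u uP] : forall n : nat, exists s, S s /\
    dot2 (z - s) (z - s) <= d + (2^-1 ^+ n) ^+ 2.
  move=> n; have e0 : 0 < (2^-1 ^+ n) ^+ 2 :> R by rewrite !exprn_gt0// invr_gt0.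
  have [_ [s Ss <-] sd] := inf_adherent e0 D0.
  by exists s; split=> //; exact: ltW.
have Shalf s t : S s -> S t -> S (2^-1 *: (s + t)).
  move=> Ss St; rewrite scalerDr -[2^-1 *: t]addr0; by apply: (lS) => //; exact: lS.
have uC n k : (n <= k)%N -> `|u k - u n| <= 2 * 2^-1 ^+ n.
  move=> nk; have [Sn dn] := uP n; have [Sk dk] := uP k.
  rewrite -(ler_pXn2r (n := 2)) ?nnegrE ?mulr_ge0 ?exprn_ge0 ?invr_ge0//.
  have := dD _ (Shalf _ _ Sk Sn); have := dot2_ge (u k - u n).
  have : 2^-1 ^+ k <= 2^-1 ^+ n :> R.
    by rewrite ler_wiXn2l// ?invr_ge0// invf_le1// ler1n.
  have : 0 <= 2^-1 ^+ k :> R by rewrite exprn_ge0// invr_ge0.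
  rewrite exprMn; move: dn dk; set x := 2^-1 ^+ n; set y := 2^-1 ^+ k.
  move=> dn dk y0 yx.
  have -> : dot2 (u k - u n) (u k - u n) =
      2 * dot2 (z - u k) (z - u k) + 2 * dot2 (z - u n) (z - u n) -
      4 * dot2 (z - 2^-1 *: (u k + u n)) (z - 2^-1 *: (u k + u n)).
    rewrite !(dot2Dl, dot2Dr, dot2Nl, dot2Nr, dot2Zl, dot2Zr).
    by rewrite (dot2C (u n) (u k)) (dot2C (u k) z) (dot2C (u n) z); field.
  have : y ^+ 2 <= x ^+ 2 by rewrite ler_pXn2r ?nnegrE// (le_trans y0).
  by lra.
have [p up pP] := cauchy_geometric uC.
have Sp : S p.
  by apply: (closed_cvg S) up => //; apply: nearW => n; have [] := uP n.
have pd : dot2 (z - p) (z - p) <= d.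
  (* [K] collects the error terms of the expansion of [dot2 (z - p) (z - p)]
     around [z - u n], each of which is at most a multiple of [2^-1 ^+ n]. *)
  pose K := 1 + 4 * (`|z - p| * 2 + 2).
  apply: (@le_geometric_half _ _ _ K) => n; have [_ dn] := uP n.
  have qp : `|p - u n| <= 2 * 2^-1 ^+ n by exact: pP.
  have h1 : 2^-1 ^+ n <= 1 :> R by rewrite exprn_ile1// ?invr_ge0// invf_le1// ler1n.
  have h0 : 0 <= 2^-1 ^+ n :> R by rewrite exprn_ge0// invr_ge0.
  have -> : dot2 (z - p) (z - p) = dot2 (z - u n) (z - u n)
      - dot2 (p - u n) (z - u n) - dot2 (z - p) (p - u n).
    by rewrite !(dot2Dl, dot2Dr, dot2Nl, dot2Nr); ring.
  have := dot2_le (p - u n) (z - u n); have := dot2_le (z - p) (p - u n).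
  rewrite !ler_norml => /andP[H1 _] /andP[H2 _].
  have zn : `|z - u n| <= `|z - p| + 2.
    rewrite -(subrK p z) -addrA (le_trans (ler_normD _ _))// subrK lerD2l.
    by rewrite (le_trans qp)//; lra.
  have b0 : 0 <= `|z - p| by [].
  have M1 : 2 * `|p - u n| * `|z - u n| <= 2 * (2 * 2^-1 ^+ n) * (`|z - p| + 2).
    by rewrite ler_pM ?mulr_ge0// ler_pM2l.
  have M2 : 2 * `|z - p| * `|p - u n| <= 2 * `|z - p| * (2 * 2^-1 ^+ n).
    by rewrite ler_wpM2l ?mulr_ge0.
  move: dn H1 H2 M1 M2; rewrite /K; set x := 2^-1 ^+ n in h0 h1 *.
  set a := `|z - p| in b0 *; have xx : x ^+ 2 <= x by rewrite expr2 ler_piMr.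
  by move=> dn H1 H2 M1 M2; nra.
exists p => // s Ss.
have [->|s0] := eqVneq s 0; first exact: dot20r.
have c0 : 0 < dot2 s s.
  by rewrite (lt_le_trans _ (dot2_ge s))// exprn_gt0// normr_gt0.
(* [p + t *: s] is the nearest point on the line through [p] along [s]. *)
pose t := dot2 (z - p) s / dot2 s s.
have := dD (t *: s + p) (lS _ _ _ Ss Sp).
have -> : dot2 (z - (t *: s + p)) (z - (t *: s + p)) =
    dot2 (z - p) (z - p) - dot2 (z - p) s ^+ 2 / dot2 s s.
  have -> : z - (t *: s + p) = (z - p) - t *: s by rewrite opprD addrA addrAC.
  rewrite /t; move: (z - p) => q.
  rewrite !(dot2Bl, dot2Br) !(dot2Zl, dot2Zr) (dot2C s q).
  by field; rewrite gt_eqF.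
move=> H1; have {H1}: dot2 (z - p) s ^+ 2 / dot2 s s <= 0 by lra.
rewrite pmulr_lle0 ?invr_gt0// => H1; apply/eqP; rewrite -sqrf_eq0.
by rewrite eq_le H1 sqr_ge0.
Qed.

Theorem orthogonal_projection (S : set (H * H)) :
  closed S -> linear_subspace S ->
  exists P : {linear (H * H)%type -> (H * H)%type},
    [/\ continuous P, forall z, S (P z) &
        forall z s, S s -> dot2 (z - P z) s = 0].
Proof.
move=> cS lS; have [S0 lS'] := lS.
have /choice[P PP] : forall z, exists p, S p /\
    forall s, S s -> dot2 (z - p) s = 0.
  by move=> z; have [p ? ?] := nearest z cS lS; exists p.
have uniq z p : S p -> (forall s, S s -> dot2 (z - p) s = 0) -> p = P z.
  move=> Sp pz; have [SP zP] := PP z.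
  have Sd : S (p - P z) by rewrite addrC -scaleN1r; exact: lS'.
  apply/eqP; rewrite -subr_eq0; apply/eqP/dot2_eq0.
  have {1}-> : p - P z = (z - P z) - (z - p) by rewrite opprB [RHS]addrC subrKA.
  by rewrite dot2Bl zP// pz// subrr.
have lP : linear P.
  move=> a u v; have [Su zu] := PP u; have [Sv zv] := PP v.
  apply/esym/uniq; first exact: lS'.
  move=> s Ss; rewrite opprD addrACA -scalerBr dot2Dl dot2Zl zu// zv//.
  by rewrite mulr0 addr0.
exists (linear_of lP); split=> [|z|z s Ss]; [|exact: (PP z).1|exact: (PP z).2].
apply: (opnorm_continuous (C := 2)) => z /=; have [SP zP] := PP z.
rewrite -(ler_pXn2r (n := 2)) ?nnegrE ?mulr_ge0//.
apply: le_trans (dot2_ge _) _.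
have : dot2 (P z) (P z) <= dot2 z z.
  have -> : dot2 z z = dot2 (z - P z) (z - P z) + dot2 (P z) (P z).
    have zz := zP _ SP; move: (zz); 
    rewrite !(dot2Dl, dot2Dr, dot2Nl, dot2Nr) (dot2C (P z) z).
    by lra.
  by rewrite lerDr dot2_ge0.
move/le_trans; apply; have := dot2_le z z; rewrite ler_norml => /andP[_].
by rewrite exprMn expr2; have := sqr_ge0 `|z|; rewrite expr2 -mulrA; lra.
Qed.

(** Adding to [T] the projection onto the orthogonal complement of its range gives
    the surjective map [(v, w) |-> T v + (w - P w)].  The bounded preimages of
    [T h] that the open mapping theorem provides have first component [h]. *)
Theorem bounded_below (V : completeNormedModType R) (T : {linear V -> (H * H)%type}) :
  continuous T -> injective T -> closed (range T) ->
  exists2 C, 0 < C & forall v, `|v| <= C * `|T v|.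
Proof.
move=> cT iT clT.
have lT : linear_subspace (range T).
  split; first by exists 0 => //; rewrite linear0.
  by move=> a _ _ [u _ <-] [v _ <-]; exists (a *: u + v) => //; rewrite linearP.
have [P [cP TP orthP]] := orthogonal_projection clT lT.
pose S (q : V * (H * H)) := T q.1 + (q.2 - P q.2).
have lS : linear S.
  move=> a q q'; rewrite /S/= !linearP /= [X in _ + X = _]addrACA -scalerDr.
  by rewrite [in RHS]scalerDr [RHS]addrACA.
have cS : continuous (linear_of lS).
  have [K K0 TK] := continuous_opnorm cT; have [M M0 PM] := continuous_opnorm cP.
  apply: (opnorm_continuous (C := K + (1 + M))) => q /=.
  have q1 : `|q.1| <= `|q| by rewrite prod_normE le_max lexx.
  have q2 : `|q.2| <= `|q| by rewrite prod_normE le_max lexx orbT.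
  rewrite (le_trans (ler_normD _ _))// mulrDl lerD//.
    by rewrite (le_trans (TK _))// ler_pM2l.
  rewrite (le_trans (ler_normB _ _))// mulrDl mul1r lerD//.
  by rewrite (le_trans (PM _))// ler_pM2l.
have sS w : exists q, linear_of lS q = w.
  by have [v _ Tv] := TP w; exists (v, w); rewrite /= /S/= Tv addrC subrK.
have [C C0 CP] := open_mapping cS sS.
exists C => // h; have [[v w] /= SE nq] := CP (T h).
rewrite /S/= in SE.
have E : w - P w = T (h - v).
  by rewrite linearB -SE [RHS]addrC addKr.
have Ehv : T (h - v) = 0.
  by apply: dot2_eq0; rewrite -{1}E orthP//; exists (h - v).
have -> : h = v.
  by apply/eqP; rewrite -subr_eq0; apply/eqP/iT; rewrite Ehv linear0.
rewrite (_ : T v = T h); last first.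
  by apply/eqP; rewrite eq_sym -subr_eq0 -linearB Ehv.
by apply: le_trans nq; rewrite prod_normE le_max lexx.
Qed.

End hilbert.

(** * Closed symmetric operators *)

Section dimension.
Variables (R : realType) (E : normedModType R).

(** A dimension bound that does not presuppose a basis. *)
Definition dim_le (S : set E) n : Prop :=
  forall c : 'I_n.+1 -> E, (forall i, S (c i)) ->
  exists2 a : 'I_n.+1 -> R, exists i, a i != 0 & \sum_i a i *: c i = 0.

Lemma has_dim_le (S : set E) n : has_dim S n -> dim_le S n.
Proof.
move=> [e [_ ->]] c /choice[M cM].
pose A : 'M[R]_(n.+1, n) := \matrix_(i, j) M i j.
have /matrix0Pn[i [j aij]] : kermx A != 0.
  rewrite kermx_eq0 /row_free; apply/eqP => rA.
  by have := rank_leq_col A; rewrite rA ltnn.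
exists (fun k => kermx A i k); first by exists j.
have /matrixP kA := mulmx_ker A.
rewrite (eq_bigr (fun k => \sum_j (kermx A i k * M k j) *: e j)); last first.
  move=> k _; rewrite cM scaler_sumr.
  by apply: eq_bigr => l _; rewrite scalerA.
rewrite exchange_big big1//= => k _; rewrite -scaler_suml.
have := kA i k; rewrite mxE [RHS]mxE => kA0.
rewrite (_ : \sum_i0 _ = 0) ?scale0r// -[RHS]kA0.
by apply: eq_bigr => l _; rewrite [A l k]mxE.
Qed.

(** In a dependence relation between [z] and the [e i], the coefficient of [z]
    cannot vanish. *)
Lemma dim_le_span (S : set E) n (e : 'I_n -> E) : dim_le S n ->
  (forall i, S (e i)) ->
  (forall a : 'I_n -> R, \sum_i a i *: e i = 0 -> forall i, a i = 0) ->
  forall z, S z -> exists a : 'I_n -> R, z = \sum_i a i *: e i.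
Proof.
move=> dS Se ie z Sz.
pose c (i : 'I_n.+1) := if unlift ord0 i is Some j then e j else z.
have [|a [i ai] ac0] := dS c.
  by move=> i; rewrite /c; case: unliftP.
have E0 : a ord0 *: z + \sum_(j < n) a (lift ord0 j) *: e j = 0.
  rewrite -[RHS]ac0 big_ord_recl /c unlift_none; congr (_ + _).
  by apply: eq_bigr => j _; rewrite liftK.
have a0 : a ord0 != 0.
  apply/eqP => a0; move: E0; rewrite a0 scale0r add0r => /ie a0'.
  by move: ai; case: (unliftP ord0 i) => [j ->|->]; rewrite ?a0' ?a0 eqxx.
exists (fun j => - (a ord0)^-1 * a (lift ord0 j)).
rewrite (eq_bigr (fun j => - (a ord0)^-1 *: (a (lift ord0 j) *: e j))); last first.
  by move=> j _; rewrite scalerA.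
rewrite -scaler_sumr; apply: (scalerI a0); rewrite scalerA mulrN divff//.
by rewrite scaleN1r; apply/eqP; rewrite -subr_eq0 opprK E0.
Qed.

End dimension.

Section bounded_below_range.
Variables (R : realType) (V W : completeNormedModType R) (T : {linear V -> W}).

Lemma closed_range C : continuous T -> (forall v, `|v| <= C * `|T v|) ->
  closed (range T).
Proof.
move=> cT TC w clw.
have /choice[v vP] : forall n : nat, exists v, `|w - T v| <= 2^-1 ^+ n.
  move=> n; have e0 : 0 < 2^-1 ^+ n :> R by rewrite exprn_gt0// invr_gt0.
  have [_ [[v _ <-]]] := clw (ball w (2^-1 ^+ n)) (nbhsx_ballx _ _ e0).
  by rewrite -ball_normE/= => wv; exists v; exact: ltW.
have vC n k : (n <= k)%N -> `|v k - v n| <= `|C| * 2 * 2^-1 ^+ n.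
  move=> nk; rewrite (le_trans (TC _))// -mulrA.
  rewrite (le_trans (ler_wpM2r _ (ler_norm C)))// ler_wpM2l//.
  have -> : T (v k - v n) = (w - T (v n)) - (w - T (v k)).
    by rewrite linearB opprB [RHS]addrC subrKA.
  rewrite (le_trans (ler_normB _ _))//.
  have : 2^-1 ^+ k <= 2^-1 ^+ n :> R.
    by rewrite ler_wiXn2l// ?invr_ge0// invf_le1// ler1n.
  by have := vP n; have := vP k; lra.
have [l vl _] := cauchy_geometric vC; exists l => //.
have H1 : T (v n) @[n --> \oo] --> T l by apply: continuous_cvg => //; exact: cT.
have H2 : T (v n) @[n --> \oo] --> w.
  apply/cvgrPdist_le => e e0.
  have /cvgr_dist_lt/(_ e e0) := @geometric_half_cvg0 R 1.
  apply: filterS => n /=; rewrite sub0r normrN mul1r => Hn.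
  by rewrite (le_trans (vP n))// (le_trans (ler_norm _))// ltW.
exact: (cvg_unique _ H1 H2).
Qed.

End bounded_below_range.

Section symmetric_operators.
Variables (R : realType) (H : completeNormedModType R) (ip : {dot H for idfun}).
Hypothesis ipE : forall x : H, ip x x = `|x| ^+ 2.
Local Notation dot2 := (dot2 ip).
Local Notation J := (@J R H).

Lemma JJ (z : H * H) : J (J z) = - z.
Proof. by case: z. Qed.

Lemma norm_J (z : H * H) : `|J z| = `|z|.
Proof. by rewrite !prod_normE/= normrN maxC. Qed.

Lemma J_linear : linear J.
Proof.
by move=> a u v; rewrite /Defs.J; congr (_, _); rewrite /= opprD scalerN.
Qed.

Lemma JB (z w : H * H) : J (z - w) = J z - J w.
Proof. by rewrite -[J]/(linear_of J_linear : _ -> _) linearB. Qed.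

Lemma J0 : J 0 = 0.
Proof. by rewrite /Defs.J oppr0. Qed.

Lemma J_sum n (a : 'I_n -> R) (e : 'I_n -> H * H) :
  J (\sum_i a i *: e i) = \sum_i a i *: J (e i).
Proof.
have <- : linear_of J_linear = J :> (H * H -> H * H) by [].
by rewrite linear_sum; apply: eq_bigr => i _; rewrite linearZ.
Qed.

Lemma dot2_JJ (z w : H * H) : dot2 (J z) (J w) = dot2 z w.
Proof. by rewrite /Defs.dot2/= (ipNl ip) (ipNr ip) opprK addrC. Qed.

Lemma dot2_Jl (z w : H * H) : dot2 (J z) w = - dot2 z (J w).
Proof. by rewrite -dot2_JJ JJ (dot2Nl ip). Qed.

(** The graph of the adjoint is the annihilator of the graph for the symplectic
    form [(J w, z)]. *)
Lemma adjoint_graphE (A : operator H) (z : H * H) :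
  adjoint_graph ip A z <-> forall w, graph A w -> dot2 (J w) z = 0.
Proof.
split=> [zA [u _] [/= Au ->]|zA u Au].
  by rewrite /Defs.dot2/= (ipNl ip) zA// addNr.
have := zA (u, A u) (conj Au erefl).
by rewrite /Defs.dot2/= (ipNl ip) => /eqP; rewrite addrC subr_eq0 eq_sym => /eqP.
Qed.

Lemma symmetric_graph (A : operator H) : symmetric_operator ip A ->
  graph A `<=` adjoint_graph ip A.
Proof. by move=> sA [u _] [/= Au ->] v Av; exact: sA. Qed.

Lemma linear_operator_graph (A : operator H) : linear_operator A ->
  linear_subspace (graph A : set (H * H)%type).
Proof.
move=> [[A0 lA] AP]; split.
  split=> //=; have := AP (-1) 0 0 A0 A0.
  by rewrite scaler0 addr0 scaleN1r addNr.
move=> a [u _] [v _] [/= Au ->] [/= Av ->]; split=> /=; first exact: lA.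
by rewrite AP.
Qed.

Lemma subspaceB (S : set (H * H)) u v :
  linear_subspace (S : set (H * H)%type) -> S u -> S v -> S (u - v).
Proof. by move=> [_ SP] Su Sv; rewrite addrC -scaleN1r; exact: SP. Qed.

Lemma subspaceD (S : set (H * H)) u v :
  linear_subspace (S : set (H * H)%type) -> S u -> S v -> S (u + v).
Proof. by move=> [_ SP] Su Sv; rewrite -[u]scale1r; exact: SP. Qed.

Definition defect_space (A : operator H) : set (H * H) :=
  orthogonal_difference ip (adjoint_graph ip A) (graph A).

Section closed_symmetric.
Variable A : operator H.
Hypotheses (lA : linear_operator A) (sA : symmetric_operator ip A)
  (cA : closed (graph A)).

Lemma adjoint_split z : adjoint_graph ip A z ->
  exists p r, [/\ graph A p, defect_space A r & z = p + r].
Proof.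
move=> zA.
have [P [_ AP zP]] := orthogonal_projection ipE cA (linear_operator_graph lA).
exists (P z), (z - P z); split=> //; last by rewrite addrC subrK.
split; last by move=> w /zP.
apply/adjoint_graphE => w Aw; have Pz := symmetric_graph sA (AP z).
move/adjoint_graphE : zA => zA; move/adjoint_graphE : Pz => Pz.
by rewrite (dot2Br ip) zA// Pz// subrr.
Qed.

(** The graph of a symmetric operator is orthogonal to its image under [J], and
    the defect space is the orthogonal complement of their sum. *)
Lemma graph_split (z : H * H) : exists p q r,
  [/\ graph A p, graph A q, defect_space A r & z = p + J q + r].
Proof.
have [P [_ AP zP]] := orthogonal_projection ipE cA (linear_operator_graph lA).
pose y := - J (z - P z); pose q := P y; pose r := J (y - q).
have Jy : J y = z - P z.
  by rewrite /y -[J]/(linear_of J_linear : _ -> _) linearN/= JJ opprK.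
have zA w : graph A w -> dot2 (J w) r = 0.
  by move=> Aw; rewrite dot2_JJ (dot2C ip) zP.
exists (P z), q, r; split=> //; first exact: AP.
  split; first by apply/adjoint_graphE.
  move=> w Aw; rewrite /r JB Jy (dot2Bl ip) zP// sub0r.
  have /adjoint_graphE := symmetric_graph sA Aw.
  by move=> /(_ _ (AP y)) ->; rewrite oppr0.
by rewrite /r JB Jy -addrA [J q + _]addrC !subrK addrC subrK.
Qed.

Lemma defect_space_orth r p : defect_space A r -> graph A p ->
  dot2 r p = 0 /\ dot2 r (J p) = 0.
Proof.
by move=> [/adjoint_graphE Ar rA] Ap; rewrite rA// (dot2C ip) Ar.
Qed.

Lemma defect_space_sum n (c : 'I_n -> H * H) (a : 'I_n -> R) :
  (forall i, defect_space A (c i)) -> defect_space A (\sum_i a i *: c i).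
Proof.
move=> cA'; split.
  apply/adjoint_graphE => w Aw; rewrite (dot2_sum_r ip) big1// => i _.
  by rewrite (dot2C ip) (defect_space_orth (cA' i) Aw).2 mulr0.
move=> w Aw; rewrite (dot2C ip) (dot2_sum_r ip) big1// => i _.
by rewrite (dot2C ip) (defect_space_orth (cA' i) Aw).1 mulr0.
Qed.

End closed_symmetric.

(** If the graphs of [A] and [A'] are close, the orthogonal projection from the
    defect space of [A'] to that of [A] is injective: a vector in its kernel is a
    sum [P + J Q] with [P] and [Q] in the graph of [A], which is almost orthogonal
    to the defect space of [A'], so that the vector is almost orthogonal to
    itself. *)
Lemma defect_gap (V : normedModType R) (S S' : V -> H * H) (A A' : operator H)
    (C e : R) n :
  linear_operator A -> symmetric_operator ip A -> closed (graph A) ->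
  graph A `<=` range S -> range S' `<=` graph A' ->
  (forall v, `|v| <= C * `|S v|) -> (forall v, `|S v - S' v| <= e * `|v|) ->
  0 <= e -> e * C <= 16^-1 ->
  dim_le (defect_space A) n -> dim_le (defect_space A') n.
Proof.
move=> lA sA cA AS SA SC SS e0 eC dA c cA'.
have /choice[p /choice[q /choice[r cE]]] i : exists p q r,
    [/\ graph A p, graph A q, defect_space A r & c i = p + J q + r].
  exact: graph_split.
have rA i : defect_space A (r i) by have [] := cE i.
have [a ai ar] := dA r rA; exists a => //.
pose h := \sum_i a i *: c i; rewrite -/h.
have lG := linear_operator_graph lA.
have Gsum (f : 'I_n.+1 -> H * H) : (forall i, graph A (f i)) ->
    graph A (\sum_i a i *: f i).
  move=> Af; have [G0 GP] := lG; apply: big_ind => // [u v Au Av|i _].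
    by rewrite -[u]scale1r; exact: GP.
  by rewrite -[_ *: _]addr0; exact: GP.
pose P := \sum_i a i *: p i; pose Q := \sum_i a i *: q i.
have AP : graph A P by apply: Gsum => i; have [] := cE i.
have AQ : graph A Q by apply: Gsum => i; have [] := cE i.
have hE : h = P + J Q.
  rewrite -[RHS]addr0 -ar /h /P /Q J_sum -!big_split.
  by apply: eq_bigr => i _; have [_ _ _ ->] := cE i; rewrite !scalerDr.
have hA' : defect_space A' h by exact: defect_space_sum.
have PQ : dot2 P (J Q) = 0.
  rewrite (dot2C ip).
  by have /adjoint_graphE := symmetric_graph sA AP; exact.
have hh : dot2 h h = dot2 P P + dot2 Q Q.
  rewrite hE !(dot2Dl ip) !(dot2Dr ip) dot2_JJ (dot2C ip (J Q) P) PQ.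
  by rewrite addr0 add0r.
(* [P] and [Q] have norm at most [2 * `|h|]; then [e * C <= 16^-1] makes each of
   the two terms of [dot2 h h] at most a quarter of [`|h| ^+ 2]. *)
have small w : graph A w -> `|w| <= 2 * `|h| ->
    `|dot2 h w| <= 4^-1 * `|h| ^+ 2 /\ `|dot2 h (J w)| <= 4^-1 * `|h| ^+ 2.
  move=> Aw wh; have [v _ vw] := AS w Aw.
  have [h1 h2] := defect_space_orth hA' (SA (S' v) (ex_intro2 _ _ v I erefl)).
  have nw : `|w - S' v| <= 8^-1 * `|h|.
    rewrite -vw (le_trans (SS v))// (le_trans (ler_wpM2l e0 (SC v)))//.
    rewrite vw mulrA (le_trans (ler_wpM2r (normr_ge0 _) eC))//.
    by move: wh; lra.
  have nh : 2 * `|h| * `|w - S' v| <= 4^-1 * `|h| ^+ 2.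
    rewrite (le_trans (ler_wpM2l _ nw)) ?mulr_ge0//.
    by rewrite expr2; have := mulr_ge0 (normr_ge0 h) (normr_ge0 h); lra.
  split.
    rewrite -[dot2 h w]subr0 -h1 -(dot2Br ip).
    by rewrite (le_trans (dot2_le ipE _ _)).
  rewrite -[dot2 h (J w)]subr0 -h2 -(dot2Br ip) -JB.
  by rewrite (le_trans (dot2_le ipE _ _))// norm_J.
have le2 w : dot2 w w <= dot2 h h -> `|w| <= 2 * `|h|.
  move=> wh; rewrite -(ler_pXn2r (n := 2)) ?nnegrE ?mulr_ge0//.
  have := dot2_ge ipE w; have := dot2_le ipE h h.
  rewrite ler_norml => /andP[_]; rewrite exprMn expr2 -mulrA -expr2.
  by have := sqr_ge0 `|h|; lra.
have [|hP _] := small P AP; first by apply: le2; rewrite hh lerDl dot2_ge0.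
have [|_ hQ] := small Q AQ; first by apply: le2; rewrite hh lerDr dot2_ge0.
have hPQ : dot2 h h = dot2 h P + dot2 h (J Q) by rewrite {2}hE (dot2Dr ip).
have nh0 : `|h| ^+ 2 <= 0.
  have := dot2_ge ipE h; move: hP hQ; rewrite hPQ !ler_norml.
  by move=> /andP[_ ?] /andP[_ ?]; have := sqr_ge0 `|h|; lra.
by apply/eqP; rewrite -normr_eq0 -sqrf_eq0 eq_le nh0 sqr_ge0.
Qed.

End symmetric_operators.

(** * Constancy of the defect *)

Section field.
Variables (R : realType) (H : completeNormedModType R) (ip : {dot H for idfun}).
Hypothesis ipE : forall x : H, ip x x = `|x| ^+ 2.
Variables (F0 : operator H) (D0 : set H) (x0 : H) (dF0 : H -> operator H).
Variables (Hp : completeNormedModType R) (iota : Hp -> H) (D : H -> operator H).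
Hypothesis hF0 : initial_operator ip F0 D0 x0 dF0.
Hypothesis ha : condition_a ip F0 dF0 D.
Hypothesis hb : condition_b D0 iota D.
Hypothesis hc : condition_c iota D.

Local Notation dot2 := (dot2 ip).
Local Notation J := (@J R H).
Local Notation Phi := (Phi ip F0 x0 iota D).
Local Notation M := (maxgraph ip F0 x0 iota D).

Let il : linear iota. Proof. by have [[]] := hb. Qed.
Let ic : continuous iota. Proof. by have [[]] := hb. Qed.
Let linD x : linear_operator (D x). Proof. exact: (ha.2 x).1. Qed.
Let symD x : symmetric_operator ip (D x). Proof. exact: (ha.2 x).2. Qed.
Let domD x : dom (D x) = range iota. Proof. exact: (hb.2 x).1. Qed.
Let domiota x u : dom (D x) (iota u). Proof. by rewrite domD; exists u. Qed.

Lemma dense_iota : dense (range iota).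
Proof.
have [_ dD0 _ _] := hF0; have [[_ _ _ D0i _] _] := hb.
by move=> N N0 oN; have [y [Ny /D0i]] := dD0 N N0 oN; exists y.
Qed.

(** The parametrization of the graph of [D x] by the space [Hp], which is the same
    for all [x]; it makes the graphs at different points comparable. *)
Definition section_map (x : H) (u : Hp) : H * H := (iota u, D x (iota u)).

Lemma section_map_linear x : linear (section_map x).
Proof.
move=> a u v; rewrite /section_map il.
by have [_ ->//] := linD x.
Qed.

Definition section_linear x := linear_of (section_map_linear x).

Lemma range_section x : range (section_map x) = graph (D x).
Proof.
apply/seteqP; split=> [_ [u _ <-]|[h k] [/= + ->]]; first by split=> /=.
by rewrite domD => -[u _ <-]; exists u.
Qed.

Lemma section_continuous x : continuous (section_map x).
Proof.
have [[_ [C DC]] _] := hc x.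
have [K K0 iK] := continuous_opnorm (L := linear_of il) ic.
have cS : continuous (section_linear x).
  apply: (opnorm_continuous (C := Num.max K C)) => u.
  rewrite prod_normE /= maxr_pMl// ge_max !le_max iK DC/= orbT.
  by [].
exact: cS.
Qed.

Lemma section_bounded_below x :
  exists2 C, 0 < C & forall u, `|u| <= C * `|section_map x u|.
Proof.
have [[_ _ _ _ dD0] _] := hb; have [_ [c [C [c0 _ cP]]]] := hb.2 x.
(* The factor 2 compares the maximum norm of [H * H] with the Euclidean one. *)
exists (2 / c) => [|u]; first by rewrite divr_gt0.
rewrite leNgt; apply/negP => lt.
pose f u := `|u| - 2 / c * `|section_map x u|.
have cf : continuous f.
  move=> w; apply: cvgB; first exact: cvg_norm.
  by apply: cvgMr; apply: cvg_norm; exact: section_continuous.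
have nu : \forall w \near u, 0 < f w.
  by apply: cvgr_gt; [exact: cf | rewrite subr_gt0].
have [w wD0] := dense_near dD0 nu; rewrite /f subr_gt0; apply/negP; rewrite -leNgt.
have /andP[cw _] := cP w wD0.
rewrite mulrAC ler_pdivlMr// mulrC (le_trans cw)//.
rewrite -(ler_pXn2r (n := 2)) ?nnegrE ?sqrtr_ge0 ?mulr_ge0//.
rewrite sqr_sqrtr ?addr_ge0 ?sqr_ge0// exprMn.
have [/= h1 h2] := prod_norm_ge (section_map x w).
have := sqr_ge0 `|section_map x w|.
have : `|iota w| ^+ 2 <= `|section_map x w| ^+ 2 by rewrite ler_pXn2r ?nnegrE.
have : `|D x (iota w)| ^+ 2 <= `|section_map x w| ^+ 2 by rewrite ler_pXn2r ?nnegrE.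
by rewrite [2 ^+ 2]expr2; lra.
Qed.

(** The graph norm of [D x] is equivalent to the norm of [Hp], which is complete. *)
Lemma closed_graph x : closed (graph (D x)).
Proof.
have [C _ CP] := section_bounded_below x; rewrite -range_section.
exact: (closed_range (T := section_linear x) (@section_continuous x) CP).
Qed.

Lemma section_near x e : 0 < e ->
  \forall y \near x, forall u, `|section_map y u - section_map x u| <= e * `|u|.
Proof.
move=> e0; have [_ cD] := hc x; apply: filterS (cD e e0) => y ye u.
rewrite prod_normE /= subrr normr0 ge_max ye andbT mulr_ge0//.
exact: ltW.
Qed.

Lemma defect_near x n : \forall y \near x,
  dim_le (defect_space ip (D x)) n <-> dim_le (defect_space ip (D y)) n.
Proof.
have [C C0 CP] := section_bounded_below x.
(* At a point this close to [x], the section map is bounded below with the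
   constant [2 * C], and [e * (2 * C) <= 16^-1] for [e = (32 * C)^-1]. *)
have e0 : 0 < (32 * C)^-1 by rewrite invr_gt0 mulr_gt0.
apply: filterS (section_near x e0) => y ye.
have eC : (32 * C)^-1 * C = 32^-1 by rewrite invfM mulfVK// gt_eqF.
have CP' u : `|u| <= 2 * C * `|section_map y u|.
  have := CP u.
  have : `|section_map x u| <= `|section_map y u| + (32 * C)^-1 * `|u|.
    rewrite -{1}(subrK (section_map y u) (section_map x u)) addrC.
    by rewrite (le_trans (ler_normD _ _))// lerD2l distrC.
  move/(ler_wpM2l (ltW C0)); rewrite mulrDr mulrA [C * (32 * C)^-1]mulrC eC.
  by have := normr_ge0 u; rewrite -mulrA; lra.
split.
  apply: (defect_gap ipE (S := section_map x) (S' := section_map y) (C := C)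
    (e := (32 * C)^-1)) => //; rewrite ?range_section//.
  - exact: closed_graph.
  - by move=> u; rewrite distrC; exact: ye.
  - exact: ltW.
  - by rewrite eC; lra.
apply: (defect_gap ipE (S := section_map y) (S' := section_map x) (C := 2 * C)
  (e := (32 * C)^-1)) => //; rewrite ?range_section//.
- exact: closed_graph.
- exact: ltW.
- by rewrite mulrCA eC; lra.
Qed.

(** Along a segment, the points where the bound holds form an open and closed
    set. *)
Lemma defect_constant x y n :
  dim_le (defect_space ip (D x)) n -> dim_le (defect_space ip (D y)) n.
Proof.
move=> dx.
pose p (t : R) := x + t *: (y - x).
have cp : continuous p.
  by move=> t; apply: cvgD; [exact: cvg_cst|apply: cvgZl; exact: cvg_id].
pose B := [set t | dim_le (defect_space ip (D (p t))) n].
have nB t : \forall s \near t, B t <-> B s.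
  exact: (cp t _ (defect_near (p t) n)).
have oB : open B.
  rewrite openE => t Bt; apply: filterS (nB t) => s [H1 _]; exact: H1.
have cB : closed B.
  rewrite -[B]setCK; apply: open_closedC; rewrite openE => t Bt.
  by apply: filterS (nB t) => s [_ H1] /H1.
have E : `[0%R, 1%R]%classic `&` B = `[0%R, 1%R]%classic.
  apply: (@segment_connected R 0 1).
  - exists 0; split; first by rewrite /= in_itv/= lexx ler01.
    by rewrite /B/= /p scale0r addr0.
  - by exists B.
  - by exists B.
have : (`[0%R, 1%R]%classic `&` B) 1 by rewrite E /= in_itv/= lexx ler01.
by move=> [_]; rewrite /B/= /p scale1r addrC subrK.
Qed.

Lemma finite_defect_le m : finite_defect ip F0 D m ->
  forall x, dim_le (defect_space ip (D x)) (2 * m).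
Proof. by move=> [x _ /has_dim_le dx] y; exact: (defect_constant dx). Qed.

End field.

(** * The potential of the field and the maximal extension *)

Section integrals.
Variable R : realType.
Local Notation mu := (@lebesgue_measure R).

(** By compactness of the segment, the integrands converge uniformly. *)
Lemma parametric_integral_continuous (V : normedModType R) (k : V -> R -> R) :
  (forall x t, {for (x, t), continuous (fun p : V * R => k p.1 p.2)}) ->
  continuous (fun x => \int[mu]_(t in `[0%R, 1%R]) k x t).
Proof.
move=> ck x; apply/cvgrPdist_le => e e0.
have ckx y : continuous (k y).
  move=> t; apply/cvgrPdist_lt => e1 e10.
  have /cvgr_dist_lt/(_ _ e10)[[A B]/= [nA nB] AB] := ck y t.
  apply: filterS nB => t' Bt'.
  exact: (AB (y, t') (conj (nbhs_singleton nA) Bt')).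
have ik y : mu.-integrable `[0%R, 1%R] (EFin \o k y).
  apply: continuous_compact_integrable; first exact: segment_compact.
  exact: continuous_subspaceT.
have : \forall y \near x, `[0%R, 1%R]%classic `<=` [set t | `|k x t - k y t| <= e].
  have /compact_near_coveringP := @segment_compact R 0 1; apply=> t _.
  have e20 : 0 < e / 2 by rewrite divr_gt0.
  have /cvgr_dist_lt/(_ _ e20)[[A B]/= [nA nB] AB] := ck x t.
  exists (B, A) => //= -[t' y] [/= Bt' Ay].
  have H1 := AB (y, t') (conj Ay Bt').
  have H2 := AB (x, t') (conj (nbhs_singleton nA) Bt').
  rewrite /= in H1 H2.
  rewrite -(subrK (k x t) (k x t')) -addrA (le_trans (ler_normD _ _))//.
  by rewrite distrC (splitr e) lerD// ltW.
apply: filterS => y ye.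
have mI : measurable (`[0%R, 1%R]%classic : set (measurableTypeR R)).
  exact: measurable_itv.
rewrite -(RintegralB mI (ik x) (ik y)).
have ikB : mu.-integrable `[0%R, 1%R] (EFin \o (fun t => k x t - k y t)).
  apply: continuous_compact_integrable; first exact: segment_compact.
  by apply: continuous_subspaceT => t; apply: cvgB; exact: ckx.
rewrite (le_trans (le_normr_Rintegral _ ikB))//.
have -> : e = \int[mu]_(t in `[0%R, 1%R]) e.
  by rewrite Rintegral_cst//= lebesgue_measure_itv/= lte_fin ltr01 oppr0 adde0 mulr1.
apply: le_Rintegral => //.
- apply: continuous_compact_integrable; first exact: segment_compact.
  apply: continuous_subspaceT => t; apply: cvg_norm.
  by apply: cvgB; exact: ckx.
- apply: continuous_compact_integrable; first exact: segment_compact.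
  by apply: continuous_subspaceT => t; exact: cvg_cst.
Qed.

Lemma integral_derivative (g k : R -> R) : continuous k ->
  (forall t : R, is_derive t (1 : R) g (k t)) ->
  \int[mu]_(t in `[0%R, 1%R]) k t = g 1 - g 0.
Proof.
move=> ck dg.
have cg : continuous g.
  move=> t; apply: differentiable_continuous; apply/derivable1_diffP.
  by have [] := dg t.
rewrite /Rintegral (@continuous_FTC2 _ k g)//.
- exact: continuous_subspaceT.
- split; first by move=> t _; have [] := dg t.
    by apply: cvg_at_right_filter; exact: cg.
  by apply: cvg_at_left_filter; exact: cg.
- by move=> t _; rewrite derive1E; have [] := dg t.
Qed.

(** The two difference quotients are the same function. *)
Lemma gateaux_line (V W : normedModType R) (f : V -> W) (y k : V) (t : R) l :
  is_derive (y + t *: k) k f l -> is_derive t 1 (fun s => f (y + s *: k)) l.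
Proof.
have E : (fun h : R => h^-1 *: ((f \o shift (y + t *: k)) (h *: k) -
                                f (y + t *: k))) =
    (fun h : R => h^-1 *: (((fun s => f (y + s *: k)) \o shift t) (h *: (1 : R)) -
                           f (y + t *: k))).
  apply/funext => h /=; congr (_ *: (f _ - _)).
  by rewrite [_ *: 1]mulr1 scalerDl addrCA.
by move=> [df <-]; split; [move: df; rewrite /derivable E|rewrite /derive E].
Qed.

End integrals.

Section potential.
Variables (R : realType) (H : completeNormedModType R) (ip : {dot H for idfun}).
Hypothesis ipE : forall x : H, ip x x = `|x| ^+ 2.
Variables (F0 : operator H) (D0 : set H) (x0 : H) (dF0 : H -> operator H).
Variables (Hp : completeNormedModType R) (iota : Hp -> H) (D : H -> operator H).
Hypothesis hF0 : initial_operator ip F0 D0 x0 dF0.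
Hypothesis ha : condition_a ip F0 dF0 D.
Hypothesis hb : condition_b D0 iota D.
Hypothesis hc : condition_c iota D.

Local Notation Phi := (Phi ip F0 x0 iota D).
Local Notation M := (maxgraph ip F0 x0 iota D).

Let domiota x u : dom (D x) (iota u).
Proof. by rewrite (hb.2 x).1; exists u. Qed.

Let symD x : symmetric_operator ip (D x). Proof. exact: (ha.2 x).2. Qed.

(** By the polarization identity the inner product is a function of norms. *)
Lemma ip_continuous2 : continuous (fun z : H * H => ip z.1 z.2).
Proof.
have -> : (fun z : H * H => ip z.1 z.2) =
    (fun z => 4^-1 * (`|z.1 + z.2| ^+ 2 - `|z.1 - z.2| ^+ 2)).
  apply/funext => z; rewrite -!ipE !(ipDl ip, ipDr ip, ipNl ip, ipNr ip).
  by rewrite (ipC ip z.1 z.2); field.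
move=> z; apply: cvgMr; apply: cvgB.
  apply: (@continuous_comp _ _ _ (fun z : H * H => `|z.1 + z.2|)
    (fun r : R => r ^+ 2)); last exact: exprn_continuous.
  by apply: cvg_norm; apply: cvgD; [exact: cvg_fst | exact: cvg_snd].
apply: (@continuous_comp _ _ _ (fun z : H * H => `|z.1 - z.2|)
  (fun r : R => r ^+ 2)); last exact: exprn_continuous.
by apply: cvg_norm; apply: cvgB; [exact: cvg_fst | exact: cvg_snd].
Qed.

Lemma field_continuous u : continuous (fun x => D x (iota u)).
Proof.
move=> x; apply/cvgrPdist_le => e e0; have [_ cD] := hc x.
have d0 : 0 < e / (`|u| + 1) by rewrite divr_gt0// ltr_pwDr.
apply: filterS (cD _ d0) => y ye; rewrite distrC (le_trans (ye u))//.
by rewrite mulrAC ler_pdivrMr ?ltr_pwDr// ler_wpM2l ?(ltW e0)// lerDl.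
Qed.

Lemma field_extends x w : dom F0 x -> D0 w ->
  dom (D x) w /\ D x w = dF0 x w.
Proof.
move=> Fx Dw; have [_ _ _ /(_ x Fx)[dE _ _ _]] := hF0.
have : graph (D x) (w, dF0 x w).
  by rewrite ha.1//; apply: subset_closure; split=> //=; rewrite dE.
by move=> [].
Qed.

Lemma dom_F0_line x w t : dom F0 x -> D0 w -> dom F0 (x + t *: w).
Proof.
have [[D00 D0P] _ dFE _] := hF0; rewrite dFE => -[v Dv <-] Dw.
by exists (t *: w + v); [exact: D0P | rewrite -addrA addrC].
Qed.

(** The symmetry of [D (x + t *: w)] moves the operator to the fixed vector
    [iota u], so that the derivative is continuous in [t]. *)
Lemma F0_line x w u (t : R) : dom F0 x -> D0 w ->
  is_derive t (1 : R) (fun s : R => ip (iota u) (F0 (x + s *: w)))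
    (ip (D (x + t *: w) (iota u)) w).
Proof.
move=> Fx Dw; have Ft := dom_F0_line t Fx Dw.
have [_ _ _ /(_ _ Ft)[_ _ _ /(_ w Dw) dF]] := hF0.
have [dw dE] := field_extends Ft Dw.
rewrite symD// dE.
have l : linear (ip (iota u) : H -> R) by move=> a v v'; rewrite (ipDr ip) (ipZr ip).
apply: (is_derive_linear (L := linear_of l) (g := fun s : R => F0 (x + s *: w))).
  exact: (ip_continuousr ipE).
exact: gateaux_line.
Qed.

Let segment_integrand_continuous u :
  continuous (fun p : H * R => ip (D (x0 + p.2 *: (p.1 - x0)) (iota u)) (p.1 - x0)).
Proof.
move=> p.
have c1 : {for p, continuous (fun p : H * R => p.1 - x0)}.
  by apply: cvgB; [exact: cvg_fst | exact: cvg_cst].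
have c2 : {for p, continuous (fun p : H * R => x0 + p.2 *: (p.1 - x0))}.
  by apply: cvgD; [exact: cvg_cst | apply: cvgZ; [exact: cvg_snd | exact: c1]].
apply: (@continuous_comp _ _ _ (fun p : H * R =>
  (D (x0 + p.2 *: (p.1 - x0)) (iota u), p.1 - x0)) (fun z : H * H => ip z.1 z.2)).
  apply: cvg_pair => //=.
  exact: (continuous_comp c2 (@field_continuous u _)).
exact: ip_continuous2.
Qed.

(** The fundamental theorem of calculus along the segment from [x0] to [x], which
    stays in [dom F0]. *)
Lemma Phi_F0 x u : dom F0 x -> Phi x u = ip (iota u) (F0 x).
Proof.
have [[D00 D0P] _ dFE _] := hF0; rewrite dFE => -[w Dw <-].
rewrite /Defs.Phi addrK.
have F0x0 : dom F0 x0 by rewrite dFE; exists 0 => //; rewrite add0r.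
pose k t := ip (D (x0 + t *: w) (iota u)) w.
have ck : continuous k.
  move=> t; apply: (@continuous_comp _ _ _ (fun t : R => D (x0 + t *: w) (iota u))
    (fun y => ip y w)); last exact: (ip_continuous ipE).
  apply: (@continuous_comp _ _ _ (fun t : R => x0 + t *: w)
    (fun x => D x (iota u))); last exact: field_continuous.
  by apply: cvgD; [exact: cvg_cst | apply: cvgZl; exact: cvg_id].
have := integral_derivative ck (fun t => F0_line u t F0x0 Dw).
rewrite /k => ->; rewrite scale1r scale0r addr0 [x0 + w]addrC.
by rewrite [LHS]addrC subrK.
Qed.

Lemma Phi_continuous u : continuous (Phi ^~ u).
Proof.
move=> x; apply: cvgD; first exact: cvg_cst.
apply: (parametric_integral_continuous (k := fun x t =>
  ip (D (x0 + t *: (x - x0)) (iota u)) (x - x0))).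
move=> y t; exact: segment_integrand_continuous.
Qed.

Lemma dense_dom_F0 : dense (dom F0).
Proof.
have [_ dD0 dFE _] := hF0; move=> N [y Ny] oN; rewrite dFE.
have nN : \forall w \near y - x0, N (w + x0).
  have /near_distP[d d0 dP] := open_nbhs_nbhs (conj oN Ny).
  apply/near_distP; exists d => // w wd; apply: dP.
  by move: wd; rewrite opprB addrA.
have [w Dw Nw] := dense_near dD0 nN.
by exists (w + x0); split=> //; exists w.
Qed.

(** On [dom F0] the function [Phi ^~ u] is [x |-> (iota u, F0 x)], and the mean
    value theorem bounds [psi], the remainder of its Taylor expansion at [x] in
    excess of [e * |b - a|].  Since [psi] is continuous and [dom F0] is dense, the
    bound extends to all nearby points. *)
Lemma Phi_diff u x : differentiable (Phi ^~ u) x /\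
  'd (Phi ^~ u) x = (fun h => ip (D x (iota u)) h) :> (H -> R).
Proof.
have l : linear (ip (D x (iota u)) : H -> R).
  by move=> a v v'; rewrite (ipDr ip) (ipZr ip).
apply: (near_diff (L := linear_of l)); first exact: (ip_continuousr ipE).
move=> e e0; have cD := @field_continuous u x.
have /near_distP[d d0 dP] : \forall y \near x, `|D x (iota u) - D y (iota u)| <= e.
  by move/cvgrPdist_le : cD; exact.
apply/near_distP; exists d => // y yx /=.
pose psi a b := `|Phi b u - Phi a u - ip (D x (iota u)) (b - a)| - e * `|b - a|.
have onF a b : dom F0 a -> dom F0 b -> `|a - x| < d -> `|b - x| < d ->
    psi a b <= 0.
  move=> Fa Fb ax bx; rewrite /psi subr_le0 !Phi_F0//.
  have Dab : D0 (b - a).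
    move: Fa Fb; have [[D00 D0P] _ -> _] := hF0 => -[v Dv <-] [w Dw <-].
    by rewrite opprD addrACA subrr addr0 addrC -scaleN1r; exact: D0P.
  have [t] : exists2 t : R, t \in `[0, 1]%R &
      ip (iota u) (F0 (a + 1 *: (b - a))) - ip (iota u) (F0 (a + 0 *: (b - a))) =
      ip (D (a + t *: (b - a)) (iota u)) (b - a) * (1 - 0).
    apply: (@MVT_segment _ (fun t : R => ip (iota u) (F0 (a + t *: (b - a))))
      (fun t : R => ip (D (a + t *: (b - a)) (iota u)) (b - a))) => //.
      by move=> t _; exact: F0_line.
    apply: derivable_within_continuous => t _.
    by have [] := @F0_line a (b - a) u t Fa Dab.
  rewrite in_itv/= => t01; rewrite subr0 mulr1 scale1r scale0r addr0.
  rewrite [a + (b - a)]addrC subrK => ->.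
  rewrite -(ipBl ip) (le_trans (ip_cauchy_schwarz ipE _ _))// ler_wpM2r//.
  by rewrite distrC; apply: dP; exact: ball_line.
rewrite -subr_le0 -/(psi x y) leNgt; apply/negP => psi0.
have cpsi : {for (x, y), continuous (fun p : H * H => psi p.1 p.2)}.
  have c1 : (p.2 : H) - p.1 @[p --> (x, y)] --> y - x.
    by apply: cvgB; [exact: cvg_snd | exact: cvg_fst].
  apply: cvgB; last by apply: cvgMr; exact: cvg_norm.
  apply: cvg_norm; apply: cvgB.
    apply: cvgB.
      apply: (@continuous_comp _ _ _ snd (Phi ^~ u)); first exact: cvg_snd.
      exact: Phi_continuous.
    apply: (@continuous_comp _ _ _ fst (Phi ^~ u)); first exact: cvg_fst.
    exact: Phi_continuous.
  apply: (@continuous_comp _ _ _ (fun p : H * H => p.2 - p.1)) => //.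
  exact: (ip_continuousr ipE).
have [[A B] /= [nA nB] AB] := cvgr_gt _ cpsi _ psi0.
have nx : \forall a \near x, `|a - x| < d by apply/near_distP; exists d.
have ny : \forall b \near y, `|b - x| < d.
  apply/near_distP; exists (d - `|y - x|); first by rewrite subr_gt0.
  move=> b yb; rewrite -(subrK y b) -addrA (le_lt_trans (ler_normD _ _))//.
  by rewrite -ltrBrDr.
have [a Fa [Aa ax]] := dense_near dense_dom_F0 (filterI nA nx).
have [b Fb [Bb bx]] := dense_near dense_dom_F0 (filterI nB ny).
have := AB (a, b) (conj Aa Bb); rewrite /= ltNge => /negP; apply.
exact: onF.
Qed.

(** The value chosen by [Fmax] is unique, as [range iota] is dense. *)
Lemma maxgraphP z : M z <-> forall v, Phi z.1 v = ip (iota v) z.2.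
Proof.
split=> [[[y yP] /= ->] v|zP].
  exact: (@getPex _ (maximal_values ip F0 x0 iota D z.1) (ex_intro _ y yP)).
split; first by exists z.2.
apply: (ip_dense_eq ipE (dense_iota hF0 hb)) => _ [v _ <-].
rewrite -zP.
exact: (@getPex _ (maximal_values ip F0 x0 iota D z.1) (ex_intro _ z.2 zP)).
Qed.

Lemma graph_F0_max : graph F0 `<=` M.
Proof. by move=> [x _] [/= Fx ->]; apply/maxgraphP => v /=; exact: Phi_F0. Qed.

(** Differentiate the equation [Phi x v = (iota v, y)] of the maximal graph. *)
Lemma curve_adjoint (g : R -> H * H) (t : H * H) : is_derive (0 : R) 1 g t ->
  (\forall s \near (0 : R), M (g s)) -> adjoint_graph ip (D (g 0).1) t.
Proof.
move=> dg gM v'; rewrite (hb.2 (g 0).1).1 => -[v _ <-] {v'}.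
have lfst : linear (fst : H * H -> H) by [].
have lsnd : linear (snd : H * H -> H) by [].
have lv : linear (ip (iota v) : H -> R).
  by move=> a w w'; rewrite (ipDr ip) (ipZr ip).
have d1 : is_derive (0 : R) 1 (fst \o g) t.1.
  by apply: (is_derive_linear (L := linear_of lfst)) => // z; exact: cvg_fst.
have d2 : is_derive (0 : R) 1 (snd \o g) t.2.
  by apply: (is_derive_linear (L := linear_of lsnd)) => // z; exact: cvg_snd.
have {}d2 : is_derive (0 : R) 1 (fun s => ip (iota v) (g s).2) (ip (iota v) t.2).
  apply: (is_derive_linear (L := linear_of lv) (g := snd \o g)) => //.
  exact: (ip_continuousr ipE).
have [dP dPE] := Phi_diff v (g 0).1.
have {}d1 : is_derive (0 : R) 1 (fun s => Phi (g s).1 v)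
    (ip (D (g 0).1 (iota v)) t.1).
  have := is_derive_diff_comp (f := Phi ^~ v) (g := fst \o g) dP d1.
  by have /= -> := congr1 (@^~ t.1) dPE.
have E : \forall s \near (0 : R), Phi (g s).1 v = ip (iota v) (g s).2.
  by apply: filterS gM => s /maxgraphP.
have [_ <-] := near_eq_is_derive E d1.
by have [_ <-] := d2.
Qed.

End potential.

(** * Tangent spaces *)

Section coarsening.
Variables (R : realType) (E : normedModType R).

Lemma smooth_on_C1 k (V W : normedModType R) (O : set V) (f : V -> W) :
  smooth_on k O f -> C1_on O f.
Proof. by case: k => // -[]. Qed.

Lemma C1_transition k (N : manifold R k) (a a' : chart_index N) :
  let O := @cdom R k N a `&` @cmap R k N a @^-1` (@cmap R k N a' @` @cdom R k N a') in
  open O /\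
  exists tau : model a -> model a', smooth_on C1 O tau /\
    forall b, O b -> @cdom R k N a' (tau b) /\ @cmap R k N a' (tau b) = @cmap R k N a b.
Proof.
have [oO [tau [stau tauP]]] := @transition R k N a a'.
by split=> //; exists tau; split=> //=; exact: smooth_on_C1 stau.
Qed.

Definition C1_manifold k (N : manifold R k) : manifold R C1 :=
  @Manifold R C1 N (chart_index N) (@model R k N) (@cdom R k N) (@cmap R k N)
    (@cdom_open R k N) (@cmap_inj R k N) (@cmap_cover R k N) (@C1_transition k N).

Lemma C1_regular_parametrization (S : set E) k (N : manifold R k) (i : N -> E) :
  regular_parametrization S i ->
  @regular_parametrization R E S C1 (C1_manifold N) i.
Proof.
move=> [[ii im] hi ri]; split=> //; split=> // a.
by have [sm ?] := im a; split=> //=; exact: smooth_on_C1 sm.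
Qed.

End coarsening.

Section tangents.
Variables (R : realType) (H : completeNormedModType R) (ip : {dot H for idfun}).
Hypothesis ipE : forall x : H, ip x x = `|x| ^+ 2.
Variables (S : set (H * H)) (k : smoothness) (N : manifold R k) (i : N -> H * H).
Hypothesis regi : regular_parametrization S i.
Variables (a : chart_index N) (b : model a).
Hypothesis ab : @cdom R k N a b.
Let f : model a -> H * H := i \o @cmap R k N a.

Lemma chart_differentiable : differentiable f b.
Proof.
have [[_ /(_ a)[sf _]] _ _] := regi.
exact: C1_differentiable (smooth_on_C1 sf) ab.
Qed.

Lemma chart_bounded_below : exists2 C, 0 < C &
  forall h, `|h| <= C * `|'d f b h|.
Proof.
have [[_ /(_ a)[_ /(_ b ab)[inj cl]]] _ _] := regi.
by apply: (bounded_below ipE) => //; exact: diff_continuous chart_differentiable.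
Qed.

(** The chart is a homeomorphism onto its image, so the curve lifts to the model.
    The lower bound on the differential makes the lift move at most as fast as [g],
    up to a constant; hence the difference quotients of [g] are close to ['d f b]
    applied to those of the lift, and the range of ['d f b] is closed. *)
Lemma curve_velocity (g : R -> H * H) (t : H * H) : g 0 = f b ->
  is_derive (0 : R) 1 g t -> (\forall s \near (0 : R), S (g s)) ->
  range ('d f b) t.
Proof.
move=> g0 dg gS.
have [[_ /(_ a)[_ /(_ b ab)[_ cl]]] hom rS] := regi.
have [C C0 CP] := chart_bounded_below.
apply: cl => B /near_distP[e e0 eB].
(* [K * s] will bound the distance of the lift from [b] at time [s]; the bound
   [(2 * C)^-1] on [e1] makes the linear part of [f] dominate. *)
pose e2 := e / 4; have e20 : 0 < e2 by rewrite divr_gt0.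
pose K := 2 * C * (`|t| + e2).
have K0 : 0 < K by rewrite !mulr_gt0// ltr_wpDl.
pose e1 := Num.min (2 * C)^-1 (e2 / K).
have e10 : 0 < e1 by rewrite lt_min invr_gt0 !mulr_gt0// invr_gt0.
have /near_distP[d d0 dP] := diff_near chart_differentiable e10.
pose O := @cdom R k N a `&` [set x | `|x - b| < d].
have oO : open O.
  by apply: openI; [exact: cdom_open | exact: open_dist_lt].
have [W oW OW] : open_in (range i) (f @` O).
  by apply: hom => // x [].
have Wb : W (f b).
  have : (f @` O) (f b) by exists b => //; split=> //=; rewrite subrr normr0.
  by rewrite OW => -[].
have cg : {for 0, continuous g}.
  by apply: differentiable_continuous; apply/derivable1_diffP; have [] := dg.
have nW : \forall s \near (0 : R), W (g s).
  by apply: cg; rewrite g0; exact: open_nbhs_nbhs.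
have /is_derive_nearP/(_ _ e20) ng := dg.
have /near_distP[r r0 rP] : \forall h \near (0 : R), (S (g h) /\ W (g h)) /\
    `|g h - g 0 - (h - 0) *: t| <= e2 * `|h - 0|.
  exact: filterI (filterI gS nW) ng.
pose s := r / 2; have s0 : 0 < s by rewrite divr_gt0.
have sr : `|s - 0| < r by rewrite subr0 gtr0_norm// /s; lra.
have [[Sgs Wgs]] := rP s sr; rewrite subr0 g0 gtr0_norm// => gs.
have : (f @` O) (g s) by rewrite OW; split=> //; rewrite rS.
move=> [b' [_ /= b'd] fb'].
have H1 := dP b' b'd; rewrite fb' in H1.
have e1C : e1 <= (2 * C)^-1 by rewrite ge_min lexx.
have e1K : e1 <= e2 / K by rewrite ge_min lexx orbT.
have gn : `|g s - f b| <= (`|t| + e2) * s.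
  rewrite -(subrK (s *: t) (g s - f b)) (le_trans (ler_normD _ _))//.
  by rewrite normrZ gtr0_norm// mulrDl addrC lerD// mulrC.
have bn : `|b' - b| <= K * s.
  have low := CP (b' - b).
  have up : `|'d f b (b' - b)| <= `|g s - f b| + (2 * C)^-1 * `|b' - b|.
    rewrite -(subKr (g s - f b) ('d f b (b' - b))) (le_trans (ler_normB _ _))//.
    by rewrite lerD2l (le_trans H1)// ler_wpM2r.
  have E : C * ((2 * C)^-1 * `|b' - b|) = 2^-1 * `|b' - b|.
    by field; rewrite gt_eqF.
  have : `|b' - b| <= C * `|g s - f b| + 2^-1 * `|b' - b|.
    by rewrite -E -mulrDr (le_trans low)// ler_pM2l.
  have := ler_wpM2l (ltW C0) gn; rewrite /K -!mulrA; lra.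
pose h := s^-1 *: (b' - b).
exists ('d f b h); split; first by exists h.
apply: eB; rewrite linearZ/=.
have -> : s^-1 *: 'd f b (b' - b) - t = s^-1 *: ('d f b (b' - b) - s *: t).
  by rewrite scalerBr scalerA mulVf ?gt_eqF// scale1r.
rewrite normrZ gtr0_norm ?invr_gt0// ltr_pdivrMl//.
have -> : 'd f b (b' - b) - s *: t =
    (g s - f b - s *: t) - (g s - f b - 'd f b (b' - b)).
  by rewrite [in RHS]opprB [RHS]addrC subrKA.
rewrite (le_lt_trans (ler_normB _ _))//.
have : e1 * `|b' - b| <= e2 * s.
  rewrite (le_trans (ler_pM (ltW e10) _ e1K bn))//.
  by rewrite mulrA divfK ?gt_eqF.
have : 0 < e * s by rewrite mulr_gt0.
by move: gs H1; rewrite /e2; lra.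
Qed.

(** Lines in the charts of another regular parametrization are curves in [S], so
    their velocities are in the range of ['d f b] as well. *)
Lemma tangent_spaceE : tangent_space S (f b) = range ('d f b).
Proof.
apply/seteqP; split=> [t|_ [h _ <-]]; last first.
  exists (C1_manifold N), i, (@cmap R k N a b).
  split=> //; first exact: C1_regular_parametrization.
  by exists a, b, h.
move=> [N' [i' [p' [reg' ip' [a' [b' [h [ab' bp' ->]]]]]]]].
have [[_ /(_ a')[sf' _]] _ rS'] := reg'.
have df' : differentiable (i' \o @cmap R C1 N' a') (b' + (0 : R) *: h).
  by rewrite scale0r addr0; exact: C1_differentiable sf' ab'.
apply: (curve_velocity (g := fun s : R => i' (@cmap R C1 N' a' (b' + s *: h)))).
- by rewrite scale0r addr0 bp' ip'.
- have := is_derive_diff_line df'; rewrite scale0r addr0; exact.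
- by near=> s; rewrite -rS'; exists (@cmap R C1 N' a' (b' + s *: h)).
Unshelve. all: by end_near. Qed.

End tangents.

(** * The leaves *)

Section leaves.
Variables (R : realType) (H : completeNormedModType R) (ip : {dot H for idfun}).
Hypothesis ipE : forall x : H, ip x x = `|x| ^+ 2.
Variables (F0 : operator H) (D0 : set H) (x0 : H) (dF0 : H -> operator H).
Variables (Hp : completeNormedModType R) (iota : Hp -> H) (D : H -> operator H).
Hypothesis hF0 : initial_operator ip F0 D0 x0 dF0.
Hypothesis ha : condition_a ip F0 dF0 D.
Hypothesis hb : condition_b D0 iota D.
Hypothesis hc : condition_c iota D.
Hypothesis hfol : regular_foliation ip F0 x0 iota D.

Local Notation M := (maxgraph ip F0 x0 iota D).
Local Notation G := (G ip F0 x0 iota D).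

(** The fibered chart at [z] makes the curve smooth.  The first component of its
    velocity is [iota v], and the second is then determined, because the velocity
    is in the graph of the adjoint of [D z.1] and [D z.1] is symmetric. *)
Lemma leaf_curve z v : M z ->
  curve_in M z (fun s : R => G z (s *: v)) /\
  is_derive (0 : R) 1 (fun s : R => G z (s *: v)) (section_map iota D z.1 v).
Proof.
move=> Mz; have [[il ic _ _ _] _] := hb.
case: (hfol Mz) => B [C] [W] [p] [V] [fib _].
case: fib => _ _ _ [_ [b0 Wb0 pb0]] [V0 dV].
have [oVW [psi1 _] _ hom] := dV.
pose psi (q : Hp * B) := G (p q.2) q.1.
pose aff : R -> Hp * B := fun s => (0, b0) + s *: (v, 0).
have affE s : aff s = (s *: v, b0).
  by rewrite /aff; congr (_, _); rewrite /= ?add0r// scaler0 addr0.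
have aff1 : C1_on (setT : set R) aff by exact: C1_line.
pose O := aff @^-1` (V `*` W).
have gE s : G z (s *: v) = psi (aff s) by rewrite affE /psi /= pb0.
have O0 : O 0.
  have : (V `*` W) (0 *: v, b0) by rewrite scale0r.
  by rewrite -affE.
have oO : open O.
  apply: open_comp => // s _; exact: (C1_continuous aff1).
have g1 : C1_on O (fun s : R => G z (s *: v)).
  have := C1_comp aff1 psi1 openT oVW; rewrite setTI.
  have -> // : psi \o aff = (fun s : R => G z (s *: v)).
  by apply/funext => s; rewrite gE.
have gM s : O s -> M (G z (s *: v)).
  move=> Os; have [Z _ ZE] := hom _ oVW (@subset_refl _ _).
  have : (psi @` (V `*` W)) (psi (aff s)) by exists (aff s).
  by rewrite -gE ZE => -[].
have g0 : G z (0 *: v) = z.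
  rewrite /Defs.G scale0r.
  have i0 : iota 0 = 0 by rewrite -[iota]/(linear_of il : _ -> _) linear0.
  by rewrite i0 addr0; case: (z) Mz => z1 z2 [/= _ ->].
split; first by split=> //; exists O.
have dg : differentiable (fun s : R => G z (s *: v)) 0.
  exact: C1_differentiable g1 O0.
set t := 'd (fun s : R => G z (s *: v)) 0 1.
have dgt : is_derive (0 : R) 1 (fun s : R => G z (s *: v)) t.
  by split; [exact: diff_derivable | rewrite deriveE].
suff -> : section_map iota D z.1 v = t by [].
have t1 : t.1 = iota v.
  have lfst : linear (fst : H * H -> H) by [].
  have [_ <-] := is_derive_linear (L := linear_of lfst)
    (fun z : H * H => @cvg_fst _ _ _ _ _) dgt.
  have [_ //] : is_derive (0 : R) 1 (fun s : R => z.1 + iota (s *: v)) (iota v).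
  have -> : (fun s : R => z.1 + iota (s *: v)) = (fun s => z.1 + s *: iota v).
    apply/funext => s; congr (_ + _).
    by rewrite -[iota]/(linear_of il : _ -> _) linearZ.
  exact: is_derive_line.
have adj : adjoint_graph ip (D z.1) t.
  have := curve_adjoint ipE hF0 ha hb hc dgt; rewrite g0; apply.
  by apply: filterS (open_nbhs_nbhs (conj oO O0)) => s; exact: gM.
have domi u : dom (D z.1) (iota u) by rewrite (hb.2 z.1).1; exists u.
have t2 : D z.1 (iota v) = t.2.
  apply: (ip_dense_eq ipE (dense_iota hF0 hb)) => _ [u _ <-].
  by rewrite -adj// t1; rewrite (ha.2 z.1).2.
by rewrite /section_map t2 -t1; case: (t).
Qed.

End leaves.

(** * Linear algebra in the tangent spaces *)

Section lagrangian.
Variables (R : realType) (H : completeNormedModType R) (ip : {dot H for idfun}).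
Hypothesis ipE : forall x : H, ip x x = `|x| ^+ 2.
Variables (A : operator H) (m : nat) (T : set (H * H)).
Variables (dT : H * H -> 'rV[R]_m) (dT' : 'rV[R]_m -> H * H).
Hypothesis lA : linear_operator A.
Hypothesis sA : symmetric_operator ip A.
Hypothesis cA : closed (graph A).
Hypothesis dA : dense (dom A).
Hypothesis dim : dim_le (defect_space ip A) (2 * m).
Hypothesis lT : linear_subspace (T : set (H * H)%type).
Hypothesis AT : graph A `<=` T.
Hypothesis TA : T `<=` adjoint_graph ip A.
Hypothesis adj : is_adjoint ip T dT dT'.
Hypothesis onto : dT @` T = setT.
Hypothesis charT : range dT' `<=` T `&` @J R H @` T.
Hypothesis iso : forall a, dT (J (dT' a)) = 0.

Local Notation dot2 := (dot2 ip).
Local Notation J := (@J R H).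

(** The tangent space at a zero of the map whose differential is [dT]. *)
Definition kernel_part : set (H * H) := [set t | T t /\ dT t = 0].

Let dT'T a : T (dT' a). Proof. exact: (adj a).1. Qed.

Let adjP a t : T t -> dot2 t (dT' a) = \sum_i dT t 0 i * a 0 i.
Proof. exact: (adj a).2. Qed.

Let JdT'T a : T (J (dT' a)).
Proof.
have [_ [t Tt <-]] := charT (ex_intro2 _ _ a I erefl).
by rewrite JJ -sub0r; apply: subspaceB => //; exact: lT.1.
Qed.

(** The adjoint is determined by its products with [T], which depend linearly on
    the argument. *)
Lemma adjoint_linear : linear dT'.
Proof.
move=> r a b; apply/eqP; rewrite -subr_eq0; apply/eqP/(dot2_eq0 ipE).
set t := _ - _; have Tt : T t.
  by apply: subspaceB => //; exact: lT.2.
rewrite {2}/t !(dot2Br ip, dot2Dr ip) (dot2Zr ip) !adjP//.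
rewrite mulr_sumr -big_split -sumrB big1//= => i _.
by rewrite !mxE; ring.
Qed.

Let dT'l := linear_of adjoint_linear.

(** [dT] is onto, so its adjoint is injective. *)
Lemma adjoint_injective a : dT' a = 0 -> a = 0.
Proof.
move=> a0; have [t Tt ta] : (dT @` T) a by rewrite onto.
have := adjP a Tt; rewrite a0 (dot20r ip) ta => /esym aa.
apply/rowP => i; rewrite mxE; apply/eqP; rewrite -sqrf_eq0 expr2.
move/eqP: aa; rewrite psumr_eq0 => [/allP/(_ i)|j _]; last by rewrite -expr2 sqr_ge0.
by rewrite mem_index_enum => /(_ isT).
Qed.

Lemma JdT'_orth a b : dot2 (J (dT' b)) (dT' a) = 0.
Proof. by rewrite adjP// iso big1// => i _; rewrite mxE mul0r. Qed.

Let defect_dT' a : defect_space ip A (dT' a).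
Proof.
split; first exact/TA/dT'T.
move=> w Aw; have [_ [t Tt <-]] := charT (ex_intro2 _ _ a I erefl).
rewrite dot2_Jl (dot2C ip); have /adjoint_graphE -> // := TA Tt.
by rewrite oppr0.
Qed.

Let defect_JdT' a : defect_space ip A (J (dT' a)).
Proof.
split; first exact/TA/JdT'T.
move=> w Aw; rewrite dot2_Jl (dot2C ip).
by have /adjoint_graphE -> // := TA (dT'T a); rewrite oppr0.
Qed.

(** By the dimension bound the range of [dT'] and its image under [J], which are
    orthogonal, fill the whole defect space. *)
Lemma defect_decomposition r : defect_space ip A r ->
  exists a b, r = dT' a + J (dT' b).
Proof.
have m2 : (2 * m = m + m)%N by rewrite mul2n addnn.
pose e (k : 'I_(m + m)) := match fintype.split k with
  | inl j => dT' (delta_mx 0 j) | inr j => J (dT' (delta_mx 0 j)) end.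
have eE (c : 'I_(m + m) -> R) : \sum_k c k *: e k =
    dT' (\row_j c (lshift m j)) + J (dT' (\row_j c (rshift m j))).
  have dTsum (h : 'I_m -> R) : dT' (\row_j h j) = \sum_j h j *: dT' (delta_mx 0 j).
    rewrite [in LHS](row_sum_delta (\row_j h j)) -[dT']/(dT'l : _ -> _) linear_sum.
    by apply: eq_bigr => j _; rewrite linearZ mxE.
  rewrite big_split_ord /= !dTsum J_sum; congr (_ + _); apply: eq_bigr => j _.
    by rewrite /e (unsplitK (inl j)).
  by rewrite /e (unsplitK (inr j)).
move=> dr; have dim' := dim; rewrite m2 in dim'.
have [||c ->] := @dim_le_span R _ _ _ e dim' _ _ r dr.
- by move=> k; rewrite /e; case: fintype.splitP => j _.
- move=> c; rewrite eE; set a := \row_j _; set b := \row_j _ => ab0.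
  have a0 : a = 0.
    apply/adjoint_injective/(dot2_eq0 ipE).
    have : dot2 (dT' a + J (dT' b)) (dT' a) = 0 by rewrite ab0 (dot20l ip).
    by rewrite (dot2Dl ip) JdT'_orth addr0.
  have b0 : b = 0.
    apply/adjoint_injective/(dot2_eq0 ipE); rewrite -dot2_JJ.
    move: ab0; rewrite a0 -[dT' 0]/(dT'l 0) linear0 add0r => ->.
    exact: dot20l.
  move=> k; case: (fintype.splitP k) => j kE.
    have /rowP/(_ j) := a0; rewrite !mxE => <-; congr c; exact: ord_inj.
  have /rowP/(_ j) := b0; rewrite !mxE => <-; congr c; exact: ord_inj.
by rewrite eE; do 2!eexists.
Qed.

(** The adjoint graph is the sum of the graph of [A] and the defect space, and both
    are in [T]. *)
Lemma tangent_adjoint : T = adjoint_graph ip A.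
Proof.
apply/seteqP; split=> // z /(adjoint_split ipE lA sA cA)[p [r [Ap dr ->]]].
have [a [b ->]] := defect_decomposition dr.
by apply: subspaceD => //; [exact: AT | exact: subspaceD].
Qed.

Lemma dT_eq0 t : T t -> (forall a, dot2 t (dT' a) = 0) -> dT t = 0.
Proof.
move=> Tt t0; apply/rowP => j; rewrite mxE.
have := adjP (delta_mx 0 j) Tt; rewrite t0 (bigD1 j)//= mxE !eqxx mulr1.
rewrite big1 ?addr0// => i ij.
by rewrite mxE eqxx/= (negbTE ij) mulr0.
Qed.

Lemma dT_graph w : graph A w -> dT w = 0.
Proof.
move=> Aw; apply: dT_eq0; first exact: AT.
by move=> a; rewrite (dot2C ip) (defect_dT' a).2.
Qed.

Lemma kernel_partP t : kernel_part t <->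
  exists w a, graph A w /\ t = w + J (dT' a).
Proof.
split=> [[Tt t0]|[w [a [Aw ->]]]].
  have := Tt; rewrite tangent_adjoint => /(adjoint_split ipE lA sA cA).
  move=> [w [r [Aw dr tE]]]; have [a [b rE]] := defect_decomposition dr.
  exists w, b; split=> //.
  suff a0 : dT' a = 0 by rewrite tE rE a0 add0r.
  apply: (dot2_eq0 ipE).
  have : dot2 t (dT' a) = 0 by rewrite adjP// t0 big1// => i _; rewrite mxE mul0r.
  rewrite tE rE !(dot2Dl ip) JdT'_orth addr0 (dot2C ip w) (defect_dT' a).2//.
  by rewrite add0r.
have TwJ : T (w + J (dT' a)) by apply: subspaceD => //; exact: AT.
split=> //; apply: dT_eq0 => // b.
by rewrite (dot2Dl ip) JdT'_orth addr0 (dot2C ip) (defect_dT' b).2.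
Qed.

Lemma kernel_part_inj w a : graph A w -> w + J (dT' a) = 0 -> w = 0 /\ a = 0.
Proof.
move=> Aw wa0.
have a0 : dT' a = 0.
  apply: (dot2_eq0 ipE); rewrite -dot2_JJ.
  have : dot2 (w + J (dT' a)) (J (dT' a)) = 0 by rewrite wa0 (dot20l ip).
  by rewrite (dot2Dl ip) (dot2C ip w) (defect_JdT' a).2// add0r.
split; last exact: adjoint_injective.
by move: wa0; rewrite a0 J0 addr0.
Qed.

Lemma kernel_part_subspace : linear_subspace (kernel_part : set (H * H)%type).
Proof.
have [GA0 GAP] := linear_operator_graph lA.
split; first by split; [exact: lT.1 | exact: dT_graph].
move=> r u v /kernel_partP[w [a [Aw ->]]] /kernel_partP[w' [a' [Aw' ->]]].
apply/kernel_partP; exists (r *: w + w'), (r *: a + a'); split; first exact: GAP.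
by rewrite adjoint_linear J_linear scalerDr addrACA.
Qed.

(** [K] is isotropic because the graph of [A] is orthogonal to the image under [J]
    of the adjoint graph, and [dT'] is orthogonal to [J (dT')].  Conversely, a
    vector that annihilates the graph of [A] is in [T], and if it annihilates
    [J (dT' a)] as well it is orthogonal to the range of [dT']. *)
Lemma kernel_part_lagrangian z :
  kernel_part z <-> forall w, kernel_part w -> dot2 (J w) z = 0.
Proof.
split=> [/kernel_partP[w [a [Aw ->]]] _ /kernel_partP[w' [a' [Aw' ->]]]|zK].
  have Jadd (u v : H * H) : J (u + v) = J u + J v.
    by rewrite -[u]scale1r J_linear !scale1r.
  rewrite Jadd JJ (dot2Dl ip) !(dot2Dr ip) (dot2Nl ip) dot2_JJ.
  have /adjoint_graphE -> // := symmetric_graph sA Aw.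
  rewrite (dot2C ip w') (defect_dT' a).2// (dot2Nl ip) (dot2C ip (dT' a') w).
  by rewrite (dot2C ip w) (defect_dT' a').2// (dot2C ip) JdT'_orth !(oppr0, addr0).
have Az : adjoint_graph ip A z.
  apply/adjoint_graphE => w Aw; apply: zK; apply/kernel_partP.
  exists w, 0; split=> //; rewrite -[dT' 0]/(dT'l 0) linear0.
  by rewrite J0 addr0.
have Tz : T z by rewrite tangent_adjoint.
split=> //; apply: dT_eq0 => // a.
have K : kernel_part (J (dT' a)).
  apply/kernel_partP; exists 0, a; rewrite add0r; split=> //.
  by have [] := linear_operator_graph lA.
by have := zK _ K; rewrite JJ (dot2Nl ip) (dot2C ip) => /eqP; rewrite oppr_eq0 => /eqP.
Qed.

Lemma kernel_part_closed : closed kernel_part.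
Proof.
have -> : kernel_part = \bigcap_(w in kernel_part) [set z | dot2 z (J w) = 0].
  apply/seteqP; split=> z.
    by move=> /kernel_part_lagrangian zK w /zK; rewrite (dot2C ip).
  by move=> zK; apply/kernel_part_lagrangian => w /zK; rewrite (dot2C ip).
apply: closed_bigI => w _.
apply: (@closed_comp _ _ (fun z => dot2 z (J w)) [set 0]); last exact: closed_eq.
by move=> z _; exact: dot2_continuous.
Qed.

(** A vector [(0, k)] of an isotropic space that projects onto a dense set has
    [k = 0], so that [K] is a graph; being its own annihilator, it is the graph of
    a self-adjoint operator. *)
Lemma kernel_part_self_adjoint :
  exists2 B : operator H, self_adjoint ip B & graph B = kernel_part.
Proof.
have [K0 KP] := kernel_part_subspace.
have single h k k' : kernel_part (h, k) -> kernel_part (h, k') -> k = k'.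
  move=> K1 K2; apply/eqP; rewrite -subr_eq0; apply/eqP.
  have := subspaceB kernel_part_subspace K1 K2.
  have -> : (h, k) - (h, k') = (0, k - k') :> H * H by congr (_, _); rewrite /= subrr.
  move/kernel_part_lagrangian => KO.
  apply: (ip_dense_eq ipE dA) => v Av.
  have : kernel_part (v, A v).
    apply/kernel_partP; exists (v, A v), 0; split=> //.
    rewrite -[dT' 0]/(dT'l 0) linear0.
    by rewrite J0 addr0.
  by move/KO; rewrite /Defs.dot2/= (ip0r ip) add0r (ip0r ip).
pose d := [set h | exists k, kernel_part (h, k)].
pose f h := xget 0 [set k | kernel_part (h, k)].
have fP h k : kernel_part (h, k) -> f h = k.
  move=> K; rewrite /f; case: xgetP => [k' _ /= K'|/(_ k)//].
  exact: single K' K.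
pose B := Operator d f.
have gB : graph B = kernel_part.
  apply/seteqP; split=> [[h k] [/= [k' K ->]]|[h k] K].
    by rewrite (fP _ _ K).
  by split=> /=; [exists k | rewrite (fP _ _ K)].
exists B => //; split.
- split; first split.
  + by exists 0.
  + by move=> r u v [k K] [k' K']; exists (r *: k + k'); exact: (KP r _ _ K K').
  + move=> r u v [k K] [k' K'] /=; rewrite (fP _ _ K) (fP _ _ K').
    exact/fP/(KP r _ _ K K').
- move=> N N0 oN; have [v [Nv Av]] := dA N0 oN; exists v; split=> //.
  exists (A v); apply/kernel_partP; exists (v, A v), 0; split=> //.
  rewrite -[dT' 0]/(dT'l 0) linear0.
  by rewrite J0 addr0.
- apply/seteqP; split=> z; rewrite gB.
    move/kernel_part_lagrangian => zK; apply/adjoint_graphE => w.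
    by rewrite gB; exact: zK.
  by move/adjoint_graphE; rewrite gB => zK; apply/kernel_part_lagrangian.
Qed.

End lagrangian.

(** * The zero set as a manifold *)

Section auxiliary.
Variable R : realType.

Lemma rV_linear_continuous m (V : normedModType R) (L : {linear 'rV[R]_m -> V}) :
  continuous L.
Proof.
apply: (opnorm_continuous (C := \sum_k `|L (delta_mx 0 k)|)) => a.
rewrite {1}(row_sum_delta a) linear_sum mulr_suml (le_trans (ler_norm_sum _ _ _))//.
apply: ler_sum => k _; rewrite linearZ normrZ mulrC ler_wpM2l//.
exact: rV_coord_le.
Qed.

Lemma C1_open_preimage (V W : normedModType R) (O : set V) (f : V -> W) (O' : set W) :
  open O -> C1_on O f -> open O' -> open (O `&` f @^-1` O').
Proof.
move=> oO f1 oO'; rewrite openE => x [Ox Ofx].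
have cf := C1_continuous f1 Ox.
have n1 := cf _ (open_nbhs_nbhs (conj oO' Ofx)).
exact: filterI (open_nbhs_nbhs (conj oO Ox)) n1.
Qed.

Lemma is_derive_translate (V : normedModType R) (g : R -> V) (s : R) (t : V) :
  is_derive (0 : R) 1 (fun h => g (s + h)) t -> is_derive s 1 g t.
Proof.
move/is_derive_nearP => gt; apply/is_derive_nearP => e /gt/near_distP[d d0 dP].
apply/near_distP; exists d => // h hs.
by have := dP (h - s); rewrite subr0 [s + (h - s)]addrC subrK addr0; exact.
Qed.

End auxiliary.

Section zero_manifold.
Variables (R : realType) (H : completeNormedModType R) (ip : {dot H for idfun}).
Hypothesis ipE : forall x : H, ip x x = `|x| ^+ 2.
Variables (F0 : operator H) (D0 : set H) (x0 : H) (dF0 : H -> operator H).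
Variables (Hp : completeNormedModType R) (iota : Hp -> H) (D : H -> operator H).
Hypothesis hF0 : initial_operator ip F0 D0 x0 dF0.
Hypothesis ha : condition_a ip F0 dF0 D.
Hypothesis hb : condition_b D0 iota D.
Hypothesis hc : condition_c iota D.
Hypothesis hfol : regular_foliation ip F0 x0 iota D.

Local Notation M := (maxgraph ip F0 x0 iota D).
Local Notation T := (tangent_space M).
Local Notation J := (@J R H).

Variables (m : nat) (U : set (H * H)) (Theta : H * H -> 'rV[R]_m).
Variables (dTheta : H * H -> H * H -> 'rV[R]_m).
Variables (dTheta' : H * H -> 'rV[R]_m -> H * H).
Hypothesis hdef : finite_defect ip F0 D m.
Hypothesis oU : open_in M U.
Hypothesis hTheta : forall z, U z ->
  [/\ tangent_derivative M Theta z (dTheta z) /\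
        is_adjoint ip (T z) (dTheta z) (dTheta' z),
      dTheta z @` T z = setT,
      range (dTheta' z) `<=` characteristic_space ip F0 x0 iota D z &
      forall a, dTheta z (J (dTheta' z a)) = 0].

Variables (N : manifold R C2) (i : N -> H * H).
Hypothesis regi : regular_parametrization M i.

Local Notation chart a := (i \o @cmap R C2 N a).

Hypothesis sTheta : forall a : chart_index N,
  C2_on (@cdom R C2 N a `&` chart a @^-1` U) (Theta \o i \o @cmap R C2 N a).

Let UM : U `<=` M. Proof. by have [W _ ->] := oU; move=> z []. Qed.

Let chart1 a : C1_on (@cdom R C2 N a) (chart a).
Proof. by have [[_ /(_ a)[[] ]]] := regi. Qed.

Let chartM a b : M (chart a b).
Proof. by have [_ _ <-] := regi; exists (@cmap R C2 N a b). Qed.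

Lemma chart_cover z : M z -> exists a b, @cdom R C2 N a b /\ chart a b = z.
Proof.
have [_ _ <-] := regi; move=> [p _ <-].
by have [a [b ab bp]] := @cmap_cover R C2 N p; exists a, b; rewrite /= bp.
Qed.

Lemma line_in_chart a b (h : model a) : @cdom R C2 N a b ->
  curve_in M (chart a b) (fun s : R => chart a (b + s *: h)) /\
  is_derive (0 : R) 1 (fun s : R => chart a (b + s *: h)) ('d (chart a) b h).
Proof.
move=> ab.
have db : differentiable (chart a) (b + (0 : R) *: h).
  by rewrite scale0r addr0; exact: C1_differentiable (@chart1 a) ab.
have dl := is_derive_diff_line db; rewrite scale0r addr0 in dl.
split=> //; split; first by rewrite scale0r addr0.
pose aff : R -> model a := fun s => b + s *: h.
have aff1 : C1_on (setT : set R) aff by exact: C1_line.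
exists (aff @^-1` @cdom R C2 N a); split.
- have := C1_open_preimage openT aff1 (@cdom_open R C2 N a).
  by rewrite setTI.
- by rewrite /aff/= scale0r addr0.
- have := C1_comp aff1 (@chart1 a) openT (@cdom_open R C2 N a).
  by rewrite setTI.
- by move=> s _; exact: chartM.
Qed.

Lemma tangent_chart a b : @cdom R C2 N a b -> T (chart a b) = range ('d (chart a) b).
Proof. by move=> ab; exact: (tangent_spaceE ipE regi ab). Qed.

Lemma tangent_subspace z : M z -> linear_subspace (T z : set (H * H)%type).
Proof.
move=> /chart_cover[a [b [ab <-]]]; rewrite (tangent_chart ab); split.
  by exists 0 => //; rewrite linear0.
by move=> r _ _ [u _ <-] [v _ <-]; exists (r *: u + v) => //; rewrite linearP.
Qed.

Lemma tangent_sub_adjoint z : M z -> T z `<=` adjoint_graph ip (D z.1).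
Proof.
move=> /chart_cover[a [b [ab <-]]]; rewrite (tangent_chart ab) => _ [h _ <-].
have [[g0 [V [oO O0 _ OM]]] dg] := line_in_chart h ab.
have := curve_adjoint ipE hF0 ha hb hc dg; rewrite scale0r addr0; apply.
by apply: filterS (open_nbhs_nbhs (conj oO O0)) => s; exact: OM.
Qed.

Lemma graph_sub_tangent z : M z -> graph (D z.1) `<=` T z.
Proof.
move=> Mz; rewrite -(range_section hb) => _ [v _ <-].
have [a [b [ab abz]]] := chart_cover Mz.
have [[g0 [V [oO O0 _ OM]]] dg] := leaf_curve ipE hF0 ha hb hc hfol v Mz.
rewrite -[in T _]abz (tangent_chart ab).
apply: (curve_velocity ipE regi ab _ dg); first by rewrite g0 abz.
by apply: filterS (open_nbhs_nbhs (conj oO O0)) => s; exact: OM.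
Qed.

Let lD z : linear_operator (D z). Proof. exact: (ha.2 z).1. Qed.
Let sD z : symmetric_operator ip (D z). Proof. exact: (ha.2 z).2. Qed.
Let cD z : closed (graph (D z)).
Proof. exact: (closed_graph ha hb hc). Qed.
Let dD z : dense (dom (D z)).
Proof. rewrite (hb.2 z).1; exact: (dense_iota hF0 hb). Qed.
Let dimD z : dim_le (defect_space ip (D z)) (2 * m).
Proof. exact: (finite_defect_le ipE ha hb hc hdef). Qed.

Definition kernel_space z := kernel_part (T z) (dTheta z).

Lemma kernel_spaceP z t : U z -> kernel_space z t <->
  exists w a, graph (D z.1) w /\ t = w + J (dTheta' z a).
Proof.
move=> Uz; have Mz := UM Uz; have [[_ adj] onto char iso] := hTheta Uz.
exact: (kernel_partP ipE (@lD _) (@sD _) (@cD _) (@dimD _) (tangent_subspace Mz)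
  (graph_sub_tangent Mz) (tangent_sub_adjoint Mz) adj onto char iso).
Qed.

Lemma kernel_space_closed z : U z -> closed (kernel_space z).
Proof.
move=> Uz; have Mz := UM Uz; have [[_ adj] onto char iso] := hTheta Uz.
exact: (kernel_part_closed ipE (@lD _) (@sD _) (@cD _) (@dimD _)
  (tangent_subspace Mz)
  (graph_sub_tangent Mz) (tangent_sub_adjoint Mz) adj onto char iso).
Qed.

Lemma kernel_space_self_adjoint z : U z ->
  exists2 B : operator H, self_adjoint ip B & graph B = kernel_space z.
Proof.
move=> Uz; have Mz := UM Uz; have [[_ adj] onto char iso] := hTheta Uz.
exact: (kernel_part_self_adjoint ipE (@lD _) (@sD _) (@cD _) (@dD _) (@dimD _)
  (tangent_subspace Mz)
  (graph_sub_tangent Mz) (tangent_sub_adjoint Mz) adj onto char iso).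
Qed.

Lemma kernel_space_inj z w a : U z -> graph (D z.1) w ->
  w + J (dTheta' z a) = 0 -> w = 0 /\ a = 0.
Proof.
move=> Uz; have Mz := UM Uz; have [[_ adj] onto char iso] := hTheta Uz.
exact: (kernel_part_inj ipE (tangent_subspace Mz) (tangent_sub_adjoint Mz) adj
  onto char).
Qed.

Lemma dTheta_graph z w : U z -> graph (D z.1) w -> dTheta z w = 0.
Proof.
move=> Uz; have Mz := UM Uz; have [[_ adj] onto char iso] := hTheta Uz.
exact: (dT_graph (graph_sub_tangent Mz) (tangent_sub_adjoint Mz) adj char).
Qed.

Lemma dTheta'_linear z : U z -> linear (dTheta' z).
Proof.
move=> Uz; have Mz := UM Uz; have [[_ adj] _ _ _] := hTheta Uz.
exact: (adjoint_linear ipE (tangent_subspace Mz) adj).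
Qed.

(** Through each of its points, the line of [graph F0] in the direction of
    [iota v] is the curve [s |-> G z (s *: v)] in the leaf.  Its velocity is in the
    graph of [D z.1], where [dTheta] vanishes. *)
Lemma graph_F0_zero : graph F0 `<=` U ->
  (exists2 z, graph F0 z & Theta z = 0) -> forall z, graph F0 z -> Theta z = 0.
Proof.
move=> F0U [[x1 y1] [/= F1 ->] T1] [x y] [/= Fx ->].
have [[D00 D0P] _ dFE _] := hF0; have [[il _ _ D0i _] _] := hb.
have Dw : D0 (x - x1).
  move: F1 Fx; rewrite dFE => -[v Dv <-] [w Dw <-].
  by rewrite opprD addrACA subrr addr0 addrC -scaleN1r; exact: D0P.
have [v _ vw] := D0i _ Dw.
pose gam (s : R) := (x1 + s *: (x - x1), F0 (x1 + s *: (x - x1))).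
have Fg s : graph F0 (gam s).
  by split=> //=; exact: (dom_F0_line hF0).
have Mg s : M (gam s) by exact: (graph_F0_max ipE hF0 ha hb hc).
have dg (s : R) : is_derive s (1 : R) (Theta \o gam) 0.
  apply: is_derive_translate.
  have Us := F0U _ (Fg s).
  have [[tder _] _ _ _] := hTheta Us.
  have [cv dcv] := leaf_curve ipE hF0 ha hb hc hfol v (Mg s).
  have := tder _ cv; have [_ ->] := dcv.
  rewrite dTheta_graph//; last by rewrite -(range_section hb); exists v.
  have -> // : Theta \o (fun s0 : R => G ip F0 x0 iota D (gam s) (s0 *: v)) =
      (fun h : R => (Theta \o gam) (s + h)).
  apply/funext => h /=; congr Theta; rewrite /G.
  have -> : (gam s).1 + iota (h *: v) = (gam (s + h)).1.
    rewrite -[iota]/(linear_of il : _ -> _) linearZ /= vw.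
    by rewrite scalerDl addrA.
  by have [_ /= <-] := Mg (s + h).
have T01 : Theta (gam 1) = Theta (gam 0).
  apply/rowP => j.
  apply: (@is_derive_0_is_cst R (fun s => Theta (gam s) 0 j)) => s.
  have := is_derive_linear (L := linear_of (@coord_linear R m j))
    (@coord_continuous _ _ _ _ _) (dg s).
  by rewrite /= mxE.
move: T01; rewrite /gam scale1r scale0r addr0 T1 => <-.
by rewrite [x1 + _]addrC subrK.
Qed.

Section local_chart.
Variable a : chart_index N.
Let O := @cdom R C2 N a `&` chart a @^-1` U.
Local Notation theta := (Theta \o i \o @cmap R C2 N a).

Lemma chart_domain_open : open O.
Proof.
have [W oW UE] := oU.
have -> : O = @cdom R C2 N a `&` chart a @^-1` W.
  by rewrite /O UE; apply/seteqP; split=> b [ab] => [[]|Wb]; split=> //; split.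
exact: (C1_open_preimage (@cdom_open R C2 N a) (@chart1 a) oW).
Qed.

Lemma theta_C1 : C1_on O theta.
Proof. by have [] := sTheta a. Qed.

(** Both sides are the derivative of [Theta] along the image of a line. *)
Lemma theta_diff b h : O b ->
  'd theta b h = dTheta (chart a b) ('d (chart a) b h).
Proof.
move=> [ab Ub]; have [[tder _] _ _ _] := hTheta Ub.
have [cv dcv] := line_in_chart h ab.
have := tder _ cv; have [_ ->] := dcv => -[_ <-].
have db : differentiable theta (b + (0 : R) *: h).
  by rewrite scale0r addr0; apply: (C1_differentiable theta_C1).
have := is_derive_diff_line db; rewrite scale0r addr0 => -[_ <-].
by [].
Qed.

(** A chart of the zero set bundled with its inverse [zcoord].  Taking all such
    charts as the atlas avoids a choice of one chart for each point. *)
Record zero_chart_at := ZeroChart {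
  zdom : set (model a); zmod : set (Hp * 'rV[R]_m);
  zpar : Hp * 'rV[R]_m -> model a; zcoord : model a -> Hp * 'rV[R]_m;
  zdom_open : open zdom; zdom_sub : zdom `<=` O; zmod_open : open zmod;
  zpar_C1 : C1_on zmod zpar; zcoord_C1 : C1_on zdom zcoord;
  zparP : forall q, zmod q -> [/\ zdom (zpar q), theta (zpar q) = 0,
    zcoord (zpar q) = q, injective ('d zpar q) &
    range ('d zpar q) = [set k | 'd theta (zpar q) k = 0]];
  zcoordP : forall x, zdom x -> theta x = 0 ->
    zmod (zcoord x) /\ zpar (zcoord x) = x }.

(** The kernel of the differential of [theta] at [b] corresponds under ['d (chart a) b]
    to [kernel_space z], which [S] parametrizes by [Hp * 'rV_m].  All the maps
    that occur are continuous because ['d (chart a) b] and [S] are bounded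
    below. *)
Lemma zero_chart_ex b : O b -> theta b = 0 ->
  exists c : zero_chart_at, zdom c b.
Proof.
move=> Ob thb; have [ab Ub] := Ob.
set z := chart a b in Ub; have Mz : M z by exact: chartM.
have [[_ adj] onto char iso] := hTheta Ub.
have [C C0 CP] := chart_bounded_below ipE regi ab.
have injd : injective ('d (chart a) b).
  by have [[_ /(_ a)[_ /(_ b ab)[]]]] := regi.
have cd : continuous ('d (chart a) b).
  exact: diff_continuous (chart_differentiable regi ab).
have Tz : T z = range ('d (chart a) b) by exact: tangent_chart.
have ldT' := dTheta'_linear Ub.
pose S (q : Hp * 'rV[R]_m) := section_map iota D z.1 q.1 + J (dTheta' z q.2).
have lS : linear S.
  move=> r p q; rewrite /S/= (section_map_linear ha hb).
  by rewrite ldT' J_linear scalerDr addrACA.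
have SK q : kernel_space z (S q).
  apply/kernel_spaceP => //; exists (section_map iota D z.1 q.1), q.2.
  by split=> //; rewrite -(range_section hb); exists q.1.
have cS : continuous (linear_of lS).
  have c1 := @section_continuous R H ip F0 D0 dF0 Hp iota D ha hb hc z.1.
  have ljt : linear (fun v => J (dTheta' z v)).
    by move=> r p q; rewrite ldT' J_linear.
  have cj : continuous (fun v => J (dTheta' z v)).
    by have := @rV_linear_continuous R m _ (linear_of ljt).
  move=> q; apply: cvgD.
    apply: (@continuous_comp _ _ _ fst (section_map iota D z.1)); first exact: cvg_fst.
    exact: c1.
  apply: (@continuous_comp _ _ _ snd (fun v => J (dTheta' z v))); first exact: cvg_snd.
  exact: cj.
have rS : range S = kernel_space z.
  apply/seteqP; split=> [_ [q _ <-]//|t /kernel_spaceP-/(_ Ub)[w [v [Dw ->]]]].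
  by move: Dw; rewrite -(range_section hb) => -[u _ <-]; exists (u, v).
have injS : injective (linear_of lS).
  move=> q q' /= Sqq'; apply/eqP; rewrite -subr_eq0; apply/eqP.
  have : S (q - q') = 0.
    by rewrite -[S]/(linear_of lS : _ -> _) linearB /= Sqq' subrr.
  case: (q - q') => u v S0.
  have Du : graph (D z.1) (section_map iota D z.1 u).
    by rewrite -(range_section hb); exists u.
  have [u0 v0] := kernel_space_inj Ub Du S0; rewrite /= in v0.
  rewrite v0; congr (_, _).
  have [[il _ ii _ _] _] := hb; apply: ii.
  have i0 : iota 0 = 0 by rewrite -[iota]/(linear_of il : _ -> _) linear0.
  by have := congr1 fst u0; rewrite /= i0.
have clS : closed (range (linear_of lS)).
  by have := kernel_space_closed Ub; rewrite -rS.
have [CS CS0 CSP] := bounded_below ipE cS injS clS.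
have /choice[Q QE] : forall q, exists h, 'd (chart a) b h = S q.
  by move=> q; have [] := SK q; rewrite Tz => -[h _ <-]; exists h.
have lQ : linear Q.
  by move=> r p q; apply: injd; rewrite linearP !QE lS.
have injQ : injective Q.
  by move=> p q pq; apply: injS; rewrite /= -!QE pq.
have cQ : continuous (linear_of lQ).
  have [K K0 KP] := continuous_opnorm cS.
  apply: (opnorm_continuous (C := C * K)) => q /=.
  by rewrite (le_trans (CP _))// QE -mulrA ler_pM2l//; exact: KP.
have /choice[e eE] : forall k : 'I_m, exists h, 'd theta b h = delta_mx 0 k.
  move=> k; have [t Tt tE] : (dTheta z @` T z) (delta_mx 0 k) by rewrite onto.
  by move: Tt; rewrite Tz => -[h _ ht]; exists h; rewrite theta_diff// ht.
pose B (v : 'rV[R]_m) := \sum_k v 0 k *: e k.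
have lB : linear B.
  move=> r u v; rewrite /B scaler_sumr -big_split; apply: eq_bigr => k _ /=.
  by rewrite !mxE scalerDl scalerA.
have cB : continuous B by have := @rV_linear_continuous R m _ (linear_of lB).
have thB v : 'd theta b (B v) = v.
  rewrite linear_sum [RHS]row_sum_delta; apply: eq_bigr => k _.
  by rewrite linearZ /= eE.
have cth : continuous ('d theta b).
  by apply: diff_continuous; exact: (C1_differentiable theta_C1).
pose y x := x - B ('d theta b x).
have thy x : 'd theta b (y x) = 0 by rewrite linearB thB subrr.
have ly : linear (fun x => 'd (chart a) b (y x)).
  move=> r u v; rewrite /y linearP lB opprD addrACA -scalerBr.
  by rewrite linearP.
have cy : continuous (linear_of ly).
  move=> x; apply: (@continuous_comp _ _ _ y ('d (chart a) b)); last exact: cd.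
  apply: cvgB; first exact: cvg_id.
  apply: (@continuous_comp _ _ _ ('d theta b) B); first exact: cth.
  exact: cB.
have /choice[P PE] : forall x, exists q, Q q = y x.
  move=> x; have : kernel_space z ('d (chart a) b (y x)).
    split; first by rewrite Tz; exists (y x).
    by rewrite -theta_diff// thy.
  by rewrite -rS => -[q _ Sq]; exists q; apply: injd; rewrite QE.
have lP : linear P.
  move=> r u v; apply: injQ; rewrite lQ !PE /y linearP lB opprD addrACA.
  by rewrite -scalerBr.
have cP : continuous (linear_of lP).
  have [K K0 KP] := continuous_opnorm cy.
  apply: (opnorm_continuous (C := CS * K)) => x /=.
  rewrite (le_trans (CSP _))// -mulrA ler_pM2l//.
  by have := KP x; rewrite /= -PE QE.
have thQ q : 'd theta b (Q q) = 0.
  by rewrite theta_diff// QE; have [] := SK q.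
have B0 : B 0 = 0 by rewrite -[B]/(linear_of lB : _ -> _) linear0.
have QP : cancel (linear_of lQ) (linear_of lP).
  by move=> q; apply: injQ; rewrite /= PE /y thQ B0 subr0.
have QPA x : 'd theta b x = 0 -> linear_of lQ (linear_of lP x) = x.
  by move=> thx; rewrite /= PE /y thx B0 subr0.
have := @zero_chart R (model a) (Hp * 'rV[R]_m)%type m theta O b
  (linear_of lB) (linear_of lQ) (linear_of lP) chart_domain_open Ob theta_C1 thb
  cB cQ cP thB QP thQ QPA.
move=> [Om [W [chi [rho [[oOm Omb OmO oW] chi1 rho1 chiP rhoP]]]]].
by exists (ZeroChart oOm OmO oW chi1 rho1 chiP rhoP).
Qed.

End local_chart.
Arguments zdom_open {a} z.
Arguments zmod_open {a} z.
Arguments zpar_C1 {a} z.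
Arguments zcoord_C1 {a} z.
Variables (L : set (H * H)) (z0 : H * H).
Hypothesis hL : L = [set z | U z /\ Theta z = 0].
Hypothesis Lz0 : L z0.

Definition zero_points := {z : H * H | L z}.
Definition zero_index := {a : chart_index N & zero_chart_at a}.

(** The default value [z0] is taken outside the domain of the chart only. *)
Definition zero_map (c : zero_index) (q : Hp * 'rV[R]_m) : zero_points :=
  if pselect (L (chart (projT1 c) (zpar (projT2 c) q))) is left Lz
  then exist _ _ Lz else exist _ _ Lz0.

Let Y : completeNormedModType R := (Hp * 'rV[R]_m)%type.

Lemma zero_points_inj : injective (@sval _ _ : zero_points -> H * H).
Proof.
move=> [z Lz] [z' Lz'] /= zz'; move: Lz'; rewrite -zz' => Lz'.
by congr exist; exact: Prop_irrelevance.
Qed.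

Lemma zero_mapE c q : zmod (projT2 c) q ->
  sval (zero_map c q) = chart (projT1 c) (zpar (projT2 c) q).
Proof.
move=> cq; have [cz th _ _ _] := zparP cq.
rewrite /zero_map; case: pselect => //= nL; exfalso; apply: nL; rewrite hL.
by have [_ Uz] := zdom_sub cz.
Qed.

Lemma chart_inj a x x' : @cdom R C2 N a x -> @cdom R C2 N a x' ->
  chart a x = chart a x' -> x = x'.
Proof.
have [[ii _] _ _] := regi => ax ax' /ii.
by apply: (@cmap_inj R C2 N a); rewrite inE.
Qed.

Lemma zero_map_inj c : set_inj (zmod (projT2 c)) (zero_map c).
Proof.
move=> q q'; rewrite !inE => cq cq' /(congr1 sval).
have [/zdom_sub[d _] _ rq _ _] := zparP cq.
have [/zdom_sub[d' _] _ rq' _ _] := zparP cq'.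
by rewrite !zero_mapE// => /(chart_inj d d') E; rewrite -rq E rq'.
Qed.

Lemma zero_map_cover p : exists c, (zero_map c @` zmod (projT2 c)) p.
Proof.
case: p => z Lz; have [Uz thz] : U z /\ Theta z = 0 by move: (Lz); rewrite hL.
have [a [b [ab abz]]] := chart_cover (UM Uz).
have Ob : (@cdom R C2 N a `&` chart a @^-1` U) b.
  by split=> //; rewrite /preimage/= in abz *; rewrite abz.
have thb : (Theta \o i \o @cmap R C2 N a) b = 0 by rewrite /= in abz *; rewrite abz.
have [c cb] := zero_chart_ex Ob thb.
have [cq qb] := zcoordP cb thb.
exists (existT _ a c), (zcoord c b) => //=; apply: zero_points_inj.
by rewrite zero_mapE//= qb.
Qed.

(** The transition map is the transition map of [M] between the charts of the two
    parametrizations.  It respects the zero sets since [Theta] is a function on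
    [M]. *)
Lemma zero_transition (c c' : zero_index) :
  let O := zmod (projT2 c) `&`
    zero_map c @^-1` (zero_map c' @` zmod (projT2 c')) in
  open (O : set Y) /\
  exists tau : Y -> Y, smooth_on C1 (O : set Y) tau /\
    forall q, O q -> zmod (projT2 c') (tau q) /\ zero_map c' (tau q) = zero_map c q.
Proof.
case: c => a c; case: c' => a' c' O.
have [oON [tauN [stau tauP]]] := @transition R C2 N a a'.
have tau1 := smooth_on_C1 stau.
set ON := _ `&` _ in oON stau tauP tau1.
pose O1 := ON `&` tauN @^-1` zdom c'.
have oO1 : open O1 by exact: (C1_open_preimage oON tau1 (zdom_open c')).
have OE : O = zmod c `&` zpar c @^-1` O1.
  apply/seteqP; split=> q [cq].
    move=> [q' cq' /(congr1 sval)]; rewrite !zero_mapE//= => E.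
    have [/zdom_sub[d Ud] th _ _ _] := zparP cq.
    have [cz' th' _ _ _] := zparP cq'; have [d' Ud'] := zdom_sub cz'.
    have [[ii _] _ _] := regi; have {}E := ii _ _ E.
    have ONq : ON (zpar c q) by split=> //; exists (zpar c' q').
    split=> //; split=> //; have [dt tE] := tauP _ ONq.
    suff tq : tauN (zpar c q) = zpar c' q' by rewrite /preimage/= tq.
    by apply: (@cmap_inj R C2 N a'); rewrite ?inE// tE E.
  move=> [ONq cz']; split=> //.
  have [_ th _ _ _] := zparP cq; have [dt tE] := tauP _ ONq.
  have th' : (Theta \o i \o @cmap R C2 N a') (tauN (zpar c q)) = 0.
    by rewrite /= tE.
  have [cq' qE] := zcoordP cz' th'.
  exists (zcoord c' (tauN (zpar c q))) => //=; apply: zero_points_inj.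
  by rewrite !zero_mapE//= qE tE.
split.
  have oP := C1_open_preimage (zmod_open c) (zpar_C1 c) oO1.
  by rewrite OE; exact: oP.
exists (zcoord c' \o (tauN \o zpar c)); split.
  have H1 := C1_comp (zpar_C1 c) tau1 (zmod_open c) oON.
  have oH := C1_open_preimage (zmod_open c) (zpar_C1 c) oON.
  apply: C1_sub (C1_comp H1 (zcoord_C1 c') oH (zdom_open c')).
  by rewrite OE => q [cq [ONq cz']]; split.
move=> q; rewrite OE => -[cq [ONq cz']].
have [_ th _ _ _] := zparP cq; have [dt tE] := tauP _ ONq.
have th' : (Theta \o i \o @cmap R C2 N a') (tauN (zpar c q)) = 0.
  by rewrite /= tE.
have [cq' qE] := zcoordP cz' th'; split=> //=; apply: zero_points_inj.
by rewrite !zero_mapE//= qE tE.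
Qed.

Definition zero_set_manifold : manifold R C1 :=
  @Manifold R C1 zero_points zero_index (fun=> Y)
    (fun c => zmod (projT2 c)) zero_map
    (fun c => zmod_open (projT2 c)) zero_map_inj zero_map_cover zero_transition.

Lemma zero_chart_diff (c : zero_index) (q : Y) : zmod (projT2 c) q ->
  let z := chart (projT1 c) (zpar (projT2 c) q) in
  injective ('d (sval \o zero_map c : Y -> H * H) q) /\
  range ('d (sval \o zero_map c : Y -> H * H) q) = kernel_space z.
Proof.
case: c => a c /= cq.
have [cz th _ dinj dran] := zparP cq; have [az Uz] := zdom_sub cz.
set z := i _ in Uz *.
have dpar := C1_differentiable (zpar_C1 c) cq.
have dch := C1_differentiable (@chart1 a) az.
have nE : \forall r \near (q : Y),
    (chart a \o zpar c) r = sval (zero_map (existT _ a c) r).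
  apply: filterS (open_nbhs_nbhs (conj (zmod_open c) cq)) => r cr.
  by rewrite zero_mapE.
have [_ dE0] := near_eq_diff nE (differentiable_comp dpar dch).
have dE h : 'd (sval \o zero_map (existT _ a c) : Y -> H * H) q h =
    'd (chart a) (zpar c q) ('d (zpar c) q h).
  apply: etrans (congr1 (@^~ h) dE0) _.
  exact: (congr1 (@^~ h) (diff_comp dpar dch)).
have injc : injective ('d (chart a) (zpar c q)).
  by have [[_ /(_ a)[_ /(_ _ az)[]]]] := regi.
split.
  move=> h h' hh'; apply: dinj; apply: injc.
  by apply: etrans (esym (dE h)) _; apply: etrans (dE h').
have Tz : T z = range ('d (chart a) (zpar c q)) by exact: tangent_chart.
have Oz : (@cdom R C2 N a `&` chart a @^-1` U) (zpar c q) by split.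
apply/seteqP; split=> [_ [h _ <-]|t [Tt t0]].
  have ker : 'd (Theta \o i \o @cmap R C2 N a) (zpar c q) ('d (zpar c) q h) = 0.
    by have : range ('d (zpar c) q) ('d (zpar c) q h) by [exists h]; rewrite dran.
  rewrite dE; split; first by rewrite Tz; exists ('d (zpar c) q h).
  by apply: etrans ker; exact: (esym (theta_diff _ Oz)).
move: Tt; rewrite Tz => -[k _ kt].
have [h _ hk] : range ('d (zpar c) q) k.
  by rewrite dran; apply: etrans (theta_diff k Oz) _; rewrite kt.
exists h; first by [].
by apply: etrans (dE h) _; rewrite hk.
Qed.

Lemma zero_immersion :
  @injective_immersion R (H * H)%type C1 zero_set_manifold
    (@sval _ _ : zero_points -> H * H).
Proof.
split; first exact: zero_points_inj.
move=> c; split=> /= [|q cq].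
  have oc : open (zmod (projT2 c) : set Y) by exact: zmod_open.
  apply: (C1_eq (f := chart (projT1 c) \o zpar (projT2 c)) oc).
    by move=> q cq; rewrite /= zero_mapE.
  have := C1_comp (zpar_C1 (projT2 c)) (@chart1 (projT1 c)) oc
    (@cdom_open R C2 N (projT1 c)).
  apply: C1_sub => q cq; split=> //.
  by have [/zdom_sub[]] := zparP cq.
have [inj ran] := zero_chart_diff cq; split; first exact: inj.
rewrite ran; apply: kernel_space_closed.
by have [/zdom_sub[]] := zparP cq.
Qed.

Lemma zero_tangent (p : zero_points) :
  @tangent_image R (H * H)%type C1 zero_set_manifold
    (@sval _ _ : zero_points -> H * H) p = kernel_space (sval p).
Proof.
have val c q : zmod (projT2 c) q -> zero_map c q = p ->
    range ('d (sval \o zero_map c : Y -> H * H) q) = kernel_space (sval p).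
  move=> cq qp; have [_ ->] := zero_chart_diff cq.
  by rewrite -qp zero_mapE.
apply/seteqP; split=> [t [c [q [h [/= cq qp ->]]]]|t].
  by rewrite -(val c q cq qp); exists h.
have [c [q cq qp]] := zero_map_cover p.
by rewrite -(val c q cq qp) => -[h _ <-]; exists c, q, h.
Qed.

Lemma zero_submanifold : exists (Nz : manifold R C1) (iz : Nz -> H * H),
  [/\ injective_immersion iz, range iz = L &
      forall p, tangent_image iz p = kernel_space (iz p)].
Proof.
exists zero_set_manifold, (@sval _ _ : zero_points -> H * H); split.
- exact: zero_immersion.
- apply/seteqP; split=> [_ [[z Lz] _ <-] //|z Lz].
  by exists (exist _ z Lz).
- exact: zero_tangent.
Qed.

End zero_manifold.

(* [U] is a neighborhood of [L] in [M] that also contains [graph F0], as it must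
   when [graph F0 `<=` L]: replacing [L] and [U] by their intersections with a
   small ball around a point of [graph F0] preserves all the other hypotheses
   but not the conclusion. *)
Theorem theorem3p7 (R : realType) (H : completeNormedModType R)
    (ip : {dot H for idfun}) (ipE : forall x : H, ip x x = `|x| ^+ 2)
    (F0 : operator H) (D0 : set H) (x0 : H) (dF0 : H -> operator H)
    (Hp : completeNormedModType R) (iota : Hp -> H) (D : H -> operator H)
    (dD : H * H -> H * H -> Hp -> H) (D' : H -> Hp -> H -> H)
    (m : nat) (L : set (H * H)) :
  let M := maxgraph ip F0 x0 iota D in
  let T := tangent_space M in
  initial_operator ip F0 D0 x0 dF0 ->
  condition_a ip F0 dF0 D ->
  condition_b D0 iota D ->
  condition_c iota D ->
  condition_d ip F0 x0 iota D dD ->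
  condition_e ip F0 x0 iota D dD D' ->
  condition_f ip F0 x0 iota D D' ->
  regular_foliation ip F0 x0 iota D ->
  finite_defect ip F0 D m ->
  L `<=` M -> L !=set0 ->
  L `&` graph F0 !=set0 ->
  (exists (U : set (H * H)) (Theta : H * H -> 'rV[R]_m)
          (dTheta : H * H -> H * H -> 'rV[R]_m)
          (dTheta' : H * H -> 'rV[R]_m -> H * H),
     [/\ open_in M U, L `|` graph F0 `<=` U, C2_map M U Theta,
         L = [set z | U z /\ Theta z = 0] &
         forall z, U z ->
           [/\ tangent_derivative M Theta z (dTheta z) /\
                 is_adjoint ip (T z) (dTheta z) (dTheta' z),
               dTheta z @` T z = setT,
               range (dTheta' z) `<=`
                 characteristic_space ip F0 x0 iota D z &
               forall a, dTheta z (J (dTheta' z a)) = 0]]) ->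
  exists F : operator H,
    [/\ graph F = L, extension F F0 & locally_self_adjoint ip F].
Proof.
move=> M T hF0 ha hb hc _ _ _ hfol hdef LM _ [z1 [Lz1 F0z1]].
move=> [U [theta [dTheta [dTheta' [oU LFU [N [i [regi sTheta]]] hL hTheta]]]]].
have FU : graph F0 `<=` U by move=> z Fz; apply: LFU; right.
have LU : L `<=` U by move=> z Lz; apply: LFU; left.
have F0L : graph F0 `<=` L.
  have T1 : exists2 z, graph F0 z & theta z = 0.
    by exists z1 => //; move: Lz1; rewrite hL => -[].
  move=> z Fz; rewrite hL; split; first exact: FU.
  exact: (graph_F0_zero ipE hF0 ha hb hc hfol oU hTheta regi FU T1 Fz).
pose Fm := Fmax ip F0 x0 iota D.
pose F := Operator [set x | L (x, Fm x)] Fm.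
have gF : graph F = L.
  apply/seteqP; split=> [[x y] [/= Lx ->]|[x y] Lz] //.
  have yE : y = Fm x by have [_] := LM _ Lz.
  have Lx : L (x, Fm x) by rewrite -yE.
  by split.
have /choice[B BP] : forall z, exists B : operator H, L z ->
    self_adjoint ip B /\ graph B = kernel_space ip F0 x0 iota D dTheta z.
  move=> z; have [Lz|nLz] := pselect (L z); last by exists F0.
  have [B sB gB] := kernel_space_self_adjoint ipE hF0 ha hb hc hfol hdef oU
    hTheta regi (LU _ Lz).
  by exists B.
exists F; split=> //; first by rewrite /extension gF.
pose dF x := B (x, Fm x).
have FE z : L z -> (z.1, Fm z.1) = z.
  by case: z => x y /LM[/= _ ->].
exists dF; split; last first.
  by move=> x /= Lx; have [] := BP _ Lx.
have [Nz [iz [imm ran tan]]] := zero_submanifold ipE hF0 ha hb hc hfol hdef oU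
  hTheta regi sTheta hL Lz1.
exists Nz, iz; split=> //; first by rewrite gF.
move=> p; have Lp : L (iz p) by rewrite -ran; exists p.
rewrite tan /dF FE//; have [[lB _ _] gB] := BP _ Lp.
by split.
Qed.
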